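(* Assume that (i) each entry $\sigma^{(ij)}$, $(i,j)\in\{1,\dots,d_x\}^2$, is bounded and Lipschitz with respect to $\|\cdot\|_2$ on $\mathbb{R}^{d_x}$ and $a(x):=\sigma(x)\sigma(x)^*$ is uniformly elliptic; (ii) each $h^{(i)}$, $i\in\{1,\dots,d_y\}$, and each $b^{(j)}$, $j\in\{1,\dots,d_x\}$, is bounded and Lipschitz with respect to $\|\cdot\|_2$ on $\mathbb{R}^{d_x}$. Let $P$ be a positive probability mass function on $\{0,1,\dots\}$ and $Q(l)=\sum_{q=l}^\infty P(q)$. Then for any $t\in\mathbb{N}$ there exists a constant $C<+\infty$ such that for any $N\in\mathbb{N}$ and any bounded measurable $\varphi:\mathbb{R}^{d_x}\to\mathbb{R}$ that is Lipschitz with respect to $\|\cdot\|_2$, the single term estimator $\gamma_{t,ST}(\varphi)$ and the coupled sum estimator $\gamma_{t,CS}(\varphi)$ (built with $P$ and $N$ samples per level) satisfy $$\overline{\mathbb{E}}[\gamma_{t,ST}(\varphi)^2]\le C(\|\varphi\|+\|\varphi\|_{\mathrm{Lip}})^2\sum_{l=0}^\infty\frac{1}{P(l)}\Big\{\frac{\Delta_l^{1/2}}{N}+\Delta_l\Big\},$$ $$\overline{\mathbb{E}}[\gamma_{t,CS}(\varphi)^2]\le C(\|\varphi\|+\|\varphi\|_{\mathrm{Lip}})^2\sum_{l=0}^\infty\frac{1}{Q(l)}\Big\{\frac{\Delta_l^{1/2}}{N}+\Delta_l\Big\}.$$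
   Context: **Model.** $\mathbb{N}=\{1,2,\dots\}$, $\mathbb{N}_0=\mathbb{N}\cup\{0\}$; $^*$ denotes transpose; empty products equal $1$; $\|\varphi\|=\sup_x|\varphi(x)|$ and $\|\varphi\|_{\mathrm{Lip}}$ is the Lipschitz constant of $\varphi$ with respect to $\|\cdot\|_2$. The infinite series in the bounds have nonnegative terms and may equal $+\infty$. $d_x,d_y\in\mathbb{N}$, $x_*\in\mathbb{R}^{d_x}$, $h:\mathbb{R}^{d_x}\to\mathbb{R}^{d_y}$, $b:\mathbb{R}^{d_x}\to\mathbb{R}^{d_x}$, $\sigma:\mathbb{R}^{d_x}\to\mathbb{R}^{d_x\times d_x}$, with $\sigma$ non-constant and of full rank. Under the probability measure $\overline{\mathbb{P}}$ (expectation $\overline{\mathbb{E}}$), the data $\{Y_t\}_{t\ge0}$ is a standard $d_y$-dimensional Brownian motion (independent of the signal $dX_t=b(X_t)dt+\sigma(X_t)dW_t$, $X_0=x_*$, with $W$ a standard $d_x$-dimensional Brownian motion). **Discretized model.** For $l\in\mathbb{N}_0$ let $\Delta_l=2^{-l}$. For $k\in\mathbb{N}_0$, $x\in\mathbb{R}^{d_x}$ set $$G_k^l(x)=\exp\Big\{h(x)^*(Y_{(k+1)\Delta_l}-Y_{k\Delta_l})-\tfrac{\Delta_l}{2}h(x)^*h(x)\Big\}.$$ For $p\in\mathbb{N}_0$ and a path $x_{p:p+1-\Delta_l}=(x_p,x_{p+\Delta_l},\dots,x_{p+1-\Delta_l})$ set $\mathbf{G}_p^l(x_{p:p+1-\Delta_l})=\prod_{k=0}^{\Delta_l^{-1}-1}G^l_{p\Delta_l^{-1}+k}(x_{p+k\Delta_l})$.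 **Particle filter (PF) at level $l$ with $N$ samples.** All simulation randomness is generated independently of $W$ and, conditionally on the data $Y$, as follows. For $x\in\mathbb{R}^{d_x}$ let $M^l(x,\cdot)$ be the law of the Euler path $(x_0,x_{\Delta_l},\dots,x_1)$ of step $\Delta_l$ started at $x_0=x$, i.e. $x_{k\Delta_l}=x_{(k-1)\Delta_l}+b(x_{(k-1)\Delta_l})\Delta_l+\sigma(x_{(k-1)\Delta_l})V_{k\Delta_l}$ with i.i.d. $V_{k\Delta_l}\sim\mathcal{N}_{d_x}(0,\Delta_l I)$. (1) For $i=1,\dots,N$ draw independently $(x_0^{l,i},\dots,x_1^{l,i})\sim M^l(x_*,\cdot)$. (2) For $p=1,2,\dots$: given the past, draw independently for $i=1,\dots,N$ the path $(x_p^{l,i},\dots,x_{p+1}^{l,i})$ from the mixture $\sum_{k=1}^N\frac{\mathbf{G}_{p-1}^l(x_{p-1:p-\Delta_l}^{l,k})}{\sum_{j=1}^N\mathbf{G}_{p-1}^l(x_{p-1:p-\Delta_l}^{l,j})}M^l(x_p^{l,k},\cdot)$, where the $x^{l,k}_p$ in the mixture are the end points of the previous paths (before resampling). Put $$\gamma_{t,PF}^{l,N}(\varphi)=\Big[\prod_{p=0}^{t-2}\frac1N\sum_{i=1}^N\mathbf{G}_p^l(x_{p:p+1-\Delta_l}^{l,i})\Big]\frac1N\sum_{i=1}^N\mathbf{G}_{t-1}^l(x_{t-1:t-\Delta_l}^{l,i})\varphi(x_t^{l,i}),$$ where in the factor with index $p$ (and $t-1$) the path generated over $[p,p+1]$ (respectively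 $[t-1,t]$, with end point $x_t^{l,i}$) is used. **Coupled particle filter (CPF) at level $l\ge1$ with $N$ samples.** The kernel $\check M^l((x,\check x),\cdot)$ is the law of the pair of paths $((x_0,x_{\Delta_l},\dots,x_1),(\check x_0,\check x_{\Delta_{l-1}},\dots,\check x_1))$ with $x_0=x$, $\check x_0=\check x$, built from i.i.d. $V_{k\Delta_l}\sim\mathcal{N}_{d_x}(0,\Delta_l I)$, $k=1,\dots,\Delta_l^{-1}$, by $x_{k\Delta_l}=x_{(k-1)\Delta_l}+b(x_{(k-1)\Delta_l})\Delta_l+\sigma(x_{(k-1)\Delta_l})V_{k\Delta_l}$ and $\check x_{k\Delta_{l-1}}=\check x_{(k-1)\Delta_{l-1}}+b(\check x_{(k-1)\Delta_{l-1}})\Delta_{l-1}+\sigma(\check x_{(k-1)\Delta_{l-1}})[V_{(2k-1)\Delta_l}+V_{2k\Delta_l}]$. The maximal coupling of two probability mass functions $(r_1^i)$, $(r_2^i)$ on $\{1,\dots,N\}$ is the law of $(i,j)$ obtained so: with $\bar r=\sum_i\min\{r_1^i,r_2^i\}$, with probability $\bar r$ draw $i$ from $\min\{r_1^i,r_2^i\}/\bar r$ and set $j=i$; otherwise draw independently $i$ from $(r_1^i-\min\{r_1^i,r_2^i\})/(1-\bar r)$ and $j$ from $(r_2^j-\min\{r_1^j,r_2^j\})/(1-\bar r)$. The CPF: (1) for $i=1,\dots,N$ draw independently $((x_0^{l,i},\dots,x_1^{l,i}),(\check x_0^{l-1,i},\dots,\check x_1^{l-1,i}))\sim\check M^l((x_*,x_*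 ),\cdot)$. (2) For $p=1,2,\dots$: given the past, independently for $i=1,\dots,N$ draw indices $(s,\check s)=(s_{p-1}^{l,i},\check s_{p-1}^{l-1,i})$ from the maximal coupling of the mass functions $k\mapsto\mathbf{G}_{p-1}^l(x_{p-1:p-\Delta_l}^{l,k})/\sum_j\mathbf{G}_{p-1}^l(x_{p-1:p-\Delta_l}^{l,j})$ and $k\mapsto\mathbf{G}_{p-1}^{l-1}(\check x_{p-1:p-\Delta_{l-1}}^{l-1,k})/\sum_j\mathbf{G}_{p-1}^{l-1}(\check x_{p-1:p-\Delta_{l-1}}^{l-1,j})$, then draw the new pair of paths $((x_p^{l,i},\dots,x_{p+1}^{l,i}),(\check x_p^{l-1,i},\dots,\check x_{p+1}^{l-1,i}))\sim\check M^l((x_p^{l,s},\check x_p^{l-1,\check s}),\cdot)$, started at the end points of the selected previous paths. Put $$[\gamma_t^l-\gamma_t^{l-1}]^N_{CPF}(\varphi)=\Big[\prod_{p=0}^{t-2}\frac1N\sum_{i}\mathbf{G}_p^l(x_{p:p+1-\Delta_l}^{l,i})\Big]\frac1N\sum_i\mathbf{G}_{t-1}^l(x_{t-1:t-\Delta_l}^{l,i})\varphi(x_t^{l,i})-\Big[\prod_{p=0}^{t-2}\frac1N\sum_i\mathbf{G}_p^{l-1}(\check x_{p:p+1-\Delta_{l-1}}^{l-1,i})\Big]\frac1N\sum_i\mathbf{G}_{t-1}^{l-1}(\check x_{t-1:t-\Delta_{l-1}}^{l-1,i})\varphi(\check x_t^{l-1,i}),$$ with all sums over $i\in\{1,\dots,N\}$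 and the same convention on which paths are used. **Randomized estimators.** Put $\Psi_t^0(\varphi)=\gamma_{t,PF}^{0,N}(\varphi)$ and $\Psi_t^l(\varphi)=[\gamma_t^l-\gamma_t^{l-1}]_{CPF}^N(\varphi)$ for $l\ge1$, with the same $N$ for every level, where the filters at different levels are run independently of each other (conditionally on the data). Let $L$ be a random variable on $\{0,1,\dots\}$ with mass function $P$, independent of $(\Psi_t^l(\varphi))_{l\ge0}$ and of the data. The single term estimator is $\gamma_{t,ST}(\varphi)=\Psi_t^L(\varphi)/P(L)$. The coupled sum estimator is $\gamma_{t,CS}(\varphi)=\Psi_t^0(\varphi)+\sum_{l=1}^L\Psi_t^l(\varphi)/Q(l)$ (equal to $\Psi_t^0(\varphi)$ if $L=0$). *)

(* Defs.v *)
From HB Require Import structures.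
From mathcomp Require Import all_boot all_order all_algebra.
From mathcomp Require Import all_classical all_reals all_analysis.
Set Implicit Arguments.
Unset Strict Implicit.
Unset Printing Implicit Defensive.
Import Order.TTheory GRing.Theory Num.Theory.
Import numFieldNormedType.Exports.
Local Open Scope classical_set_scope.
Local Open Scope ring_scope.

(* Vectors of R^n are n-tuples: these carry the product (Borel) sigma-algebra
   of the library, which matrices do not. *)

Definition edist (R : realType) (n : nat) (x y : n.-tuple R) : R :=
  Num.sqrt (\sum_(i < n) (tnth x i - tnth y i) ^+ 2).

Definition bounded_real (R : realType) (T : Type) (f : T -> R) : Prop :=
  exists M : R, forall x, `|f x| <= M.

Definition lipschitz2 (R : realType) (n : nat) (f : n.-tuple R -> R) : Prop :=
  exists K : R, forall x y, `|f x - f y| <= K * edist x y.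

Definition sup_norm (R : realType) (T : Type) (f : T -> R) : R :=
  sup [set `|f x| | x in [set: T]].

Definition lip_const (R : realType) (n : nat) (f : n.-tuple R -> R) : R :=
  sup [set r | exists x y : n.-tuple R,
                 x <> y /\ r = `|f x - f y| / edist x y].

Definition uniformly_elliptic (R : realType) (n : nat)
    (a : n.-tuple R -> 'M[R]_n) : Prop :=
  exists2 c : R, 0 < c &
    forall (x : n.-tuple R) (u : 'cV[R]_n),
      c * (u^T *m u) 0 0 <= (u^T *m a x *m u) 0 0.

Section Brownian.
Context (R : realType) (d : measure_display) (Omega : measurableType d).

Definition generated_by (d' : measure_display) (T : measurableType d')
    (X : Omega -> T) : set_system Omega :=
  preimage_set_system [set: Omega] X measurable.

(* Y s is only relevant for s >= 0. *)
Definition process_events (n : nat) (Y : R -> Omega -> n.-tuple R)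
    (I : set R) : set_system Omega :=
  \bigcup_(s in I) generated_by (Y s).

(* The last clause says at once that Y_t - Y_s is independent of
   sigma(Y_u, u <= s) and has law N(0, (t - s) I). *)
Definition standard_brownian_motion (Pr : probability Omega R) (n : nat)
    (Y : R -> Omega -> n.-tuple R) : Prop :=
  [/\ forall s, 0 <= s -> measurable_fun [set: Omega] (Y s),
      {ae Pr, forall w, forall j, tnth (Y 0 w) j = 0},
      {ae Pr, forall w, forall j,
         {within [set s | 0 <= s], continuous (fun s => tnth (Y s w) j)}} &
      forall (s t : R) (A : set Omega) (B : 'I_n -> set R),
        0 <= s -> s < t ->
        <<s process_events Y [set u | 0 <= u <= s] >> A ->
        (forall j, measurable (B j)) ->
        Pr (A `&` [set w | forall j, B j (tnth (Y t w) j - tnth (Y s w) j)])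
        = (Pr A * \big[*%E/1%E]_(j < n)
                    normal_prob 0 (Num.sqrt (t - s)) (B j))%E].

End Brownian.

Definition delta (R : realType) (l : nat) : R := (2 ^+ l)^-1.

(* Integral of f against the n-fold product of the law whose integral
   operator is I. *)
Fixpoint iid_integral (R : realType) (T : Type) (I : (T -> \bar R) -> \bar R)
    (n : nat) : (n.-tuple T -> \bar R) -> \bar R :=
  match n with
  | 0 => fun f => f [tuple]
  | m.+1 => fun f =>
      I (fun v => @iid_integral R T I m (fun u => f [tuple of v :: u]))
  end.

(* Integral against N_n(0, v I); normal_prob takes the standard deviation. *)
Definition gauss_vec_integral (R : realType) (n : nat) (v : R) :
    (n.-tuple R -> \bar R) -> \bar R :=
  @iid_integral R R
    (fun f => (\int[normal_prob 0 (Num.sqrt v)]_z f z)%E) n.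

(* A path (x_p, x_(p + Delta_l), ..., x_(p+1)) at level l. *)
Definition level_path (R : realType) (dx l : nat) := (2 ^ l).+1.-tuple (dx.-tuple R).

Definition endpoint (R : realType) (dx l : nat) (u : level_path R dx l) :
  dx.-tuple R := tnth u ord_max.

Section Euler.
Context (R : realType) (dx : nat).
Context (b : dx.-tuple R -> dx.-tuple R) (sigma : dx.-tuple R -> 'M[R]_dx).
Implicit Types (x v : dx.-tuple R).

Definition euler_step (l : nat) x v : dx.-tuple R :=
  [tuple tnth x i + tnth (b x) i * delta R l
         + \sum_(j < dx) sigma x i j * tnth v j | i < dx].

Definition euler_path (l : nat) x (v : (2 ^ l).-tuple (dx.-tuple R)) :
    level_path R dx l :=
  [tuple of x :: scanl (euler_step l) x v].

(* Coarse increments V_(2k-1) + V_(2k), k = 1, ..., 2^l (the 0-based positions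
   are 2k and 2k+1, k < 2^l; the default of nth is never reached). *)
Definition coarsen (l : nat) (v : (2 ^ l.+1).-tuple (dx.-tuple R)) :
    (2 ^ l).-tuple (dx.-tuple R) :=
  let V k := nth [tuple 0 | _ < dx] v k in
  [tuple [tuple tnth (V k.*2) i + tnth (V k.*2.+1) i | i < dx] | k < 2 ^ l].

(* M^l(x, .) *)
Definition euler_law (l : nat) x (B : set (level_path R dx l)) : \bar R :=
  iid_integral (@gauss_vec_integral R dx (delta R l))
    (fun v : (2 ^ l).-tuple (dx.-tuple R) => (\1_B (euler_path x v))%:E).

(* The coupled kernel at level l.+1: fine paths live at level l.+1 and coarse
   paths at level l. *)
Definition coupled_euler_law (l : nat) x xc
    (B : set (level_path R dx l.+1 * level_path R dx l)) : \bar R :=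
  iid_integral (@gauss_vec_integral R dx (delta R l.+1))
    (fun v : (2 ^ l.+1).-tuple (dx.-tuple R) =>
       (\1_B (euler_path x v, euler_path xc (coarsen v)))%:E).

End Euler.

Section Potentials.
Context (R : realType) (dx dy : nat) (h : dx.-tuple R -> dy.-tuple R).
(* a trajectory of the data *)
Context (y : R -> dy.-tuple R).

Definition potential (l k : nat) (x : dx.-tuple R) : R :=
  expR (\sum_(j < dy) tnth (h x) j *
          (tnth (y (k.+1%:R * delta R l)) j - tnth (y (k%:R * delta R l)) j)
        - delta R l / 2 * \sum_(j < dy) tnth (h x) j * tnth (h x) j).

(* The end point of the path does not enter. *)
Definition path_potential (l p : nat) (u : level_path R dx l) : R :=
  \prod_(k < 2 ^ l)
    potential l (p * 2 ^ l + k) (tnth u (widen_ord (leqnSn _) k)).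

Definition weight (l N p : nat) (u : 'I_N -> level_path R dx l) (k : 'I_N) : R :=
  path_potential p (u k) / \sum_(j < N) path_potential p (u j).

(* u p i is the i-th path over [p, p+1]; meant for t >= 1. *)
Definition gamma_estimate (l N t : nat) (u : nat -> 'I_N -> level_path R dx l)
    (phi : dx.-tuple R -> R) : R :=
  (\prod_(p < t.-1) (N%:R^-1 * \sum_(i < N) path_potential p (u p i))) *
  (N%:R^-1 * \sum_(i < N)
     path_potential t.-1 (u t.-1 i) * phi (endpoint (u t.-1 i))).

End Potentials.

(* With x / 0 = 0 the degenerate cases rbar = 0 and rbar = 1 come out right. *)
Definition maximal_coupling (R : realType) (N : nat) (r1 r2 : 'I_N -> R)
    (i j : 'I_N) : R :=
  let m k := Num.min (r1 k) (r2 k) in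
  let rbar := \sum_(k < N) m k in
  rbar * (if i == j then m i / rbar else 0)
  + (1 - rbar) * ((r1 i - m i) / (1 - rbar) * ((r2 j - m j) / (1 - rbar))).

(* The random variables produced by the filters with N samples: the particle
   filter at level 0 and, for each l, the coupled particle filter at level
   l.+1. The paths with index p are those over [p, p+1]; the indices with
   index p select the parents of the paths with index p.+1. *)
Record filters (R : realType) (dx N : nat) (Omega : Type) := Filters {
  pf_path : nat -> 'I_N -> Omega -> level_path R dx 0;
  cpf_fine : forall l : nat, nat -> 'I_N -> Omega -> level_path R dx l.+1;
  cpf_coarse : forall l : nat, nat -> 'I_N -> Omega -> level_path R dx l;
  cpf_fine_index : nat -> nat -> 'I_N -> Omega -> 'I_N;
  cpf_coarse_index : nat -> nat -> 'I_N -> Omega -> 'I_N }.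

Section Filtering.
Context (R : realType) (dx dy : nat) (xstar : dx.-tuple R).
Context (h : dx.-tuple R -> dy.-tuple R) (b : dx.-tuple R -> dx.-tuple R).
Context (sigma : dx.-tuple R -> 'M[R]_dx).
Context (d : measure_display) (Omega : measurableType d).
Context (Pr : probability Omega R) (Y : R -> Omega -> dy.-tuple R).
Context (N : nat) (F : filters R dx N Omega).

(* Events read off from the first p rounds (the paths with index < p, and the
   indices used to generate them) of the filter at level q. *)
Definition level_events (q p : nat) : set_system Omega :=
  match q with
  | 0 => [set A | exists r i, (r < p)%N /\ generated_by (pf_path F r i) A]
  | l.+1 => [set A | exists r i, (r < p)%N /\
               (generated_by (cpf_fine F l r i) A \/
                generated_by (cpf_coarse F l r i) A)] `|`
            [set A | exists r i s, (r.+1 < p)%N /\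
               (A = [set w | cpf_fine_index F l r i w = s] \/
                A = [set w | cpf_coarse_index F l r i w = s])]
  end.

(* Everything a draw of the filter at level q in round p is conditioned upon:
   the whole data, the past of that filter, and the filters at all the other
   levels. Conditioning on the latter while drawing from a law that depends
   only on the data and the past of the filter itself expresses that the levels
   are run independently of each other given the data. *)
Definition past (q p : nat) : set_system Omega :=
  <<s process_events Y [set s | 0 <= s] `|` level_events q p `|`
      [set A | exists q' p', q' <> q /\ level_events q' p' A] >>.

Definition data (w : Omega) : R -> dy.-tuple R := fun s => Y s w.

Definition is_particle_filter : Prop :=
  [/\ forall p i, measurable_fun [set: Omega] (pf_path F p i),
      forall (A : set Omega) (B : 'I_N -> set (level_path R dx 0)),
        past 0 0 A -> (forall i, measurable (B i)) ->
        Pr (A `&` [set w | forall i, B i (pf_path F 0 i w)])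
        = (Pr A * \big[*%E/1%E]_(i < N) euler_law b sigma xstar (B i))%E &
      forall (p : nat) (A : set Omega) (B : 'I_N -> set (level_path R dx 0)),
        past 0 p.+1 A -> (forall i, measurable (B i)) ->
        Pr (A `&` [set w | forall i, B i (pf_path F p.+1 i w)])
        = (\int[Pr]_(w in A) \big[*%E/1%E]_(i < N) \sum_(k < N)
             (weight h (data w) p (fun j => pf_path F p j w) k)%:E *
             euler_law b sigma (endpoint (pf_path F p k w)) (B i))%E].

(* The coupled particle filter at level l.+1. *)
Definition is_coupled_particle_filter (l : nat) : Prop :=
  [/\ forall p i, measurable_fun [set: Omega] (cpf_fine F l p i) /\
                  measurable_fun [set: Omega] (cpf_coarse F l p i),
      forall p i s,
        measurable [set w | cpf_fine_index F l p i w = s] /\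
        measurable [set w | cpf_coarse_index F l p i w = s],
      forall (A : set Omega) (B : 'I_N -> set (level_path R dx l.+1 * level_path R dx l)),
        past l.+1 0 A -> (forall i, measurable (B i)) ->
        Pr (A `&` [set w | forall i,
                     B i (cpf_fine F l 0 i w, cpf_coarse F l 0 i w)])
        = (Pr A * \big[*%E/1%E]_(i < N)
                    coupled_euler_law b sigma xstar xstar (B i))%E &
      forall (p : nat) (A : set Omega) (s sc : 'I_N -> 'I_N)
        (B : 'I_N -> set (level_path R dx l.+1 * level_path R dx l)),
        past l.+1 p.+1 A -> (forall i, measurable (B i)) ->
        Pr (A `&` [set w | forall i,
                     [/\ cpf_fine_index F l p i w = s i,
                         cpf_coarse_index F l p i w = sc i &
                         B i (cpf_fine F l p.+1 i w, cpf_coarse F l p.+1 i w)]])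
        = (\int[Pr]_(w in A) \big[*%E/1%E]_(i < N)
             ((maximal_coupling
                 (weight h (data w) p (fun j => cpf_fine F l p j w))
                 (weight h (data w) p (fun j => cpf_coarse F l p j w))
                 (s i) (sc i))%:E *
              coupled_euler_law b sigma
                (endpoint (cpf_fine F l p (s i) w))
                (endpoint (cpf_coarse F l p (sc i) w)) (B i)))%E].

Definition runs_filters : Prop :=
  is_particle_filter /\ forall l, is_coupled_particle_filter l.

Definition Psi (t : nat) (phi : dx.-tuple R -> R) (q : nat) (w : Omega) : R :=
  match q with
  | 0 => gamma_estimate h (data w) t (fun p i => pf_path F p i w) phi
  | l.+1 =>
      gamma_estimate h (data w) t (fun p i => cpf_fine F l p i w) phi
      - gamma_estimate h (data w) t (fun p i => cpf_coarse F l p i w) phi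
  end.

Definition single_term (P : nat -> R) (L : Omega -> nat) (t : nat)
    (phi : dx.-tuple R -> R) (w : Omega) : R :=
  Psi t phi (L w) w / P (L w).

Definition coupled_sum (Q : nat -> R) (L : Omega -> nat) (t : nat)
    (phi : dx.-tuple R -> R) (w : Omega) : R :=
  Psi t phi 0 w + \sum_(1 <= l < (L w).+1) Psi t phi l w / Q l.

(* L has mass function P and is independent of the data and of the Psi_t^l. *)
Definition is_random_level (P : nat -> R) (t : nat) (phi : dx.-tuple R -> R)
    (L : Omega -> nat) : Prop :=
  [/\ measurable_fun [set: Omega] L,
      forall l, Pr [set w | L w = l] = (P l)%:E &
      forall (l : nat) (A : set Omega),
        <<s process_events Y [set s | 0 <= s] `|`
            [set A | exists q, generated_by (Psi t phi q) A] >> A ->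
        Pr ([set w | L w = l] `&` A) = (Pr [set w | L w = l] * Pr A)%E].

End Filtering.

Definition positive_pmf (R : realType) (P : nat -> R) : Prop :=
  (forall l, 0 < P l) /\ (\sum_(0 <= l <oo) (P l)%:E = 1)%E.

Definition tail_mass (R : realType) (P : nat -> R) (l : nat) : R :=
  fine (\sum_(l <= q <oo) (P q)%:E)%E.

(* Main.v *)
(* The square of an estimator is a functional of the data and of the particles.
   Blocks of Brownian increments over unit intervals are i.i.d. Gaussian, so the
   data can be averaged round by round, and the coupled filter becomes a Markov
   chain on (products of normalizing constants, particle pairs).

   Two facts about one round at step [D] drive the bound. First, Euler paths with
   common noise started at [x, x'] have a mean path cost of order
   [q x x' = min 1 |x - x'|^2 + D], and the mean over the data of [(G - G')^2] is
   of the order of the path cost. Second, under maximal coupling the probability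
   of selecting different parents is at most the normalized sum of [|G - G'|].
   Hence, with [Z, Z'] the products of normalizing constants,
   [(Z - Z')^2 + (Z^2 + Z'^2) * mean Theta], where [Theta] is of order [sqrt q] in
   mean, grows by at most a constant factor per round and starts at order
   [sqrt D]. It bounds the conditional variances, each of which carries a factor
   [1 / N]; the bias, propagated backwards through the semigroup, is of order [D].
   The second moment at level [l] is therefore of order
   [nu l = sqrt (Delta l) / N + Delta l].

   The single term estimator follows by conditioning on [L]. For the coupled sum,
   summation by parts against the tail mass [Q] leaves the cross terms
   [Psi_j Psi_l / Q j], [j < l], whose means are at most geometrically small
   multiples of [nu j / Q j], as [nu] itself decays geometrically: no independence
   across levels is needed. *)
From HB Require Import structures.
Require Import Defs.
From mathcomp Require Import all_boot all_order all_algebra.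
From mathcomp Require Import all_classical all_reals all_analysis.
From mathcomp Require Import measurable_realfun ring lra.
Set Implicit Arguments.
Unset Strict Implicit.
Unset Printing Implicit Defensive.
Import Order.TTheory GRing.Theory Num.Theory.
Import numFieldNormedType.Exports.
Local Open Scope classical_set_scope.
Local Open Scope ring_scope.

(** * Integrals of nonnegative measurable functions *)

(** The obstacle is that the potentials are exponentials of the data, in general neither bounded nor
    bounded below uniformly in the data, so the normalized weights cannot be estimated one
    realization at a time. Every one-round estimate is therefore arranged to be at most quadratic in
    the potentials of the current block: multiplying by the squared normalizing constants clears the
    denominators of the weights, and only second moments over the block remain, which are explicit
    Gaussian integrals. The rate [sqrt D] instead of [D] in the variance is the price of selection:
    a pair with distinct parents may be at distance of order one, and this has a probability of the
    order of a first moment of [|G - G'|], the root of the path cost. The weighted inequality that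
    bounds this first moment uses as weight [sqrt q] at the start of the path, a quantity fixed
    before the path is drawn and the block is revealed; hence the form of [Theta]. The bias escapes
    the loss because the marginals of the maximal coupling are the exact weights of the two
    filters. *)

Section nonneg_measurable.
Context {R : realType}.

(** For such integrands Tonelli, linearity and monotonicity hold without integrability conditions;
    almost all moments below are integrals of this kind. *)
Definition nnm d (T : measurableType d) (f : T -> \bar R) : Prop :=
  measurable_fun setT f /\ (forall x, 0 <= f x)%E.

Lemma nnm_comp d1 d2 (T1 : measurableType d1) (T2 : measurableType d2)
    (f : T2 -> \bar R) (g : T1 -> T2) :
  nnm f -> measurable_fun setT g -> nnm (fun x => f (g x)).
Proof. by move=> [mf f0] mg; split=> // ; exact: measurableT_comp. Qed.

Lemma nnm_pair1 d1 d2 (T1 : measurableType d1) (T2 : measurableType d2)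
    (f : T1 * T2 -> \bar R) (y : T2) : nnm f -> nnm (fun x => f (x, y)).
Proof. by move=> nf; exact: (nnm_comp nf (measurable_pair2 y)). Qed.

Lemma nnm_pair2 d1 d2 (T1 : measurableType d1) (T2 : measurableType d2)
    (f : T1 * T2 -> \bar R) (x : T1) : nnm f -> nnm (fun y => f (x, y)).
Proof. by move=> nf; exact: (nnm_comp nf (measurable_pair1 x)). Qed.

Lemma nnm_add d (T : measurableType d) (f g : T -> \bar R) :
  nnm f -> nnm g -> nnm (fun x => f x + g x)%E.
Proof.
by move=> [mf f0] [mg g0]; split=> [|x]; [exact: emeasurable_funD|exact: adde_ge0].
Qed.

Lemma nnm_mul d (T : measurableType d) (f g : T -> \bar R) :
  nnm f -> nnm g -> nnm (fun x => f x * g x)%E.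
Proof.
by move=> [mf f0] [mg g0]; split=> [|x]; [exact: emeasurable_funM|exact: mule_ge0].
Qed.

Lemma nnm_sum d (T : measurableType d) (I : Type) (s : seq I) (P : pred I)
    (f : I -> T -> \bar R) :
  (forall i, nnm (f i)) -> nnm (fun x => \sum_(i <- s | P i) f i x)%E.
Proof.
move=> nf; split=> [|x]; last by apply: sume_ge0 => i _; case: (nf i).
by under eq_fun do rewrite big_mkcond /=; apply: emeasurable_sum => i;
  case: (P i) => //; case: (nf i).
Qed.

Lemma nnm_prod d (T : measurableType d) (I : Type) (s : seq I)
    (f : I -> T -> \bar R) :
  (forall i, nnm (f i)) -> nnm (fun x => \big[*%E/1%E]_(i <- s) f i x)%E.
Proof.
move=> nf; elim: s => [|i s IH].
  by under eq_fun do rewrite big_nil; split.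
by under eq_fun do rewrite big_cons; exact: nnm_mul.
Qed.

Lemma nnm_EFin d (T : measurableType d) (f : T -> R) :
  measurable_fun setT f -> (forall x, 0 <= f x) -> nnm (fun x => (f x)%:E).
Proof. by move=> mf f0; split=> [|x]; [exact/measurable_EFinP|rewrite lee_fin]. Qed.

Lemma nnm_indic d (T : measurableType d) (A : set T) :
  measurable A -> nnm (fun x => (\1_A x)%:E : \bar R).
Proof. by move=> mA; apply: nnm_EFin => // x; rewrite ?indicE ?ler0n. Qed.

Lemma nnm_cst d (T : measurableType d) (c : \bar R) :
  (0 <= c)%E -> nnm (fun _ : T => c).
Proof. by move=> c0; split. Qed.

(** Once [k] is packaged as a probability kernel, this is the measurability of parametrized kernel
    integrals. *)
Lemma nnm_kernel d1 d2 (S : measurableType d1) (E : measurableType d2)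
    (k : S -> probability E R)
    (mk : forall U, measurable U -> measurable_fun setT (fun s => k s U))
    (f : S * E -> \bar R) :
  nnm f -> nnm (fun s => \int[k s]_v f (s, v))%E.
Proof.
move=> [mf f0]; split=> [|s]; last by apply: integral_ge0.
pose k0 : S -> {measure set E -> \bar R} := fun s => k s.
pose k1 : R.-ker S ~> E := HB.pack k0 (isKernel.Build _ _ _ _ _ k0 mk).
have k1p : forall x, k1 x setT = 1%E by move=> x; exact: probability_setT.
pose k2 : R.-pker S ~> E :=
  HB.pack k0 (isKernel.Build _ _ _ _ _ k0 mk)
    (Kernel_isProbability.Build _ _ _ _ _ k1 k1p).
exact: (@measurable_kfcomp _ _ _ _ _ k2 f mf f0).
Qed.

Lemma nnm_int d1 d2 (S : measurableType d1) (E : measurableType d2)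
    (mu : probability E R) (f : S * E -> \bar R) :
  nnm f -> nnm (fun s => \int[mu]_v f (s, v))%E.
Proof. by move=> nf; apply: (nnm_kernel (k := fun=> mu)). Qed.

Lemma int_swap d1 d2 (S : measurableType d1) (E : measurableType d2)
    (m1 : probability S R) (m2 : probability E R) (f : S * E -> \bar R) :
  nnm f -> (\int[m1]_x \int[m2]_y f (x, y) = \int[m2]_y \int[m1]_x f (x, y))%E.
Proof. by move=> [mf f0]; exact: fubini_tonelli. Qed.

Lemma int_le d (T : measurableType d) (mu : {measure set T -> \bar R})
    (f g : T -> \bar R) :
  nnm f -> nnm g -> (forall x, f x <= g x)%E ->
  (\int[mu]_x f x <= \int[mu]_x g x)%E.
Proof. by move=> [mf f0] [mg g0] fg; apply: ge0_le_integral. Qed.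

Lemma int_add d (T : measurableType d) (mu : {measure set T -> \bar R})
    (f g : T -> \bar R) :
  nnm f -> nnm g ->
  (\int[mu]_x (f x + g x) = \int[mu]_x f x + \int[mu]_x g x)%E.
Proof. by move=> [mf f0] [mg g0]; rewrite ge0_integralD. Qed.

Lemma int_scale d (T : measurableType d) (mu : {measure set T -> \bar R})
    (k : R) (f : T -> \bar R) :
  nnm f -> 0 <= k ->
  (\int[mu]_x (k%:E * f x) = k%:E * \int[mu]_x f x)%E.
Proof. by move=> [mf f0] k0; rewrite ge0_integralZl. Qed.

Lemma int_sum d (T : measurableType d) (mu : {measure set T -> \bar R})
    (I : Type) (s : seq I) (f : I -> T -> \bar R) :
  (forall i, nnm (f i)) ->
  (\int[mu]_x (\sum_(i <- s) f i x) = \sum_(i <- s) \int[mu]_x f i x)%E.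
Proof.
by move=> nf; rewrite ge0_integral_sum// => [i|i x _]; case: (nf i).
Qed.

Lemma int_cst d (T : measurableType d) (mu : probability T R) (c : \bar R) :
  (\int[mu]_x c = c)%E.
Proof. by rewrite integral_cst//= probability_setT mule1. Qed.

End nonneg_measurable.

(** * Images and mixtures of probability measures *)

Section probability_constructions.
Context {R : realType}.

(** The laws below are used only through their integrals against [nnm] functions, hence the
    existential form; a measure is picked with [cid] where a name is needed. *)
Lemma int_push d1 d2 (X : measurableType d1) (Y : measurableType d2)
    (mu : probability X R) (phi : X -> Y) :
  measurable_fun setT phi ->
  exists m : probability Y R, forall f, nnm f ->
    (\int[m]_y f y = \int[mu]_x f (phi x))%E.
Proof.
move=> mphi.
pose f : {mfun X >-> Y} := HB.pack phi (isMeasurableFun.Build _ _ _ _ _ mphi).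
by exists (distribution mu f) => g [mg g0]; rewrite ge0_integral_distribution.
Qed.

Lemma eq_int_prob d (T : measurableType d) (m1 m2 : probability T R) :
  (forall A, measurable A -> m1 A = m2 A) ->
  forall f : T -> \bar R, (\int[m1]_x f x = \int[m2]_x f x)%E.
Proof. by move=> e f; apply: eq_measure_integral => A mA _; exact: e. Qed.

Lemma int_indicT d (T : measurableType d) (m : {measure set T -> \bar R}) (A : set T) :
  measurable A -> (\int[m]_x (\1_A x)%:E = m A)%E.
Proof. by move=> mA; rewrite integral_indic// setIT. Qed.

(** The mixture is a composition of two kernels that starts from the one-point space [unit]. *)
Lemma int_mix d1 d2 (S : measurableType d1) (Z : measurableType d2)
    (mu : probability S R) (k : S -> probability Z R)
    (mk : forall U, measurable U -> measurable_fun setT (fun s => k s U)) :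
  exists m : probability Z R, forall f, nnm f ->
    (\int[m]_z f z = \int[mu]_s \int[k s]_z f z)%E.
Proof.
pose l0 : unit -> {measure set S -> \bar R} := fun=> mu.
have ml0 U : measurable U -> measurable_fun setT (fun x => l0 x U) by [].
pose l1 : R.-ker unit ~> S := HB.pack l0 (isKernel.Build _ _ _ _ _ l0 ml0).
have l1p : forall x, l1 x setT = 1%E by move=> x; exact: probability_setT.
pose l2 : R.-pker unit ~> S :=
  HB.pack l0 (isKernel.Build _ _ _ _ _ l0 ml0)
    (Kernel_isProbability.Build _ _ _ _ _ l1 l1p).
pose k0 : unit * S -> {measure set Z -> \bar R} := fun s => k s.2.
have mk0 U : measurable U -> measurable_fun setT (fun x => k0 x U).
  by move=> mU; apply: (measurableT_comp (mk _ mU)).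
pose k1 : R.-ker (unit * S)%type ~> Z := HB.pack k0 (isKernel.Build _ _ _ _ _ k0 mk0).
have k1p : forall x, k1 x setT = 1%E by move=> x; exact: probability_setT.
pose k2 : R.-pker (unit * S)%type ~> Z :=
  HB.pack k0 (isKernel.Build _ _ _ _ _ k0 mk0)
    (Kernel_isProbability.Build _ _ _ _ _ k1 k1p).
have m1 : kcomp l2 k2 tt setT = 1%E.
  rewrite /kcomp /=; under eq_integral => x _ do rewrite /k0 /= probability_setT.
  exact: int_cst.
pose m : probability Z R := HB.pack (kcomp l2 k2 tt) (Measure_isProbability.Build _ _ _ (kcomp l2 k2 tt) m1).
exists m => f [mf f0]; exact: (@integral_kcomp _ _ _ _ _ _ _ l2 k2 tt f f0 mf).
Qed.

Lemma int_finite_mixture d1 d2 (V : measurableType d1) (E : measurableType d2)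
    (J : finType) (w : J -> R) (g : probability V R) (F : J -> V -> E) :
  (forall j, 0 <= w j) -> \sum_j w j = 1 ->
  (forall j, measurable_fun setT (F j)) ->
  exists m : probability E R, forall f, nnm f ->
    (\int[m]_x f x = \sum_j (w j)%:E * \int[g]_v f (F j v))%E.
Proof.
move=> w0 w1 mF.
have [m mE] : exists m : {measure set E -> \bar R}, forall f, nnm f ->
    (\int[m]_x f x = \sum_j (w j)%:E * \int[g]_v f (F j v))%E.
  (* The total mass is not yet prescribed: partial sums of the mixture are measures but not
     probabilities. *)
  elim: (index_enum J) => [|j s [m IH]].
    by exists mzero => f nf; rewrite big_nil integral_measure_zero.
  have [p pE] := int_push g (mF j).
  exists (measure_add (mscale (NngNum (w0 j)) p) m) => f nf.
  have [mf f0] := nf.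
  by rewrite ge0_integral_measure_add// ge0_integral_mscale// big_cons IH// pE.
have mT : m setT = 1%E.
  rewrite -int_indicT// mE; last exact: nnm_indic.
  rewrite -[RHS]/(1%:E) -w1 -sumEFin; apply: eq_bigr => j _.
  under eq_integral => v _ do rewrite indicT /=.
  by rewrite int_cst mule1.
case: m mE mT => ms mc mE mT.
pose m : {measure set E -> \bar R} := Measure.Pack mc.
pose m' : probability E R :=
  HB.pack ms mc (Measure_isProbability.Build _ _ _ m mT).
by exists m'.
Qed.

End probability_constructions.

(** * Independent samples *)

Section iid_measure.
Context {R : realType} d (T : measurableType d).

Lemma measurable_cons_tuple n :
  measurable_fun setT (fun p : T * n.-tuple T => [tuple of p.1 :: p.2]).
Proof. exact: (measurable_cons measurable_fst measurable_snd). Qed.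

Lemma nnm_consr n (f : n.+1.-tuple T -> \bar R) (v : T) :
  nnm f -> nnm (fun u : n.-tuple T => f [tuple of v :: u]).
Proof.
move=> nf.
exact: (nnm_pair2 v (nnm_comp nf (@measurable_cons_tuple n))).
Qed.

(** The kernels of the filters are defined by iterated integrals, so the product measure is
    characterized in the same form. *)
Lemma iid_exists (mu : probability T R) n :
  exists m : probability (n.-tuple T) R, forall f, nnm f ->
    (\int[m]_u f u = iid_integral (fun g => \int[mu]_x g x) f)%E.
Proof.
elim: n => [|n [m IH]].
  exists (\d_([tuple] : 0.-tuple T)) => f [mf f0] /=.
  by rewrite integral_dirac//= diracT mul1e.
have [m' m'E] := int_push (mu \x m)%E (@measurable_cons_tuple n).
exists m' => f nf; rewrite m'E// fubini_tonelli1//=.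
- by apply: eq_integral => v _; rewrite /fubini_F IH//; exact: nnm_consr.
- by case: (nnm_comp nf (@measurable_cons_tuple n)).
- by move=> x; case: nf.
Qed.

Definition iid (mu : probability T R) n : probability (n.-tuple T) R :=
  sval (cid (iid_exists mu n)).

Lemma iidE (mu : probability T R) n f : nnm f ->
  (\int[iid mu n]_u f u = iid_integral (fun g => \int[mu]_x g x) f)%E.
Proof. by rewrite /iid; case: cid => /= m; apply. Qed.

Lemma iid0 (mu : probability T R) f : nnm f ->
  (\int[iid mu 0]_u f u = f [tuple])%E.
Proof. by move=> nf; rewrite iidE. Qed.

Lemma iidS (mu : probability T R) n f : nnm f ->
  (\int[iid mu n.+1]_u f u = \int[mu]_v \int[iid mu n]_u f [tuple of v :: u])%E.
Proof.
move=> nf; rewrite iidE//=; apply: eq_integral => v _.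
by rewrite iidE//; exact: nnm_consr.
Qed.

Lemma nnm_iidS (mu : probability T R) n f : nnm f ->
  nnm (fun v => \int[iid mu n]_u f [tuple of v :: u])%E.
Proof.
by move=> nf; have := nnm_int (iid mu n) (nnm_comp nf (@measurable_cons_tuple n)).
Qed.

End iid_measure.

Section iid_kernel.
Context {R : realType} d1 d2 (S : measurableType d1) (E : measurableType d2).
Variable k : S -> probability E R.
Hypothesis mk : forall U, measurable U -> measurable_fun setT (fun s => k s U).

Lemma nnm_iid_kernel n (f : S * n.-tuple E -> \bar R) :
  nnm f -> nnm (fun s => \int[iid (k s) n]_u f (s, u))%E.
Proof.
(* Each integration moves one coordinate of the sample into the parameter space, so the induction
   must be free in [S'] and [g]. *)
suff H m d (S' : measurableType d) (g : S' -> S) (f' : S' * m.-tuple E -> \bar R) :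
    measurable_fun setT g -> nnm f' ->
    nnm (fun s => iid_integral (fun h => \int[k (g s)]_v h v)%E
                    (fun u => f' (s, u))).
  move=> nf; have := H n _ S id f (@measurable_id _ _ _) nf.
  congr (nnm _); apply/funext => s; rewrite iidE//.
  exact: (nnm_pair2 _ nf).
elim: m d S' g f' => [|m IH] d S' g f' mg nf' /=.
  exact: (nnm_pair1 _ nf').
pose f1 (p : (S' * E) * m.-tuple E) := f' (p.1.1, [tuple of p.1.2 :: p.2]).
have nf1 : nnm f1.
  apply: nnm_comp nf' _; apply: measurable_fun_pair => /=.
    exact: measurableT_comp.
  by apply: measurable_cons => //; exact: measurableT_comp.
have nf2 := IH _ (S' * E)%type (g \o fst) f1 (measurableT_comp mg measurable_fst) nf1.
have mk' U : measurable U -> measurable_fun setT (fun s => (k \o g) s U).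
  by move=> mU; exact: (measurableT_comp (mk mU) mg).
exact: (nnm_kernel mk' nf2).
Qed.

End iid_kernel.
Section rectangles.
Context {R : realType} d (T : measurableType d).

Lemma iid_prod (mu : probability T R) n (g : 'I_n -> T -> \bar R) :
  (forall i, nnm (g i)) ->
  (\int[iid mu n]_u \big[*%E/1%E]_(i < n) g i (tnth u i) =
   \big[*%E/1%E]_(i < n) \int[mu]_x g i x)%E.
Proof.
have np m (h : 'I_m -> T -> \bar R) : (forall i, nnm (h i)) ->
    nnm (fun u : m.-tuple T => \big[*%E/1%E]_(i < m) h i (tnth u i))%E.
  by move=> nh; apply: nnm_prod => i; apply: nnm_comp => //; exact: measurable_tnth.
elim: n g => [|n IH] g ng.
  by rewrite iid0 ?big_ord0//; exact: np.
rewrite iidS; last exact: np.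
rewrite big_ord_recl muleC.
have [m0 g0] := ng ord0.
rewrite -ge0_integralZl//; last first.
  by apply: prode_ge0 => i _; apply: integral_ge0 => x _; case: (ng (lift ord0 i)).
apply: eq_integral => v _.
rewrite -(IH (fun i => g (lift ord0 i)))//.
under eq_integral => u _.
  rewrite big_ord_recl tnth0.
  under eq_bigr => i _ do rewrite tnthS.
  over.
have [mf f0] := np n (fun i => g (lift ord0 i)) (fun i => ng _).
by rewrite ge0_integralZl// muleC.
Qed.

Definition rect n (B : 'I_n -> set T) : set (n.-tuple T) :=
  [set u | forall i, B i (tnth u i)].

Lemma indic_rect n (B : 'I_n -> set T) u :
  (\1_(rect B) u)%:E = \big[*%E/1%E]_(i < n) (\1_(B i) (tnth u i))%:E :> \bar R.
Proof.
rewrite prodEFin; congr EFin; rewrite indicE.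
case: (boolP (u \in rect B)) => [/set_mem uB|uB].
  by rewrite big1// => i _; rewrite indicE mem_set.
rewrite /=; apply/esym/eqP; rewrite prodf_seq_eq0; apply/hasP.
have /existsNP[i nB] : ~ forall i, B i (tnth u i).
  by move=> H; move/negP: uB; apply; exact: mem_set.
exists i; first exact: mem_index_enum.
by rewrite /= indicE memNset//= eqxx.
Qed.

Lemma measurable_rect n (B : 'I_n -> set T) :
  (forall i, measurable (B i)) -> measurable (rect B).
Proof.
move=> mB.
have -> : rect B = \bigcap_(i in [set: 'I_n]) ((fun u => tnth u i) @^-1` B i).
  by apply/seteqP; split => [u uB i _|u uB i]; [exact: uB|exact: (uB i I)].
apply: fin_bigcap_measurable => // i _.
by rewrite -[X in measurable X]setTI; apply: measurable_tnth.
Qed.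

Lemma iid_rect (mu : probability T R) n (B : 'I_n -> set T) :
  (forall i, measurable (B i)) ->
  iid mu n (rect B) = \big[*%E/1%E]_(i < n) mu (B i).
Proof.
move=> mB; rewrite -int_indicT; last exact: measurable_rect.
under eq_integral => u _ do rewrite indic_rect.
rewrite (iid_prod mu (g := fun i x => (\1_(B i) x)%:E)); last first.
  by move=> i; exact: nnm_indic.
by apply: eq_bigr => i _; rewrite int_indicT.
Qed.

End rectangles.

Section joint_law.
Context {R : realType} d0 d1 d2 (Om : measurableType d0)
  (S : measurableType d1) (E : measurableType d2) (Pr : probability Om R).
Variables (n : nat) (X : Om -> S) (U : Om -> n.-tuple E) (k : S -> probability E R).
Hypotheses (mX : measurable_fun setT X) (mU : measurable_fun setT U).
Hypothesis mk : forall C, measurable C -> measurable_fun setT (fun s => k s C).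
Hypothesis XU : forall A (B : 'I_n -> set E), measurable A ->
  (forall i, measurable (B i)) ->
  (Pr (X @^-1` A `&` U @^-1` rect B) =
   \int[Pr]_(w in X @^-1` A) \big[*%E/1%E]_(i < n) k (X w) (B i))%E.

Let ST := (S * n.-tuple E)%type.
Let G : set (set ST) := [set C | exists A B, [/\ measurable A,
  forall i, measurable (B i) & C = A `*` rect B]].

(** The hard inclusion amounts to measurability of the identity from [<<s G >>] to the product
    space, which can be checked coordinate by coordinate. *)
Let mG : @measurable _ ST = <<s G >>.
Proof.
apply/seteqP; split; last first.
  apply: smallest_sub; first exact: sigma_algebra_measurable.
  by move=> _ [A [B [mA mB ->]]]; apply: measurableX => //; exact: measurable_rect.
have sG C : G C -> <<s G >> C by exact: sub_sigma_algebra.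
suff mid : measurable_fun [set: g_sigma_algebraType G] (id : _ -> ST).
  by move=> C mC; have := mid measurableT C mC; rewrite setTI.
apply/measurable_fun_pairP; split.
  move=> _ A mA; rewrite setTI; apply: sG.
  exists A, (fun=> setT); split=> //; apply/seteqP; split => [x xA|x []//].
  by split.
apply/measurable_fun_tnthP => i _ A mA; rewrite setTI; apply: sG.
exists setT, (fun j => if j == i then A else setT); split => // [j|].
  by case: ifP.
apply/seteqP; split => [x /= xA|x /= [_ /(_ i)]]; last by rewrite eqxx.
by split => // j; case: eqP => // ->.
Qed.

Let GI : setI_closed G.
Proof.
move=> _ _ [A [B [mA mB ->]]] [A' [B' [mA' mB' ->]]].
exists (A `&` A'), (fun i => B i `&` B' i); split => [|i|].
- exact: measurableI.
- exact: measurableI.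
apply/seteqP; split => [x /= [[? h] [? h']]|x /= [[? ?] h]].
  by do 2?split => // i.
by split; split => // i; case: (h i).
Qed.

(** The draws are specified by probabilities of rectangles only. Rectangles are stable under
    intersection and generate the product sigma-algebra, so the conditional law extends to every
    nonnegative function of past and sample. *)
Lemma joint_law (f : S * n.-tuple E -> \bar R) : nnm f ->
  (\int[Pr]_w f (X w, U w) = \int[Pr]_w \int[iid (k (X w)) n]_u f (X w, u))%E.
Proof.
have mXU : measurable_fun setT (fun w => (X w, U w)) by exact: measurable_fun_pair.
have [m1 m1E] := int_push Pr mXU.
have mk' C : measurable C -> measurable_fun setT (fun w => k (X w) C).
  by move=> mC; exact: (measurableT_comp (mk mC) mX).
pose kk w : probability ST R := sval (cid (int_push (iid (k (X w)) n)
  (@measurable_pair1 _ _ S (n.-tuple E) (X w)))).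
have kkE w f' : nnm f' ->
    (\int[kk w]_z f' z = \int[iid (k (X w)) n]_u f' (X w, u))%E.
  by rewrite /kk; case: cid => /= m; apply.
have nkk f' : nnm f' -> nnm (fun w => \int[kk w]_z f' z)%E.
  move=> nf'; under eq_fun do rewrite kkE//.
  apply: (nnm_iid_kernel mk' (f := fun p => f' (X p.1, p.2))).
  by apply: nnm_comp => //; apply: measurable_fun_pair => //; exact: measurableT_comp.
have mkk C : measurable C -> measurable_fun setT (fun w => kk w C).
  move=> mC; have [+ _] := nkk _ (nnm_indic mC).
  by congr measurable_fun; apply/funext => w; rewrite int_indicT.
have [m2 m2E] := int_mix Pr mkk.
suff m12 C : measurable C -> m1 C = m2 C.
  move=> nf; rewrite -m1E// (eq_int_prob m12) m2E//.
  by apply: eq_integral => w _; rewrite kkE.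
apply: (measure_unique G (fun=> setT)) => //.
- by move=> i; exists setT, (fun=> setT); split => //; apply/seteqP; split.
- by rewrite bigcup_const.
- move=> _ [A [B [mA mB ->]]].
  have mR := @measurable_rect _ _ n B mB.
  have mAR : measurable (A `*` rect B) by exact: measurableX.
  have mXA : measurable (X @^-1` A) by rewrite -[X in measurable X]setTI; exact: mX.
  have mUB : measurable (U @^-1` rect B) by rewrite -[X in measurable X]setTI; exact: mU.
  transitivity (Pr (X @^-1` A `&` U @^-1` rect B)).
    rewrite -int_indicT// m1E; last exact: nnm_indic.
    by rewrite -[RHS]int_indicT//; exact: measurableI.
  rewrite XU// -int_indicT// m2E; last exact: nnm_indic.
  rewrite integral_mkcond; apply: eq_integral => w _.
  rewrite kkE; last exact: nnm_indic.
  rewrite patchE; case: ifPn => [/set_mem wA|wA].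
    rewrite -iid_rect// -int_indicT//; apply: eq_integral => u _.
    congr EFin; rewrite !indicE.
    have [h|h] := pselect (rect B u); first by rewrite !mem_set.
    by rewrite !memNset// => -[].
  rewrite integral0_eq// => u _; rewrite indicE memNset// => -[/= h _].
  by move/negP: wA; apply; exact: mem_set.
- by move=> i; rewrite /= probability_setT ltry.
Qed.

End joint_law.

Section iid_rcons.
Context {R : realType} d (T : measurableType d).

Lemma measurable_rcons_tuple n :
  measurable_fun setT (fun p : n.-tuple T * T => [tuple of rcons p.1 p.2]).
Proof.
apply/measurable_fun_tnthP => i.
have [ilt|ige] := ltnP i n.
  apply: (eq_measurable_fun (fun p : n.-tuple T * T => tnth p.1 (Ordinal ilt))).
    move=> p _ /=; rewrite (tnth_nth p.2) [RHS](tnth_nth p.2) /= nth_rcons.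
    by rewrite size_tuple ilt.
  exact: (measurableT_comp (measurable_tnth _)).
apply: (eq_measurable_fun snd) => // p _ /=.
have /eqP e : nat_of_ord i == n by rewrite eqn_leq ige -ltnS ltn_ord.
by rewrite (tnth_nth p.2) /= nth_rcons size_tuple e ltnn eqxx.
Qed.

(** [iid] is built from the front of the tuple, whereas time appends new entries at the end. *)
Lemma iid_rcons (mu : probability T R) n (f : n.+1.-tuple T -> \bar R) : nnm f ->
  (\int[iid mu n.+1]_u f u =
   \int[iid mu n]_u \int[mu]_v f [tuple of rcons u v])%E.
Proof.
elim: n f => [|n IH] f nf.
  rewrite iidS// iid0; last first.
    exact: (nnm_int mu (nnm_comp nf (@measurable_rcons_tuple 0))).
  apply: eq_integral => v _; rewrite iid0; last exact: nnm_consr.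
  by congr f; exact: val_inj.
rewrite iidS// [RHS]iidS; last first.
  exact: (nnm_int mu (nnm_comp nf (@measurable_rcons_tuple n.+1))).
apply: eq_integral => v _; rewrite IH; last exact: nnm_consr.
apply: eq_integral => u _; apply: eq_integral => z _.
by congr f; exact: val_inj.
Qed.

End iid_rcons.

(** * Sequences independent of the past and particle systems *)

Section independent_sequence.
Context {R : realType} d0 d (Om : measurableType d0) (T : measurableType d)
  (Pr : probability Om R) (mu : probability T R).
Variables (V : nat -> Om -> T) (G : nat -> set_system Om).
Hypothesis GS : forall k, G k `<=` G k.+1.
Hypothesis mV : forall k, measurable_fun [set: g_sigma_algebraType (G k.+1)] (V k).

Definition independent_of_past := forall k d' (S : measurableType d') (X : Om -> S),
  measurable_fun [set: g_sigma_algebraType (G k)] X ->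
  forall f : S * T -> \bar R, nnm f ->
  (\int[Pr]_w f (X w, V k w) = \int[Pr]_w \int[mu]_v f (X w, v))%E.

Lemma measurable_coarser k m d' (S : measurableType d') (X : Om -> S) :
  measurable_fun [set: g_sigma_algebraType (G k)] X ->
  measurable_fun [set: g_sigma_algebraType (G (k + m))] X.
Proof.
move=> mX _ A mA.
have sG : G k `<=` G (k + m).
  elim: m => [|m IH]; first by rewrite addn0.
  by rewrite addnS; exact: (subset_trans IH (@GS _)).
have h : <<s G k >> `<=` <<s G (k + m) >> by exact: sub_sigma_algebra2.
by apply: h; exact: (mX measurableT A mA).
Qed.

Lemma measurable_window k n :
  measurable_fun [set: g_sigma_algebraType (G (k + n))]
    (fun w => [tuple V (k + i) w | i < n]).
Proof.
apply/measurable_fun_tnthP => i.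
have -> : (fun x => tnth x i) \o (fun w => [tuple V (k + i) w | i < n]) = V (k + i).
  by apply/funext => w /=; rewrite tnth_mktuple.
have := @measurable_coarser (k + i).+1 (n - i.+1) _ _ _ (@mV (k + i)).
by rewrite -addnS -addnA subnKC.
Qed.

(** The last entry is averaged first: the earlier ones belong to its past, and the induction
    hypothesis integrates them afterwards. *)
Lemma iid_window : independent_of_past ->
  forall n k d' (S : measurableType d') (X : Om -> S),
  measurable_fun [set: g_sigma_algebraType (G k)] X ->
  forall f : S * n.-tuple T -> \bar R, nnm f ->
  (\int[Pr]_w f (X w, [tuple V (k + i) w | i < n]) =
   \int[Pr]_w \int[iid mu n]_u f (X w, u))%E.
Proof.
move=> iV; elim=> [|n IH] k d' S X mX f nf.
  apply: eq_integral => w _; rewrite iid0; last exact: (nnm_pair2 _ nf).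
  by congr (f (_, _)); rewrite [LHS]tuple0.
pose g (p : (S * n.-tuple T) * T) := f (p.1.1, [tuple of rcons p.1.2 p.2]).
have ng : nnm g.
  apply: nnm_comp => //; apply: measurable_fun_pair => /=.
    exact: measurableT_comp.
  have h : measurable_fun setT (fun p : (S * n.-tuple T) * T => (p.1.2, p.2)).
    by apply: measurable_fun_pair => //; exact: measurableT_comp.
  exact: (measurableT_comp (@measurable_rcons_tuple _ T n) h).
have mXw : measurable_fun [set: g_sigma_algebraType (G (k + n))]
    (fun w => (X w, [tuple V (k + i) w | i < n])).
  by apply: measurable_fun_pair; [exact: measurable_coarser|exact: measurable_window].
transitivity (\int[Pr]_w g ((X w, [tuple V (k + i) w | i < n]), V (k + n) w))%E.
  apply: eq_integral => w _; congr (f (_, _)); apply: eq_from_tnth => i.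
  rewrite tnth_mktuple (tnth_nth (V (k + n) w)) /= nth_rcons size_tuple card_ord.
  case: ltngtP => [lin|nli|->//].
  by rewrite -[RHS](tnth_nth _ [tuple V (k + j) w | j < n] (Ordinal lin)) tnth_mktuple.
by have := ltn_ord i; rewrite ltnS leqNgt nli.
rewrite (iV _ _ _ _ mXw)//.
rewrite (IH k _ _ _ mX (fun p => \int[mu]_v g (p, v))%E); last exact: nnm_int.
apply: eq_integral => w _; rewrite iid_rcons//.
exact: (nnm_pair2 _ nf).
Qed.

End independent_sequence.

Section particle_system.
Context {R : realType} d0 d1 d2 d3 (Om : measurableType d0)
  (D : measurableType d1) (A : measurableType d2) (E : measurableType d3).
Variables (N : nat) (Pr : probability Om R) (mu : probability D R).
Variables (a0 : A) (upd : A -> D -> N.-tuple E -> A).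
Variables (k0 : probability E R) (k : D * N.-tuple E -> probability E R).
Hypothesis mupd : measurable_fun setT
  (fun p : (A * D) * N.-tuple E => upd p.1.1 p.1.2 p.2).
Hypothesis mk : forall C, measurable C -> measurable_fun setT (fun s => k s C).

Definition transition (f : A * N.-tuple E -> \bar R) (s : A * N.-tuple E) : \bar R :=
  (\int[mu]_y \int[iid (k (y, s.2)) N]_u f (upd s.1 y s.2, u))%E.

Lemma nnm_transition_in (f : A * N.-tuple E -> \bar R) : nnm f ->
  nnm (fun p : (A * N.-tuple E) * D =>
    \int[iid (k (p.2, p.1.2)) N]_u f (upd p.1.1 p.2 p.1.2, u))%E.
Proof.
move=> nf.
have m1 : measurable_fun setT (fun p : (A * N.-tuple E) * D => (p.2, p.1.2)).
  by apply: measurable_fun_pair => //; exact: measurableT_comp.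
have mk' C : measurable C -> measurable_fun setT
    (fun p : (A * N.-tuple E) * D => k (p.2, p.1.2) C).
  by move=> mC; exact: (measurableT_comp (mk mC) m1).
apply: (nnm_iid_kernel mk' (f := fun q => f (upd q.1.1.1 q.1.2 q.1.1.2, q.2))).
apply: nnm_comp => //; apply: measurable_fun_pair => //.
have m2 : measurable_fun setT (fun q : ((A * N.-tuple E) * D) * N.-tuple E =>
    ((q.1.1.1, q.1.2), q.1.1.2)).
  have m3 : measurable_fun setT (fun q : ((A * N.-tuple E) * D) * N.-tuple E =>
    q.1.1) by exact: measurableT_comp.
  apply: measurable_fun_pair => /=; first apply: measurable_fun_pair => /=.
  - exact: (measurableT_comp measurable_fst m3).
  - exact: measurableT_comp.
  - exact: (measurableT_comp measurable_snd m3).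
exact: (measurableT_comp mupd m2).
Qed.

Lemma nnm_transition (f : A * N.-tuple E -> \bar R) : nnm f -> nnm (transition f).
Proof. by move=> nf; exact: nnm_int (nnm_transition_in nf). Qed.

Lemma nnm_transition_s (f : A * N.-tuple E -> \bar R) s : nnm f ->
  nnm (fun y => \int[iid (k (y, s.2)) N]_u f (upd s.1 y s.2, u))%E.
Proof. by move=> nf; exact: nnm_pair2 s (nnm_transition_in nf). Qed.

(* The data blocks being i.i.d., block [p] is integrated out in the same round in
   which it is used, so that the filter run over random data becomes a chain with
   a time-homogeneous kernel; [chain p f] is the mean of [f] after [p] rounds. *)
Fixpoint chain (p : nat) (f : A * N.-tuple E -> \bar R) : \bar R :=
  match p with
  | 0 => (\int[iid k0 N]_u f (a0, u))%E
  | p.+1 => chain p (transition f)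
  end.

Lemma eq_chain p f g : f =1 g -> chain p f = chain p g.
Proof. by move=> /funext ->. Qed.

Lemma chain_le p f g : nnm f -> nnm g -> (forall s, f s <= g s)%E ->
  (chain p f <= chain p g)%E.
Proof.
elim: p f g => [|p IH] f g nf ng fg /=.
  by apply: int_le => //; exact: nnm_pair2.
apply: IH; [exact: nnm_transition|exact: nnm_transition|move=> s].
apply: int_le; [exact: nnm_transition_s|exact: nnm_transition_s|move=> y].
by apply: int_le => //; exact: nnm_pair2.
Qed.

Lemma chain_add p f g : nnm f -> nnm g ->
  (chain p (fun s => f s + g s) = chain p f + chain p g)%E.
Proof.
elim: p f g => [|p IH] f g nf ng /=.
  by apply: int_add; exact: nnm_pair2.
rewrite -IH; [|exact: nnm_transition|exact: nnm_transition].
apply: eq_chain => s.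
rewrite /transition -int_add; [|exact: nnm_transition_s|exact: nnm_transition_s].
by apply: eq_integral => y _; apply: int_add; exact: nnm_pair2.
Qed.

Lemma chain_scale p f (c : R) : nnm f -> 0 <= c ->
  (chain p (fun s => c%:E * f s) = c%:E * chain p f)%E.
Proof.
move=> + c0; elim: p f => [|p IH] f nf /=.
  by apply: int_scale => //; exact: nnm_pair2.
rewrite -IH; last exact: nnm_transition.
apply: eq_chain => s.
rewrite /transition -int_scale//; last exact: nnm_transition_s.
by apply: eq_integral => y _; apply: int_scale => //; exact: nnm_pair2.
Qed.

Variables (Y : nat -> Om -> D) (U : nat -> Om -> N.-tuple E).

(** In the filters this statistic holds the products of the normalizing constants of the completed
    rounds. *)
Fixpoint acc (p : nat) (w : Om) : A :=
  match p with
  | 0 => a0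
  | p.+1 => upd (acc p w) (Y p w) (U p w)
  end.

Definition window p n w : n.-tuple D := [tuple Y (p + i) w | i < n].

Hypothesis law_data : forall n (f : n.-tuple D -> \bar R), nnm f ->
  (\int[Pr]_w f (window 0 n w) = \int[iid mu n]_y f y)%E.
Hypothesis law_init : forall n (f : n.-tuple D * N.-tuple E -> \bar R), nnm f ->
  (\int[Pr]_w f (window 0 n w, U 0 w) =
   \int[Pr]_w \int[iid k0 N]_u f (window 0 n w, u))%E.
Hypothesis law_step : forall p n
    (f : ((n.+1.-tuple D * A) * N.-tuple E) * N.-tuple E -> \bar R), nnm f ->
  (\int[Pr]_w f (((window p n.+1 w, acc p w), U p w), U p.+1 w) =
   \int[Pr]_w \int[iid (k (Y p w, U p w)) N]_u
      f (((window p n.+1 w, acc p w), U p w), u))%E.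

(** The draws are conditional on the whole data, so the blocks still to come can be carried along as
    known. The induction on [p] leaves [n] free because every round consumes the head of a
    window. *)
Lemma particle_law p n (f : (n.-tuple D * A) * N.-tuple E -> \bar R) : nnm f ->
  (\int[Pr]_w f ((window p n w, acc p w), U p w) =
   chain p (fun s => \int[iid mu n]_y f ((y, s.1), s.2)))%E.
Proof.
elim: p n f => [|p IH] n f nf /=.
  rewrite (law_init (f := fun q => f ((q.1, a0), q.2))); last first.
    apply: nnm_comp => //; apply: measurable_fun_pair => //.
    by apply: measurable_fun_pair.
  have n1 : nnm (fun q : n.-tuple D * N.-tuple E => f ((q.1, a0), q.2)).
    apply: nnm_comp => //; apply: measurable_fun_pair => //.
    by apply: measurable_fun_pair.
  rewrite (law_data (f := fun y => \int[iid k0 N]_u f ((y, a0), u))%E).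
    exact: int_swap n1.
  exact: nnm_int n1.
pose B : Type := n.-tuple D.
pose b (y : n.+1.-tuple D) : n.-tuple D := [tuple of behead y].
have mb : measurable_fun setT b by exact: measurable_behead.
have mh : measurable_fun setT (fun y : n.+1.-tuple D => tnth y ord0).
  exact: measurable_tnth.
pose X1 := ((n.+1.-tuple D * A) * N.-tuple E)%type.
(* Round [p.+1] seen from round [p]: the head of the longer window is the block consumed by [upd],
   its tail is the window that remains. *)
pose g (q : X1 * N.-tuple E) :=
  f ((b q.1.1.1, upd q.1.1.2 (tnth q.1.1.1 ord0) q.1.2), q.2).
have m1 : measurable_fun setT (fun q : X1 => q.1.1) by exact: measurableT_comp.
have mu1 : measurable_fun setT (fun q : X1 => upd q.1.2 (tnth q.1.1 ord0) q.2).
  have h : measurable_fun setT (fun q : X1 => ((q.1.2, tnth q.1.1 ord0), q.2)).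
    apply: measurable_fun_pair => //; apply: measurable_fun_pair => /=.
      exact: measurableT_comp.
    exact: (measurableT_comp mh m1).
  exact: (measurableT_comp mupd h).
have ng : nnm g.
  apply: nnm_comp => //; apply: measurable_fun_pair => //.
  apply: measurable_fun_pair => /=.
    exact: (measurableT_comp (measurableT_comp mb m1) measurable_fst).
  exact: (measurableT_comp mu1 measurable_fst).
transitivity (\int[Pr]_w g (((window p n.+1 w, acc p w), U p w), U p.+1 w))%E.
  apply: eq_integral => w _; rewrite /g /= tnth_mktuple addn0; congr (f (_, _, _)).
  apply: eq_from_tnth => i; rewrite /window (tnth_nth (Y 0%N w)) [RHS](tnth_nth (Y 0%N w)).
  rewrite nth_behead -[LHS]tnth_nth.
  have -> : (nat_of_ord i).+1 = nat_of_ord (lift ord0 i) by [].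
  by rewrite -tnth_nth !tnth_mktuple /= /bump /= addnS addSn.
rewrite law_step//.
have mk' C : measurable C ->
    measurable_fun setT (fun q : X1 => k (tnth q.1.1 ord0, q.2) C).
  move=> mC; apply: (measurableT_comp (mk mC)).
  by apply: measurable_fun_pair => //; exact: (measurableT_comp mh m1).
have nG := nnm_iid_kernel mk' ng.
pose F (q : X1) := (\int[iid (k (tnth q.1.1 ord0, q.2)) N]_u g (q, u))%E.
transitivity (\int[Pr]_w F ((window p n.+1 w, acc p w), U p w))%E.
  by apply: eq_integral => w _; rewrite /F /= tnth_mktuple addn0.
rewrite (IH _ F)//; apply: eq_chain => -[a u] /=.
rewrite /transition /= iidS; last first.
  apply: (nnm_comp nG (g := fun y => ((y, a), u))).
  by apply: measurable_fun_pair => //; exact: measurable_fun_pair.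
apply: eq_integral => y _.
have n2 : nnm (fun q : n.-tuple D * N.-tuple E => f ((q.1, upd a y u), q.2)).
  apply: nnm_comp => //; apply: measurable_fun_pair => //.
  by apply: measurable_fun_pair.
rewrite -(int_swap _ _ n2); apply: eq_integral => z _; rewrite /F /g /= tnth0.
apply: eq_integral => u' _ /=; congr (f (_, _, _)).
by apply: val_inj.
Qed.

End particle_system.

(** * Gaussian moments *)

Section density.
Context {R : realType} d (T : measurableType d) (mu m : {measure set T -> \bar R}).
Variable g : T -> R.
Hypotheses (mg : measurable_fun setT g) (g0 : forall x, 0 <= g x).
Hypothesis mE : forall A, measurable A -> (m A = \int[mu]_(x in A) (g x)%:E)%E.

Import HBNNSimple.

Let int_density_nnsfun (f : {nnsfun T >-> R}) :
  (\int[m]_x (f x)%:E = \int[mu]_x ((f x)%:E * (g x)%:E))%E.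
Proof.
have f1 r : measurable_fun setT (\1_(f @^-1` [set r]) : T -> R).
  exact: measurable_indic.
under [LHS]eq_integral do rewrite fimfunE -fsumEFin//.
rewrite [LHS]ge0_integral_fsum//; last 2 first.
  - by move=> r; apply/measurable_EFinP; exact: measurable_funM.
  - by move=> n x _; rewrite EFinM nnfun_muleindic_ge0.
under [RHS]eq_integral => x _.
  rewrite fimfunE -fsumEFin// muleC ge0_mule_fsumr; last first.
    by move=> r; rewrite EFinM nnfun_muleindic_ge0.
  over.
rewrite [RHS]ge0_integral_fsum//; last 2 first.
  - move=> r; apply/measurable_EFinP.
    by apply: measurable_funM => //; exact: measurable_funM.
  - move=> n x _; apply: mule_ge0; first by rewrite lee_fin.
    by rewrite EFinM nnfun_muleindic_ge0.
apply: eq_fsbigr => r /set_mem rf.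
rewrite integralZl_indic_nnsfun//= integral_indic// setIT mE//.
have r0 : 0 <= r by case: rf => x _ <-.
under [RHS]eq_integral => x _ do rewrite EFinM muleCA.
rewrite [RHS]ge0_integralZl//; first last.
- by move=> x _; rewrite mule_ge0 ?lee_fin// indicE.
- by apply/measurable_EFinP; exact: measurable_funM.
congr (_ * _)%E; rewrite integral_mkcond; apply: eq_integral => x _.
by rewrite patchE indicE; case: ifPn => h; rewrite ?mule1 ?mule0.
Qed.

Lemma int_density (f : T -> \bar R) : nnm f ->
  (\int[m]_x f x = \int[mu]_x (f x * (g x)%:E))%E.
Proof.
move=> [mf f0]; pose f_ := nnsfun_approx measurableT mf.
transitivity (lim (\int[m]_x (f_ n x)%:E @[n --> \oo])%E).
  rewrite -monotone_convergence//=.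
  - apply: eq_integral => ? /[!inE] xD; apply/esym/cvg_lim => //=.
    exact: cvg_nnsfun_approx.
  - by move=> n; exact/measurable_EFinP/measurable_funTS.
  - by move=> n ? _; rewrite lee_fin.
  - by move=> ? _ ? ? mn; rewrite lee_fin; exact/lefP/nd_nnsfun_approx.
under eq_fun do rewrite int_density_nnsfun.
rewrite -monotone_convergence//=.
- apply: eq_integral => x /[!inE] xD; apply/cvg_lim => //=.
  by apply: cvgeZr => //; exact: cvg_nnsfun_approx.
- by move=> n; apply/measurable_EFinP; exact: measurable_funM.
- by move=> n ? _; rewrite mule_ge0 ?lee_fin.
- move=> ? _ ? ? mn; rewrite lee_wpmul2r ?lee_fin//.
  exact/lefP/nd_nnsfun_approx.
Qed.

End density.

Section normal_moments.
Context {R : realType}.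

Lemma int_normal (m s : R) (f : R -> \bar R) : nnm f ->
  (\int[normal_prob m s]_x f x =
   \int[lebesgue_measure]_x (f x * (normal_pdf m s x)%:E))%E.
Proof.
move=> nf; apply: int_density => //; first exact: measurable_normal_pdf.
by move=> x; exact: normal_pdf_ge0.
Qed.

Lemma nnm_normal_pdf (m s : R) : nnm (fun x => (normal_pdf m s x)%:E).
Proof.
by apply: nnm_EFin; [exact: measurable_normal_pdf|exact: normal_pdf_ge0].
Qed.

Lemma measurable_expR_comp d (T : measurableType d) (f : T -> R) :
  measurable_fun setT f -> measurable_fun setT (fun x => expR (f x)).
Proof. by move=> mf; exact: (measurableT_comp (@measurable_expR R)). Qed.

(* [normal_prob] lives on an alias of R with another display. *)
Lemma gauss_exists (s : R) : exists m : probability R R, forall f : R -> \bar R,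
  nnm f -> (\int[m]_x f x = \int[normal_prob 0 s]_x f x)%E.
Proof.
have mi : measurable_fun setT (id : measurableTypeR R -> R) by move=> _ A mA; rewrite setTI.
by have [m mE] := int_push (normal_prob 0 s) mi; exists m.
Qed.

Definition gauss (s : R) : probability R R := sval (cid (gauss_exists s)).

Lemma gaussE (s : R) (f : R -> \bar R) : nnm f ->
  (\int[gauss s]_x f x = \int[normal_prob 0 s]_x f x)%E.
Proof. by rewrite /gauss; case: cid => /= m; apply. Qed.

(* Completing the square turns the integrand into a shifted normal density. *)
Lemma normal_mgf (s c : R) : s != 0 ->
  (\int[gauss s]_x (expR (c * x))%:E = (expR (s ^+ 2 * c ^+ 2 / 2))%:E)%E.
Proof.
have ne : nnm (fun x : R => (expR (c * x))%:E).
  by apply: nnm_EFin => [|x]; [exact/measurable_expR_comp/measurable_funM|exact: expR_ge0].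
move=> s0; rewrite gaussE// int_normal//.
transitivity (\int[lebesgue_measure]_x ((expR (s ^+ 2 * c ^+ 2 / 2))%:E *
    (normal_pdf (s ^+ 2 * c) s x)%:E))%E.
  apply: eq_integral => x _; rewrite -!EFinM; congr EFin.
  rewrite !normal_pdfE// mulrCA [RHS]mulrCA; congr (_ * _).
  rewrite /normal_fun -!expRD; congr expR.
  by rewrite -[_ *+ 2]mulr_natr; field.
rewrite int_scale ?expR_ge0//; last exact: nnm_normal_pdf.
by rewrite integral_normal_pdf mule1.
Qed.

(** Reflection invariance of Lebesgue measure. It serves to cancel the linear term in [normal_sqr],
    which is not a nonnegative integrand. *)
Lemma normal_sym (s : R) (f : R -> \bar R) : s != 0 -> nnm f ->
  (\int[gauss s]_x f (- x)%R = \int[gauss s]_x f x)%E.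
Proof.
move=> s0 nf; have mN : measurable_fun setT (fun x : R => - x) by exact: measurable_funN.
rewrite !gaussE//; last exact: nnm_comp nf mN.
rewrite !int_normal//; last exact: nnm_comp nf mN.
have [mh h0] := nnm_mul nf (nnm_normal_pdf 0 s).
transitivity (\int[pushforward lebesgue_measure (-%R : _ -> measurableTypeR R)]_x
    (f x * (normal_pdf 0 s x)%:E))%E.
  have h0' : {in [set: measurableTypeR R], forall x, 0 <= f x * (normal_pdf 0 s x)%:E}%E.
    by move=> x _; exact: h0.
  have mN' : measurable_fun [set: measurableTypeR R] (-%R : measurableTypeR R -> measurableTypeR R).
    exact: mN.
  rewrite (ge0_integral_pushforward mN' (lebesgue_measure : {measure set (measurableTypeR R) -> \bar R}) measurableT mh h0') preimage_setT.
  apply: eq_integral => x _ /=; rewrite !normal_pdfE//.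
  by rewrite /normal_fun !subr0 sqrrN.
by apply: eq_measure_integral => A mA _; exact: lebesgue_measureN.
Qed.

(** Instead of the exact variance, [x ^+ 2 <= 4 * (expR x + expR (- x))] is integrated at scale [s]
    with the moment generating function; this gives [8 * expR (1 / 2)], rounded up here. *)
Definition gauss_cst : R := 8 * expR 1.

Lemma gauss_cst_ge0 : 0 <= gauss_cst.
Proof. by rewrite mulr_ge0// expR_ge0. Qed.

Lemma sqr_le_exp (y : R) : y ^+ 2 <= 4 * (expR y + expR (- y)).
Proof.
wlog y0 : y / 0 <= y => [H|].
  have [|/ltW y0] := leP 0 y; first exact: H.
  by have := H (- y); rewrite opprK sqrrN addrC; apply; rewrite oppr_ge0.
have h : y ^+ 2 / 2 <= expR y.
  apply: le_trans (expR_ge1Dxn 1 y0); rewrite lerDr//.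
have := expR_ge0 (- y); have := sqr_ge0 y; lra.
Qed.

Lemma normal_sqr (s a c : R) : s != 0 ->
  (\int[gauss s]_x ((a + c * x) ^+ 2)%:E <=
   (a ^+ 2 + gauss_cst * (c ^+ 2 * s ^+ 2))%:E)%E.
Proof.
move=> s0.
have nq b : nnm (fun x : R => ((a + b * x) ^+ 2)%:E).
  apply: nnm_EFin => [|x]; last exact: sqr_ge0.
  by apply: measurable_funX; apply: measurable_funD => //; exact: measurable_funM.
have nx : nnm (fun x : R => (x ^+ 2)%:E).
  by apply: nnm_EFin => [|x]; [exact: measurable_funX|exact: sqr_ge0].
have ne b : nnm (fun x : R => (expR (b * x))%:E).
  by apply: nnm_EFin => [|x]; [exact/measurable_expR_comp/measurable_funM|exact: expR_ge0].
have h2 : (\int[gauss s]_x (x ^+ 2)%:E <= (gauss_cst * s ^+ 2)%:E)%E.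
  apply: (@le_trans _ _ (\int[gauss s]_x ((4 * s ^+ 2)%:E *
      ((expR (s^-1 * x))%:E + (expR (- s^-1 * x))%:E)))%E).
    apply: int_le => // [|x].
      apply: nnm_mul; last exact: nnm_add (ne _) (ne _).
      by apply: nnm_cst; rewrite lee_fin mulr_ge0// sqr_ge0.
    rewrite -EFinD -EFinM lee_fin.
    have := sqr_le_exp (s^-1 * x); rewrite exprMn -mulNr => h.
    have {h} := ler_wpM2l (sqr_ge0 s) h.
    by rewrite mulrA -exprMn mulfV// expr1n mul1r mulrA [s ^+ 2 * 4]mulrC.
  rewrite int_scale; [|exact: nnm_add (ne _) (ne _)|by rewrite mulr_ge0// sqr_ge0].
  rewrite int_add; [|exact: ne|exact: ne]; rewrite !normal_mgf// sqrrN exprVn mulfV ?expf_neq0// -EFinD -EFinM lee_fin.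
  have : expR (1 / 2) <= expR (1 : R) by rewrite ler_expR; lra.
  move=> h; rewrite /gauss_cst -mulr2n -mulr_natr.
  have := ler_wpM2l (sqr_ge0 s) h; nra.
(* The integral is added to its reflection, so that the cross terms cancel inside a nonnegative
   integrand. *)
have e : (\int[gauss s]_x ((a + c * x) ^+ 2)%:E +
    \int[gauss s]_x ((a + c * x) ^+ 2)%:E =
    \int[gauss s]_x ((2 * a ^+ 2)%:E + (2 * c ^+ 2)%:E * (x ^+ 2)%:E))%E.
  have n2 : nnm (fun x : R => ((a + c * - x) ^+ 2)%:E).
    by have := nq (- c); congr nnm; apply/funext => x; rewrite mulrN mulNr.
  rewrite -{2}normal_sym//; apply: etrans (esym (int_add _ (nq c) n2)) _.
  apply: eq_integral => x _; rewrite -EFinM -!EFinD; congr EFin; ring.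
have {e} e : (\int[gauss s]_x ((a + c * x) ^+ 2)%:E +
    \int[gauss s]_x ((a + c * x) ^+ 2)%:E <=
    (2 * a ^+ 2)%:E + (2 * c ^+ 2)%:E * (gauss_cst * s ^+ 2)%:E)%E.
  rewrite e int_add//; last 2 first.
  - by apply: nnm_cst; rewrite lee_fin mulr_ge0// sqr_ge0.
  - by apply: nnm_mul => //; apply: nnm_cst; rewrite lee_fin mulr_ge0// sqr_ge0.
  have c20 : 0 <= 2 * c ^+ 2 by rewrite mulr_ge0// sqr_ge0.
  rewrite int_cst int_scale//; apply: leeD2l.
  by apply: lee_wpmul2l; rewrite ?lee_fin.
have i0 : (0 <= \int[gauss s]_x ((a + c * x) ^+ 2)%:E)%E.
  by apply: integral_ge0 => x _; case: (nq c).
move: e i0; case: integral => [r| |] //.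
  by rewrite -EFinM -!EFinD !lee_fin => e _; lra.
Qed.

End normal_moments.
Section finite_sums.
Context {R : realType}.

(** Lagrange's identity: the double sum of the squares [(x i * y j - x j * y i) ^+ 2] is twice the
    gap. *)
Lemma sum_cauchy_schwarz (I : finType) (x y : I -> R) :
  (\sum_i x i * y i) ^+ 2 <= (\sum_i x i ^+ 2) * (\sum_i y i ^+ 2).
Proof.
have : 0 <= \sum_i \sum_j (x i * y j - x j * y i) ^+ 2.
  by apply: sumr_ge0 => i _; apply: sumr_ge0 => j _; exact: sqr_ge0.
have e i : \sum_j (x i * y j - x j * y i) ^+ 2 =
    x i ^+ 2 * \sum_j y j ^+ 2 - 2 * (x i * y i) * (\sum_j x j * y j)
    + y i ^+ 2 * \sum_j x j ^+ 2.
  rewrite !mulr_sumr -sumrB -big_split /=; apply: eq_bigr => j _; ring.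
under eq_bigr do rewrite e.
rewrite big_split sumrB /= -!mulr_suml -mulr_sumr => h.
by rewrite expr2; lra.
Qed.

Lemma mean_sqr_le n (x : 'I_n -> R) : (0 < n)%N ->
  (n%:R^-1 * \sum_i x i) ^+ 2 <= n%:R^-1 * \sum_i x i ^+ 2.
Proof.
move=> n0; have nR : 0 < n%:R :> R by rewrite ltr0n.
have := sum_cauchy_schwarz x (fun=> 1).
under eq_bigr do rewrite mulr1.
rewrite expr1n sumr_const card_ord exprMn => h.
rewrite expr2 -mulrA ler_pM2l ?invr_gt0// -(ler_pM2l nR) mulrA mulfV ?gt_eqF//.
by rewrite mul1r mulrC (le_trans h)// mulrC.
Qed.

End finite_sums.

Section gaussian_vectors.
Context {R : realType}.

Definition gvec n (s : R) : probability (n.-tuple R) R := iid (gauss s) n.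

Lemma measurable_lin n (a : R) (c : 'I_n -> R) :
  measurable_fun setT (fun v : n.-tuple R => a + \sum_i c i * tnth v i).
Proof.
apply: measurable_funD => //; apply: measurable_sum => i.
by apply: measurable_funM => //; exact: measurable_tnth.
Qed.

Lemma nnm_lin_sqr n (a : R) (c : 'I_n -> R) :
  nnm (fun v : n.-tuple R => ((a + \sum_i c i * tnth v i) ^+ 2)%:E).
Proof.
apply: nnm_EFin => [|v]; last exact: sqr_ge0.
by apply: measurable_funX; exact: measurable_lin.
Qed.

Lemma gvec_sqr n (s a : R) (c : 'I_n -> R) : s != 0 ->
  (\int[gvec n s]_v ((a + \sum_i c i * tnth v i) ^+ 2)%:E <=
   (a ^+ 2 + gauss_cst * (s ^+ 2 * \sum_i c i ^+ 2))%:E)%E.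
Proof.
move=> s0; elim: n a c => [|n IH] a c.
  rewrite /gvec iid0; last exact: nnm_lin_sqr.
  by rewrite !big_ord0 mulr0 mulr0 !addr0.
rewrite /gvec iidS; last exact: nnm_lin_sqr.
set S := \sum_(i < n) c (lift ord0 i) ^+ 2.
have S0 : 0 <= gauss_cst * (s ^+ 2 * S).
  apply: mulr_ge0 gauss_cst_ge0 _; apply: mulr_ge0 (sqr_ge0 _) _.
  by apply: sumr_ge0 => i _; exact: sqr_ge0.
have nz : nnm (fun z : R => ((a + c ord0 * z) ^+ 2)%:E).
  apply: nnm_EFin => [|z]; last exact: sqr_ge0.
  by apply: measurable_funX; apply: measurable_funD => //; exact: measurable_funM.
apply: (@le_trans _ _ (\int[gauss s]_z (((a + c ord0 * z) ^+ 2)%:E +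
    (gauss_cst * (s ^+ 2 * S))%:E))%E).
  apply: int_le.
  - exact: (nnm_iidS (gauss s) (nnm_lin_sqr a c)).
  - by apply: nnm_add => //; exact: nnm_cst.
  move=> z; have := IH (a + c ord0 * z) (fun i => c (lift ord0 i)).
  rewrite /gvec -/S -EFinD => h; apply: le_trans h.
  rewrite le_eqVlt; apply/orP; left; apply/eqP; apply: eq_integral => u _.
  rewrite big_ord_recl tnth0; congr ((_ ^+ 2)%:E); rewrite addrA; congr (_ + _).
  by apply: eq_bigr => i _; rewrite tnthS.
rewrite int_add; [|exact: nz|exact: nnm_cst].
rewrite int_cst; apply: (le_trans (leeD2r _ (normal_sqr _ _ s0))).
rewrite -EFinD lee_fin big_ord_recl -/S; lra.
Qed.

Lemma gvec_exp n (s : R) (c : 'I_n -> R) : s != 0 ->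
  (\int[gvec n s]_v (expR (\sum_i c i * tnth v i))%:E =
   (expR (s ^+ 2 / 2 * \sum_i c i ^+ 2))%:E)%E.
Proof.
move=> s0.
under eq_integral => v _ do rewrite expR_sum -prodEFin.
rewrite (iid_prod (gauss s) (g := fun i x => (expR (c i * x))%:E)); last first.
  by move=> i; apply: nnm_EFin => [|x]; [exact/measurable_expR_comp/measurable_funM|exact: expR_ge0].
under eq_bigr => i _ do rewrite normal_mgf//.
rewrite prodEFin -expR_sum mulr_sumr; congr ((expR _)%:E).
by apply: eq_bigr => i _; ring.
Qed.

Lemma nnm_exp_lin n (c : 'I_n -> R) :
  nnm (fun v : n.-tuple R => (expR (\sum_i c i * tnth v i))%:E).
Proof.
apply: nnm_EFin => [|v]; last exact: expR_ge0.
apply: measurable_expR_comp; apply: measurable_sum => i.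
by apply: measurable_funM => //; exact: measurable_tnth.
Qed.

Lemma gblock_exp m n (s : R) (c : 'I_m -> 'I_n -> R) : s != 0 ->
  (\int[iid (gvec n s) m]_y
     (expR (\sum_k \sum_i c k i * tnth (tnth y k) i))%:E =
   (expR (s ^+ 2 / 2 * \sum_k \sum_i c k i ^+ 2))%:E)%E.
Proof.
move=> s0.
under eq_integral => v _ do rewrite expR_sum -prodEFin.
rewrite (iid_prod (gvec n s)
  (g := fun k (x : n.-tuple R) => (expR (\sum_i c k i * tnth x i))%:E)); last first.
  by move=> k; exact: nnm_exp_lin.
under eq_bigr => k _ do rewrite gvec_exp//.
by rewrite prodEFin -expR_sum mulr_sumr.
Qed.

End gaussian_vectors.

(** * Second moments of Gaussian likelihood ratios over a data block *)

Section likelihood.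
Context {R : realType} (m n : nat) (D : R).
Hypothesis D0 : 0 < D.
Implicit Types (a b : 'I_m -> 'I_n -> R).

Definition gblock : probability (m.-tuple (n.-tuple R)) R :=
  iid (gvec n (Num.sqrt D)) m.

(** The discrete Girsanov density of observations with drift [a] against pure noise of step [D]. *)
Definition lik a (y : m.-tuple (n.-tuple R)) : R :=
  expR (\sum_k (\sum_i a k i * tnth (tnth y k) i - D / 2 * \sum_i a k i ^+ 2)).

Definition sqdist a b : R := D * \sum_k \sum_i (a k i - b k i) ^+ 2.

Lemma lik_gt0 a y : 0 < lik a y. Proof. exact: expR_gt0. Qed.

Lemma measurable_lik a : measurable_fun setT (lik a).
Proof.
apply: measurable_expR_comp; apply: measurable_sum => k.
apply: measurable_funB => //; apply: measurable_sum => i.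
apply: measurable_funM => //.
exact: (measurableT_comp (@measurable_tnth _ _ _ i) (@measurable_tnth _ _ _ k)).
Qed.

Lemma nnm_lik_mul a b : nnm (fun y => (lik a y * lik b y)%:E).
Proof.
apply: nnm_EFin => [|y]; last by rewrite mulr_ge0// ltW// lik_gt0.
by apply: measurable_funM; exact: measurable_lik.
Qed.

(** The Gaussian exponential moment of [a + b] cancels the quadratic corrections of both factors and
    leaves only the inner product, with no error term. *)
Lemma lik_mul a b :
  (\int[gblock]_y (lik a y * lik b y)%:E =
   (expR (D * \sum_k \sum_i a k i * b k i))%:E)%E.
Proof.
have s0 : Num.sqrt D != 0 by rewrite gt_eqF// sqrtr_gt0.
pose e0 := - (D / 2 * \sum_k \sum_i (a k i ^+ 2 + b k i ^+ 2)).
transitivity (\int[gblock]_y ((expR e0)%:E *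
    (expR (\sum_k \sum_i (a k i + b k i) * tnth (tnth y k) i))%:E))%E.
  apply: eq_integral => y _; rewrite -EFinM -!expRD; congr ((expR _)%:E).
  rewrite /e0 -big_split /= mulr_sumr -sumrN -big_split /=; apply: eq_bigr => k _.
  rewrite big_split /= (_ : \sum_i (a k i + b k i) * tnth (tnth y k) i =
    \sum_i a k i * tnth (tnth y k) i + \sum_i b k i * tnth (tnth y k) i); last first.
    by rewrite -big_split; apply: eq_bigr => i _; rewrite mulrDl.
  by ring.
rewrite int_scale ?expR_ge0//; last first.
  apply: nnm_EFin => [|y]; last exact: expR_ge0.
  apply: measurable_expR_comp; apply: measurable_sum => k; apply: measurable_sum => i.
  apply: measurable_funM => //.
  exact: (measurableT_comp (@measurable_tnth _ _ _ i) (@measurable_tnth _ _ _ k)).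
rewrite gblock_exp// -EFinM -expRD; congr ((expR _)%:E).
rewrite /e0 sqr_sqrtr ?ltW// -mulrN -mulrDr -mulrA; congr (_ * _).
rewrite -sumrN -big_split /= mulr_sumr; apply: eq_bigr => k _.
rewrite -sumrN -big_split /= mulr_sumr; apply: eq_bigr => i _.
by field.
Qed.

Variable H : R.
Hypothesis mD : m%:R * D <= 1.
Definition lik_exponent : R := n%:R * H ^+ 2.
(** One constant for both the second moment [lik_sqr] and the gap [lik_diff]; the factor
    [1 + lik_exponent] comes from [exp_gap]. *)
Definition lik_cst : R := expR lik_exponent * (1 + lik_exponent).

Lemma lik_exponent_ge0 : 0 <= lik_exponent.
Proof. by rewrite mulr_ge0// sqr_ge0. Qed.

Lemma lik_cst_ge0 : 0 <= lik_cst.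
Proof. by rewrite mulr_ge0 ?expR_ge0// addr_ge0// lik_exponent_ge0. Qed.

Lemma expR_le_lik_cst : expR lik_exponent <= lik_cst.
Proof. by rewrite ler_peMr ?expR_ge0// lerDl lik_exponent_ge0. Qed.

Lemma sqdist_ge0 a b : 0 <= sqdist a b.
Proof.
apply: mulr_ge0 (ltW D0) _; apply: sumr_ge0 => k _; apply: sumr_ge0 => i _.
exact: sqr_ge0.
Qed.

Lemma energy_le a : (forall k i, `|a k i| <= H) ->
  D * \sum_k \sum_i a k i ^+ 2 <= lik_exponent.
Proof.
move=> aH; apply: (@le_trans _ _ (D * \sum_(k < m) \sum_(i < n) H ^+ 2)).
  apply: (ler_wpM2l (ltW D0)); apply: ler_sum => k _; apply: ler_sum => i _.
  have aki := aH k i; rewrite -[leLHS]real_normK ?num_real// lerXn2r ?nnegrE//.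
  exact: le_trans aki.
rewrite !sumr_const !card_ord -mulr_natl -[H ^+ 2 *+ n]mulr_natl mulrA -/lik_exponent.
by rewrite [D * _]mulrC ler_piMl// lik_exponent_ge0.
Qed.

Lemma lik_sqr a : (forall k i, `|a k i| <= H) ->
  (\int[gblock]_y (lik a y ^+ 2)%:E <= lik_cst%:E)%E.
Proof.
move=> aH; under eq_integral do rewrite expr2.
rewrite lik_mul lee_fin; apply: le_trans expR_le_lik_cst; rewrite ler_expR.
by apply: le_trans (energy_le aH).
Qed.

(** Here [A], [B] are energies and [c] their inner product, in polarized form. The left side splits
    into [(expR (A / 2) - expR (B / 2)) ^+ 2], controlled by [(A - B) ^+ 2], and [2 * expR ((A + B)
    / 2) * (1 - expR (- (dl / 2)))], controlled by [dl]. *)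
Lemma exp_gap (A B c M dl : R) : A <= M -> B <= M -> 0 <= M -> 0 <= dl ->
  c = (A + B) / 2 - dl / 2 -> (A - B) ^+ 2 <= 4 * M * dl ->
  expR A + expR B - 2 * expR c <= expR M * (1 + M) * dl.
Proof.
move=> AM BM M0 dl0 -> AB.
have e1 x : 1 - expR (- x) <= x :> R.
  by have := expR_ge1Dx (- x); lra.
have lip x y : x <= M -> y <= M ->
    (expR (x / 2) - expR (y / 2)) ^+ 2 <= expR M * (x - y) ^+ 2 / 4.
  wlog yx : x y / y <= x => [hw xM yM|xM yM].
    have [yx|/ltW xy] := leP y x; first exact: hw.
    rewrite -[X in X <= _]sqrrN opprB (le_trans (hw y x xy yM xM))//.
    by rewrite -[(y - x)]opprB sqrrN.
  have -> : expR (x / 2) - expR (y / 2) = expR (x / 2) * (1 - expR (- ((x - y) / 2))).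
    by rewrite mulrBr mulr1 -expRD; congr (_ - expR _); field.
  rewrite exprMn -expRM_natl.
  have -> : expR (2 * (x / 2)) = expR x by congr expR; field.
  have -> : expR M * (x - y) ^+ 2 / 4 = expR M * ((x - y) / 2) ^+ 2 by field.
  have h0 : 0 <= 1 - expR (- ((x - y) / 2)).
    by rewrite subr_ge0 -[leRHS]expR0 ler_expR; lra.
  apply: ler_pM; rewrite ?expR_ge0 ?sqr_ge0 ?ler_expR//.
  by rewrite lerXn2r ?nnegrE//; lra.
have -> : expR ((A + B) / 2 - dl / 2) = expR ((A + B) / 2) * expR (- (dl / 2)).
  by rewrite -expRD.
have hAB : expR A + expR B - 2 * expR ((A + B) / 2) <= expR M * M * dl.
  have -> : expR A + expR B - 2 * expR ((A + B) / 2) = (expR (A / 2) - expR (B / 2)) ^+ 2.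
    have hx x : expR x = expR (x / 2) * expR (x / 2) :> R.
      by rewrite -expRD; congr expR; field.
    have -> : expR ((A + B) / 2) = expR (A / 2) * expR (B / 2).
      by rewrite -expRD; congr expR; field.
    by rewrite (hx A) (hx B); ring.
  apply: (le_trans (lip _ _ AM BM)).
  have := ler_wpM2l (expR_ge0 M) AB; lra.
have h2 : expR ((A + B) / 2) * (1 - expR (- (dl / 2))) <= expR M * (dl / 2).
  have h0 : 0 <= 1 - expR (- (dl / 2)).
    by rewrite subr_ge0 -[leRHS]expR0 ler_expR; lra.
  by apply: ler_pM; rewrite ?expR_ge0// ler_expR; lra.
by lra.
Qed.

Lemma nnm_lik_diff a b : nnm (fun y => ((lik a y - lik b y) ^+ 2)%:E).
Proof.
apply: nnm_EFin => [|y]; last exact: sqr_ge0.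
by apply: measurable_funX; apply: measurable_funB; exact: measurable_lik.
Qed.

Lemma lik_diff a b : (forall k i, `|a k i| <= H) -> (forall k i, `|b k i| <= H) ->
  (\int[gblock]_y ((lik a y - lik b y) ^+ 2)%:E <= (lik_cst * sqdist a b)%:E)%E.
Proof.
move=> aH bH.
pose A := D * \sum_k \sum_i a k i * a k i.
pose B := D * \sum_k \sum_i b k i * b k i.
pose c := D * \sum_k \sum_i a k i * b k i.
have e : (\int[gblock]_y ((lik a y - lik b y) ^+ 2)%:E + 2%:E * (expR c)%:E =
    (expR A)%:E + (expR B)%:E)%E.
  have n2 : nnm (fun y => (2%:E * (lik a y * lik b y)%:E)%E).
    by apply: nnm_mul; [exact: nnm_cst|exact: nnm_lik_mul].
  rewrite /A /B /c -!lik_mul -(int_scale _ (nnm_lik_mul a b))//.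
  apply: etrans (etrans (esym (int_add gblock (nnm_lik_diff a b) n2)) _)
    (int_add gblock (nnm_lik_mul a a) (nnm_lik_mul b b)).
  apply: eq_integral => y _; rewrite -EFinM -!EFinD; congr EFin; ring.
have AM : A <= lik_exponent by exact: energy_le.
have BM : B <= lik_exponent by exact: energy_le.
have hd : c = (A + B) / 2 - sqdist a b / 2.
  rewrite /c /A /B /sqdist -!mulrDr -mulrA -[in X in _ - X]mulrA -mulrBr; congr (_ * _).
  rewrite -mulrBl -big_split /= -sumrB mulr_suml; apply: eq_bigr => k _.
  rewrite -big_split /= -sumrB mulr_suml; apply: eq_bigr => i _.
  by field.
(* [A - B] is the inner product of [a - b] and [a + b]: Cauchy-Schwarz leaves [sqdist a b] times the
   energy of [a + b], which the parallelogram identity bounds by [2 * A + 2 * B]. *)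
have AB : (A - B) ^+ 2 <= 4 * lik_exponent * sqdist a b.
  have -> : A - B = D * \sum_(p : 'I_m * 'I_n)
      (a p.1 p.2 - b p.1 p.2) * (a p.1 p.2 + b p.1 p.2).
    rewrite -(pair_bigA _ (fun k i => (a k i - b k i) * (a k i + b k i))) /=.
    rewrite /A /B -mulrBr -sumrB; congr (_ * _); apply: eq_bigr => k _.
    by rewrite -sumrB; apply: eq_bigr => i _; ring.
  rewrite exprMn; apply: (le_trans (ler_wpM2l (sqr_ge0 D) (sum_cauchy_schwarz _ _))).
  rewrite -(pair_bigA _ (fun k i => (a k i - b k i) ^+ 2)) /=.
  rewrite -(pair_bigA _ (fun k i => (a k i + b k i) ^+ 2)) /=.
  rewrite expr2 mulrACA -/(sqdist a b) mulrC ler_wpM2r ?sqdist_ge0//.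
  have -> : \sum_k \sum_i (a k i + b k i) ^+ 2 = 2 * (\sum_k \sum_i a k i * a k i) +
      2 * (\sum_k \sum_i b k i * b k i) - \sum_k \sum_i (a k i - b k i) ^+ 2.
    rewrite !mulr_sumr -big_split /= -sumrB; apply: eq_bigr => k _.
    rewrite !mulr_sumr -big_split /= -sumrB; apply: eq_bigr => i _.
    by ring.
  rewrite mulrBr mulrDr -/(sqdist a b).
  rewrite ![D * (2 * _)]mulrCA -/A -/B; have := sqdist_ge0 a b; lra.
have := exp_gap AM BM lik_exponent_ge0 (sqdist_ge0 a b) hd AB.
have i0 : (0 <= \int[gblock]_y ((lik a y - lik b y) ^+ 2)%:E)%E.
  by apply: integral_ge0 => x _; case: (nnm_lik_diff a b).
(* Identity [e] is additive in the extended reals; its finite right side forces the integral to be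
   finite. *)
move: e i0; rewrite /lik_cst; case: integral => [r| |] //=.
rewrite -EFinM -!EFinD => -[e] _ h; rewrite lee_fin; lra.
Qed.

End likelihood.

(** * Coupled Euler schemes *)

Lemma measurable_sqrt {R : realType} : measurable_fun setT (@Num.sqrt R).
Proof. by apply: continuous_measurable_fun; exact: sqrt_continuous. Qed.

Section lipschitz_measurable.
Context {R : realType} (n : nat).
Implicit Types x y : n.-tuple R.

Definition d2 x y : R := \sum_i (tnth x i - tnth y i) ^+ 2.

Lemma d2_ge0 x y : 0 <= d2 x y.
Proof. by apply: sumr_ge0 => i _; exact: sqr_ge0. Qed.

Lemma d2xx x : d2 x x = 0.
Proof. by rewrite /d2 big1// => i _; rewrite subrr expr0n. Qed.

Lemma d2_tri x y z : d2 x z <= 2 * d2 x y + 2 * d2 y z.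
Proof.
rewrite /d2 !mulr_sumr -big_split; apply: ler_sum => i _ /=.
have := sqr_ge0 ((tnth x i - tnth y i) - (tnth y i - tnth z i)); nra.
Qed.

Lemma edist_sq x y : Defs.edist x y ^+ 2 = d2 x y.
Proof. by rewrite sqr_sqrtr// d2_ge0. Qed.

Lemma edist_ge0 x y : 0 <= Defs.edist x y. Proof. exact: sqrtr_ge0. Qed.

Lemma measurable_d2 d (T : measurableType d) (f g : T -> n.-tuple R) :
  measurable_fun setT f -> measurable_fun setT g ->
  measurable_fun setT (fun t => d2 (f t) (g t)).
Proof.
move=> /measurable_fun_tnthP mf /measurable_fun_tnthP mg.
apply: measurable_sum => i; apply: measurable_funX.
by apply: measurable_funB; [exact: mf|exact: mg].
Qed.

Lemma rat_tuple_dense x (e : R) : 0 < e ->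
  exists q : n.-tuple rat, Defs.edist x (map_tuple ratr q) < e.
Proof.
move=> e0; pose eta := e / n.+1%:R.
have eta0 : 0 < eta by rewrite divr_gt0.
have qi i : exists q : rat, `|tnth x i - ratr q| < eta.
  have [|q] := @rat_in_itvoo R (tnth x i) (tnth x i + eta); first by rewrite ltrDl.
  rewrite in_itv /= => /andP[h1 h2]; exists q.
  by rewrite distrC ger0_norm ?subr_ge0 ?(ltW h1)// ltrBlDl.
have [g gq] := choice qi.
exists [tuple g i | i < n].
rewrite -[ltRHS]gtr0_norm// -[ltRHS]sqrtr_sqr ltr_sqrt ?exprn_gt0//.
apply: (@le_lt_trans _ _ (\sum_(i < n) eta ^+ 2)).
  apply: ler_sum => i _; rewrite tnth_map tnth_mktuple -[leLHS]real_normK ?num_real//.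
  by rewrite lerXn2r ?nnegrE//; exact: ltW.
rewrite sumr_const card_ord -mulr_natl /eta expr_div_n mulrCA gtr_pMr ?exprn_gt0//.
rewrite ltr_pdivrMr ?exprn_gt0// mul1r -natrX ltr_nat expnS expn1.
by rewrite (leq_trans (ltnSn n))// leq_pmulr.
Qed.

Lemma lipschitz_measurable (f : n.-tuple R -> R) : lipschitz2 f ->
  measurable_fun setT f.
Proof.
move=> [K0 fK0]; pose K := `|K0|; have Kge0 : 0 <= K by exact: normr_ge0.
have fK x y : `|f x - f y| <= K * Defs.edist x y.
  by apply: le_trans (fK0 x y) _; rewrite ler_wpM2r ?edist_ge0// ler_norm.
move=> mT; apply: (measurability _ (RGenOInfty.measurableE R)) => //.
move=> _ [_ [c ->] <-]; rewrite setTI.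
pose B (q : n.-tuple rat) : set (n.-tuple R) :=
  [set x | c < f (map_tuple ratr q) - K * Defs.edist x (map_tuple ratr q)].
have -> : f @^-1` `]c, +oo[ = \bigcup_q B q.
  apply/seteqP; split => x /=; rewrite in_itv /= andbT; last first.
    move=> [q _]; rewrite /B /= => h; apply: lt_le_trans h _.
    by have := fK x (map_tuple ratr q); rewrite ler_norml => /andP[]; lra.
  (* The cone at a point [q] within [e] of [x] loses at most [2 * K * e < f x - c]; the summand [1]
     keeps the denominator positive when [K = 0]. *)
  move=> cf; pose e := (f x - c) / (2 * K + 1).
  have K0' : 0 < 2 * K + 1 by lra.
  have e0 : 0 < e by rewrite divr_gt0// subr_gt0.
  have [q hq] := rat_tuple_dense x e0; exists q => //; rewrite /B /=.
  have h1 : f x - f (map_tuple ratr q) <= K * Defs.edist x (map_tuple ratr q).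
    exact: le_trans (ler_norm _) (fK _ _).
  have h2 : K * Defs.edist x (map_tuple ratr q) <= K * e by rewrite ler_wpM2l// ltW.
  have h3 : (2 * K + 1) * e = f x - c by rewrite mulrC divfK// gt_eqF.
  lra.
apply: countable_bigcupT_measurable => // q.
have mh : measurable_fun setT (fun x => f (map_tuple ratr q) - K * Defs.edist x (map_tuple ratr q)).
  apply: measurable_funB => //; apply: measurable_funM => //.
  apply: (measurableT_comp measurable_sqrt).
  exact: (@measurable_d2 _ _ id (fun=> map_tuple ratr q)).
by have := mh measurableT `]c, +oo[%classic (measurable_itv _); rewrite setTI;
  congr measurable; apply/seteqP; split => x /=; rewrite in_itv /= andbT.
Qed.

Lemma lipschitz_sqr (f : n.-tuple R -> R) : lipschitz2 f ->
  exists2 K, 0 <= K & forall x y, (f x - f y) ^+ 2 <= K * d2 x y.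
Proof.
move=> [K fK]; exists (K ^+ 2) => [|x y]; first exact: sqr_ge0.
rewrite -edist_sq -exprMn -[leLHS]real_normK ?num_real//.
by rewrite lerXn2r ?nnegrE// (le_trans _ (fK x y)).
Qed.

End lipschitz_measurable.
Section euler.
Context {R : realType} (dx : nat) (b : dx.-tuple R -> dx.-tuple R)
  (sigma : dx.-tuple R -> 'M[R]_dx) (K : R).
Local Notation vec := (dx.-tuple R).
Hypothesis K0 : 0 <= K.
Hypothesis lip_b : forall x y i, (tnth (b x) i - tnth (b y) i) ^+ 2 <= K * d2 x y.
Hypothesis lip_s : forall x y i j, (sigma x i j - sigma y i j) ^+ 2 <= K * d2 x y.
Hypothesis bnd_b : forall x i, tnth (b x) i ^+ 2 <= K.
Hypothesis bnd_s : forall x i j, sigma x i j ^+ 2 <= K.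
Hypothesis mb : forall i, measurable_fun setT (fun x => tnth (b x) i).
Hypothesis ms : forall i j, measurable_fun setT (fun x => sigma x i j).

Lemma tnth_euler_step l (x v : vec) i : tnth (euler_step b sigma l x v) i =
  tnth x i + tnth (b x) i * delta R l + \sum_(j < dx) sigma x i j * tnth v j.
Proof. by rewrite tnth_mktuple. Qed.

Lemma measurable_euler_step l d (T : measurableType d) (f g : T -> vec) :
  measurable_fun setT f -> measurable_fun setT g ->
  measurable_fun setT (fun t => euler_step b sigma l (f t) (g t)).
Proof.
move=> mf mg; apply/measurable_fun_tnthP => i.
have /measurable_fun_tnthP mf' := mf; have /measurable_fun_tnthP mg' := mg.
rewrite (_ : _ \o _ = fun t => tnth (f t) i + tnth (b (f t)) i * delta R l
    + \sum_(j < dx) sigma (f t) i j * tnth (g t) j); last first.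
  by apply/funext => t; rewrite /= tnth_euler_step.
apply: measurable_funD.
  apply: measurable_funD; first exact: mf'.
  by apply: measurable_funM => //; exact: (measurableT_comp (mb i) mf).
apply: measurable_sum => j; apply: measurable_funM; last exact: mg'.
exact: (measurableT_comp (ms i j) mf).
Qed.

Definition addv (v w : vec) : vec := [tuple tnth v i + tnth w i | i < dx].

Lemma measurable_addv d (T : measurableType d) (f g : T -> vec) :
  measurable_fun setT f -> measurable_fun setT g ->
  measurable_fun setT (fun t => addv (f t) (g t)).
Proof.
move=> /measurable_fun_tnthP mf /measurable_fun_tnthP mg.
apply/measurable_fun_tnthP => i.
rewrite (_ : _ \o _ = fun t => tnth (f t) i + tnth (g t) i); last first.
  by apply/funext => t; rewrite /= tnth_mktuple.
by apply: measurable_funD; [exact: mf|exact: mg].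
Qed.

Variable l : nat.
Local Notation D := (delta R l.+1).
Local Notation st := (euler_step b sigma l.+1).
Local Notation stc := (euler_step b sigma l).
Local Notation gv := (gvec dx (Num.sqrt D)).
Local Notation g := (@gauss_cst R).

Lemma delta_gt0 k : 0 < delta R k. Proof. by rewrite invr_gt0 exprn_gt0. Qed.

Lemma delta_le1 k : delta R k <= 1.
Proof. by rewrite invf_le1 ?exprn_gt0// exprn_ege1// ler1n. Qed.

Lemma deltaS k : delta R k = 2 * delta R k.+1.
Proof. by rewrite /delta exprS invfM mulrA mulfV ?mul1r. Qed.

Definition step_cst : R := dx%:R * (K * (1 + g * dx%:R)).
Definition mix_cst : R := dx%:R * (K * (2 + g * dx%:R)).
(** Gronwall rate of [int_path_cost]: [6 + 4 * mix_cst] collects the coefficients of [D * d2 x xc]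
    and the rest those of [D ^+ 2], from both the running cost and [two_steps]. *)
Definition coupling_rate : R := 6 + 4 * mix_cst + 2 * mix_cst * step_cst + 2 * step_cst.

Lemma step_cst_ge0 : 0 <= step_cst.
Proof.
by rewrite /step_cst; do 2!apply: mulr_ge0 => //; rewrite addr_ge0// mulr_ge0// gauss_cst_ge0.
Qed.

Lemma mix_cst_ge0 : 0 <= mix_cst.
Proof.
by rewrite /mix_cst; do 2!apply: mulr_ge0 => //; rewrite addr_ge0// mulr_ge0// gauss_cst_ge0.
Qed.

Lemma coupling_rate_ge0 : 0 <= coupling_rate.
Proof.
have := step_cst_ge0; have := mix_cst_ge0; rewrite /coupling_rate => h1 h2.
have := mulr_ge0 h1 h2; nra.
Qed.

Let sD0 : Num.sqrt D != 0.
Proof. by rewrite gt_eqF// sqrtr_gt0 delta_gt0. Qed.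

Let sD2 : Num.sqrt D ^+ 2 = D.
Proof. by rewrite sqr_sqrtr// ltW// delta_gt0. Qed.

Lemma affine_sqr (a : 'I_dx -> R) (c : 'I_dx -> 'I_dx -> R) :
  (\int[gv]_v (\sum_i (a i + \sum_j c i j * tnth v j) ^+ 2)%:E <=
   (\sum_i (a i ^+ 2 + g * (D * \sum_j c i j ^+ 2)))%:E)%E.
Proof.
under eq_integral => v _ do rewrite -sumEFin.
rewrite int_sum; last by move=> i; exact: nnm_lin_sqr.
rewrite -sumEFin; apply: lee_sum => i _.
by have := gvec_sqr (a i) (c i) sD0; rewrite sD2.
Qed.

Lemma nnm_d2 d (T : measurableType d) (p q : T -> vec) :
  measurable_fun setT p -> measurable_fun setT q -> nnm (fun t => (d2 (p t) (q t))%:E).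
Proof.
by move=> mp mq; apply: nnm_EFin => [|t]; [exact: measurable_d2|exact: d2_ge0].
Qed.

Lemma step_increment x :
  (\int[gv]_v (d2 (st x v) x)%:E <= (step_cst * D)%:E)%E.
Proof.
have D1 := delta_le1 l.+1; have D0 := delta_gt0 l.+1.
under eq_integral => v _.
  rewrite /d2; under eq_bigr => i _.
    rewrite tnth_euler_step (_ : _ - _ = tnth (b x) i * D + \sum_j sigma x i j * tnth v j).
    over.
    by rewrite addrAC [_ + _ - tnth x i]addrAC subrr add0r.
  over.
apply: (le_trans (affine_sqr _ _)); rewrite lee_fin.
apply: (@le_trans _ _ (\sum_(i < dx) (K * D + g * (D * (dx%:R * K))))).
  apply: ler_sum => i _; apply: lerD.
    rewrite exprMn; apply: ler_pM; rewrite ?sqr_ge0//.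
    by rewrite expr2 ler_piMr// ltW.
  apply: ler_wpM2l; first exact: gauss_cst_ge0.
  apply: ler_wpM2l; first exact: ltW.
  rewrite mulr_natl -[X in _ *+ X]card_ord -sumr_const.
  by apply: ler_sum => j _; exact: bnd_s.
by rewrite sumr_const card_ord /step_cst -mulr_natl; nra.
Qed.

Lemma step_distance x xc :
  (\int[gv]_v (d2 (st x v) xc)%:E <= (2 * d2 x xc + 2 * step_cst * D)%:E)%E.
Proof.
have nd y : nnm (fun v => (d2 (st x v) y)%:E).
  by apply: nnm_d2 => //; exact: measurable_euler_step.
apply: (@le_trans _ _ (\int[gv]_v (2%:E * (d2 (st x v) x)%:E + (2 * d2 x xc)%:E))%E).
  apply: int_le => //.
    apply: nnm_add; first by apply: nnm_mul => //; exact: nnm_cst.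
    by apply: nnm_cst; rewrite lee_fin mulr_ge0// d2_ge0.
  by move=> v; rewrite -EFinM -EFinD lee_fin; exact: d2_tri.
rewrite int_add; last 2 first.
- by apply: nnm_mul => //; exact: nnm_cst.
- by apply: nnm_cst; rewrite lee_fin mulr_ge0// d2_ge0.
rewrite int_scale// int_cst [X in (_ <= X%:E)%E]addrC [leRHS]EFinD; apply: leeD2r.
by rewrite -mulrA EFinM; apply: lee_wpmul2l; rewrite ?lee_fin//; exact: step_increment.
Qed.

(** The coefficient of [d2 x xc] has to be [1 + O(D)], not merely a constant, to survive the
    iteration over [2 ^ l] coarse steps. It is so because the noise is centred: its contribution
    adds to the squared drift part instead of mixing with it. *)
Lemma two_steps x xc :
  (\int[gv]_v1 \int[gv]_v2 (d2 (st (st x v1) v2) (stc xc (addv v1 v2)))%:E <=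
   ((1 + (3 + 4 * mix_cst) * D) * d2 x xc + 2 * mix_cst * step_cst * D ^+ 2)%:E)%E.
Proof.
have D1 := delta_le1 l.+1; have D0 := delta_gt0 l.+1.
(* The coarse step is read as two fine ones with coefficients frozen at [xc]: [a] and [S] are the
   drift and noise errors of the first half, [e] and [B] those of the second. *)
pose a i := (tnth x i - tnth xc i) + D * (tnth (b x) i - tnth (b xc) i).
pose S i j := sigma x i j - sigma xc i j.
pose e v1 i := D * (tnth (b (st x v1)) i - tnth (b xc) i).
pose B v1 i j := sigma (st x v1) i j - sigma xc i j.
have inner v1 : (\int[gv]_v2 (d2 (st (st x v1) v2) (stc xc (addv v1 v2)))%:E <=
    ((1 + D) * \sum_i (a i + \sum_j S i j * tnth v1 j) ^+ 2
     + mix_cst * D * d2 (st x v1) xc)%:E)%E.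
  under eq_integral => v2 _.
    rewrite /d2; under eq_bigr => i _.
      rewrite (_ : _ - _ = (a i + \sum_j S i j * tnth v1 j + e v1 i)
        + \sum_j B v1 i j * tnth v2 j).
      over.
      rewrite !tnth_euler_step /a /S /e /B (deltaS l).
      rewrite (_ : \sum_j sigma xc i j * tnth (addv v1 v2) j =
        \sum_j sigma xc i j * tnth v1 j + \sum_j sigma xc i j * tnth v2 j); last first.
        by rewrite -big_split; apply: eq_bigr => j _ /=; rewrite tnth_mktuple mulrDr.
      rewrite (_ : \sum_j (sigma x i j - sigma xc i j) * tnth v1 j =
        \sum_j sigma x i j * tnth v1 j - \sum_j sigma xc i j * tnth v1 j); last first.
        by rewrite -sumrB; apply: eq_bigr => j _; rewrite mulrBl.
      rewrite (_ : \sum_j (sigma _ i j - sigma xc i j) * tnth v2 j =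
        \sum_j sigma (st x v1) i j * tnth v2 j - \sum_j sigma xc i j * tnth v2 j); last first.
        by rewrite -sumrB; apply: eq_bigr => j _; rewrite mulrBl.
      by ring.
    over.
  apply: (le_trans (affine_sqr _ _)); rewrite lee_fin.
  rewrite mulr_sumr /mix_cst.
  have -> : dx%:R * (K * (2 + g * dx%:R)) * D * d2 (st x v1) xc =
      \sum_(i < dx) (2 * D * (K * d2 (st x v1) xc)
        + g * (D * (dx%:R * (K * d2 (st x v1) xc)))).
    by rewrite sumr_const card_ord -[RHS]mulr_natl; ring.
  rewrite -big_split; apply: ler_sum => i _ /=; rewrite addrA; apply: lerD; last first.
    apply: ler_wpM2l; first exact: gauss_cst_ge0.
    apply: ler_wpM2l; first exact: ltW.
    rewrite [leRHS]mulr_natl -[X in _ *+ X]card_ord -sumr_const.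
    by apply: ler_sum => j _; exact: lip_s.
  set p := a i + _.
  have : e v1 i ^+ 2 <= D ^+ 2 * (K * d2 (st x v1) xc).
    by rewrite exprMn; apply: ler_wpM2l; [exact: sqr_ge0|exact: lip_b].
  set q := e v1 i; set t := K * _ => hq.
  have t0 : 0 <= t by rewrite mulr_ge0// d2_ge0.
  (* Young's inequality with weight [D]: since [q ^+ 2] is of order [D ^+ 2], the cross term costs
     only [D * p ^+ 2 + D * t]. *)
  have h1 : 0 <= (D * p - q) ^+ 2 by exact: sqr_ge0.
  have h2 : 2 * D * (p * q) <= D ^+ 2 * p ^+ 2 + q ^+ 2 by lra.
  have h3 : 2 * D * (p * q) <= D * (D * p ^+ 2 + D * t) by lra.
  have h4 : 2 * (p * q) <= D * p ^+ 2 + D * t.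
    by rewrite -(ler_pM2l D0); lra.
  have h5 : q ^+ 2 <= D * t.
    apply: (le_trans hq); rewrite expr2 -mulrA ler_pM2l//.
    by rewrite ler_piMl.
  by lra.
have nA : nnm (fun v1 : vec => (\sum_i (a i + \sum_j S i j * tnth v1 j) ^+ 2)%:E).
  by under eq_fun do rewrite -sumEFin; apply: nnm_sum => i; exact: nnm_lin_sqr.
have nB : nnm (fun v1 : vec => (d2 (st x v1) xc)%:E).
  by apply: nnm_d2 => //; exact: measurable_euler_step.
have c0 : 0 <= mix_cst * D by rewrite mulr_ge0 ?mix_cst_ge0// ltW.
apply: (@le_trans _ _ (\int[gv]_v1 (
    (1 + D)%:E * (\sum_i (a i + \sum_j S i j * tnth v1 j) ^+ 2)%:E +
    (mix_cst * D)%:E * (d2 (st x v1) xc)%:E))%E).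
  apply: int_le.
  - apply: (nnm_int gv (f := fun p => (d2 (st (st x p.1) p.2) (stc xc (addv p.1 p.2)))%:E)).
    apply: nnm_d2.
      by apply: measurable_euler_step => //; exact: measurable_euler_step.
    by apply: measurable_euler_step => //; exact: measurable_addv.
  - apply: nnm_add; apply: nnm_mul => //; apply: nnm_cst; rewrite lee_fin//.
    by rewrite addr_ge0// ltW.
  - by move=> v1; have := inner v1; rewrite !EFinD !EFinM.
rewrite int_add; last 2 first.
- by apply: nnm_mul => //; apply: nnm_cst; rewrite lee_fin addr_ge0// ltW.
- by apply: nnm_mul => //; apply: nnm_cst; rewrite lee_fin.
rewrite int_scale//; last by rewrite addr_ge0// ltW.
rewrite int_scale//.
have hA : \sum_i (a i ^+ 2 + g * (D * \sum_j S i j ^+ 2)) <=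
    (1 + D) * d2 x xc + mix_cst * D * d2 x xc.
  rewrite /mix_cst.
  have -> : dx%:R * (K * (2 + g * dx%:R)) * D * d2 x xc =
      \sum_(i < dx) (2 * D * (K * d2 x xc) + g * (D * (dx%:R * (K * d2 x xc)))).
    by rewrite sumr_const card_ord -[RHS]mulr_natl; ring.
  rewrite [X in X + _]mulr_sumr -big_split; apply: ler_sum => i _ /=.
  rewrite addrA; apply: lerD; last first.
    apply: ler_wpM2l; first exact: gauss_cst_ge0.
    apply: ler_wpM2l; first exact: ltW.
    rewrite [leRHS]mulr_natl -[X in _ *+ X]card_ord -sumr_const.
    by apply: ler_sum => j _; exact: lip_s.
  rewrite /a; set p := _ - _; set q := _ - _.
  have hq : q ^+ 2 <= K * d2 x xc by exact: lip_b.
  have : 0 <= (p - q) ^+ 2 by exact: sqr_ge0.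
  set t := K * _ in hq *.
  have t0 : 0 <= t by rewrite mulr_ge0// d2_ge0.
  have h1 : D * (2 * (p * q)) <= D * (p ^+ 2 + q ^+ 2) => [|h0].
    by rewrite ler_pM2l//; have := sqr_ge0 (p - q); nra.
  have h2 : D * q ^+ 2 <= D * t by rewrite ler_pM2l.
  have h3 : D ^+ 2 * q ^+ 2 <= D * t.
    rewrite expr2 -mulrA ler_pM2l//; apply: le_trans hq; rewrite ler_piMl ?sqr_ge0//.
  by lra.
apply: (@le_trans _ _ ((1 + D)%:E * ((1 + D) * d2 x xc + mix_cst * D * d2 x xc)%:E +
    (mix_cst * D)%:E * (2 * d2 x xc + 2 * step_cst * D)%:E)%E).
  apply: leeD; apply: lee_wpmul2l; rewrite ?lee_fin//.
  - by rewrite addr_ge0// ltW.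
  - apply: (le_trans (affine_sqr _ _)); by rewrite lee_fin.
  - exact: step_distance.
rewrite -!EFinM -EFinD lee_fin.
have dd := d2_ge0 x xc; set X := d2 x xc in dd *.
have m0 := mix_cst_ge0.
have DD : D * D <= D by rewrite ler_piMr// ltW.
have h1 : D * D * X <= D * X by rewrite ler_wpM2r.
have h2 : mix_cst * (D * D * X) <= mix_cst * (D * X) by rewrite ler_wpM2l.
by lra.
Qed.

End euler.
Definition euler_regular (R : realType) (dx : nat) (b : dx.-tuple R -> dx.-tuple R)
    (sigma : dx.-tuple R -> 'M[R]_dx) (K : R) : Prop :=
  [/\ 0 <= K,
      forall x y i, (tnth (b x) i - tnth (b y) i) ^+ 2 <= K * d2 x y,
      forall x y i j, (sigma x i j - sigma y i j) ^+ 2 <= K * d2 x y,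
      forall x i, tnth (b x) i ^+ 2 <= K &
      forall x i j, sigma x i j ^+ 2 <= K] /\
  (forall i, measurable_fun setT (fun x => tnth (b x) i)) /\
  (forall i j, measurable_fun setT (fun x => sigma x i j)).

Section coupled_paths.
Context {R : realType} (dx : nat) (b : dx.-tuple R -> dx.-tuple R)
  (sigma : dx.-tuple R -> 'M[R]_dx) (K : R).
Local Notation vec := (dx.-tuple R).
Hypothesis reg : euler_regular b sigma K.
Variable l : nat.
Local Notation D := (delta R l.+1).
Local Notation st := (euler_step b sigma l.+1).
Local Notation stc := (euler_step b sigma l).
Local Notation gv := (gvec dx (Num.sqrt D)).
Local Notation C := (coupling_rate dx K).

Let K0 : 0 <= K. Proof. by case: reg => -[]. Qed.
Let D0 : 0 < D. Proof. exact: delta_gt0. Qed.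
Let C0 : 0 <= C. Proof. exact: coupling_rate_ge0. Qed.
Let DC0 : 0 <= C * D. Proof. by rewrite mulr_ge0// ltW. Qed.

Let mst k d (T : measurableType d) (f g : T -> vec) :
  measurable_fun setT f -> measurable_fun setT g ->
  measurable_fun setT (fun t => euler_step b sigma k (f t) (g t)).
Proof. by case: reg => _ [mb ms]; exact: measurable_euler_step. Qed.

(* Squared distances at the fine times, each coarse point being compared with the
   two fine points of its coarse step, plus the final squared distance; [v] is the
   list of the fine increments. *)
Fixpoint path_cost (v : seq vec) x xc : R :=
  match v with
  | v1 :: v2 :: v' => D * (d2 x xc + d2 (st x v1) xc) +
      path_cost v' (st (st x v1) v2) (stc xc (addv v1 v2))
  | _ => d2 x xc
  end.

Lemma measurable_path_cost n d (T : measurableType d) (V : T -> n.*2.-tuple vec)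
    (X Xc : T -> vec) :
  measurable_fun setT V -> measurable_fun setT X -> measurable_fun setT Xc ->
  measurable_fun setT (fun t => path_cost (V t) (X t) (Xc t)).
Proof.
elim: n T V X Xc => [|n IH] T V X Xc mV mX mXc.
  under eq_fun do rewrite (tuple0 (V _)) /=; exact: measurable_d2.
pose V1 t := tnth (V t) ord0.
pose W t : n.*2.+1.-tuple vec := [tuple of behead (V t)].
pose V2 t := tnth (W t) ord0.
pose V' t : n.*2.-tuple vec := [tuple of behead (W t)].
have mV1 : measurable_fun setT V1 by exact: (measurableT_comp (measurable_tnth _) mV).
have mW : measurable_fun setT W by exact: (measurableT_comp (@measurable_behead _ _ _) mV).
have mV2 : measurable_fun setT V2 by exact: (measurableT_comp (measurable_tnth _) mW).
have mV' : measurable_fun setT V' by exact: (measurableT_comp (@measurable_behead _ _ _) mW).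
have -> : (fun t => path_cost (V t) (X t) (Xc t)) = fun t =>
    D * (d2 (X t) (Xc t) + d2 (st (X t) (V1 t)) (Xc t)) +
    path_cost (V' t) (st (st (X t) (V1 t)) (V2 t)) (stc (Xc t) (addv (V1 t) (V2 t))).
  apply/funext => t.
  suff -> : tval (V t) = V1 t :: V2 t :: tval (V' t) by [].
  rewrite [in LHS](tuple_eta (V t)) /=; congr (_ :: _).
  exact: (congr1 (@tval _ _) (tuple_eta (W t))).
have mS := mst l.+1 mX mV1.
apply: measurable_funD.
  apply: measurable_funM => //; apply: measurable_funD; exact: measurable_d2.
apply: IH => //; first exact: mst.
by apply: mst => //; exact: measurable_addv.
Qed.

Lemma path_cost_ge0 n (v : n.*2.-tuple vec) x xc : 0 <= path_cost v x xc.
Proof.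
case: v => s /= /eqP; elim: n s x xc => [|n IH] s x xc.
  by move/size0nil => ->; exact: d2_ge0.
case: s => [//|v1 [//|v2 s]] [ss] /=.
by rewrite addr_ge0 ?IH// mulr_ge0 ?addr_ge0 ?d2_ge0// ltW.
Qed.

Lemma nnm_path_cost n d (T : measurableType d) (V : T -> n.*2.-tuple vec)
    (X Xc : T -> vec) :
  measurable_fun setT V -> measurable_fun setT X -> measurable_fun setT Xc ->
  nnm (fun t => (path_cost (V t) (X t) (Xc t))%:E).
Proof.
move=> mV mX mXc; apply: nnm_EFin => [|t]; last exact: path_cost_ge0.
exact: measurable_path_cost.
Qed.

(** Discrete Gronwall: a coarse step multiplies the squared distance by at most [1 + C * D] and adds
    at most [C * D ^+ 2], with [C] large enough to absorb the running cost as well. *)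
Lemma int_path_cost n x xc :
  (\int[iid gv n.*2]_v (path_cost v x xc)%:E <=
   ((1 + C * D) ^+ n * (d2 x xc + n%:R * (C * D ^+ 2)))%:E)%E.
Proof.
elim: n x xc => [|n IH] x xc.
  rewrite iid0; last exact: nnm_path_cost.
  by rewrite expr0 mul1r mul0r addr0.
pose E n := (1 + C * D) ^+ n.
have E0 k : 0 <= E k by rewrite exprn_ge0// addr_ge0.
have E1 k : 1 <= E k by rewrite exprn_ege1// lerDl.
pose cn := n%:R * (C * D ^+ 2).
have cn0 : 0 <= cn by rewrite !mulr_ge0// ltW.
pose F v1 v2 := D * (d2 x xc + d2 (st x v1) xc) +
  E n * (d2 (st (st x v1) v2) (stc xc (addv v1 v2)) + cn).
have np : nnm (fun v : n.*2.+2.-tuple vec => (path_cost v x xc)%:E).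
  exact: (@nnm_path_cost n.+1).
have m1 : measurable_fun setT (fun p : vec * vec => st x p.1) by exact: mst.
have m2 : measurable_fun setT (fun p : vec * vec => st (st x p.1) p.2) by exact: mst.
have m3 : measurable_fun setT (fun p : vec * vec => stc xc (addv p.1 p.2)).
  by apply: mst => //; exact: measurable_addv.
have nF : nnm (fun p : vec * vec => (F p.1 p.2)%:E).
  apply: nnm_EFin => [|p]; last first.
    by rewrite addr_ge0// mulr_ge0 ?addr_ge0 ?d2_ge0// ltW.
  apply: measurable_funD.
    by apply: measurable_funM => //; apply: measurable_funD => //; exact: measurable_d2.
  by apply: measurable_funM => //; apply: measurable_funD => //; exact: measurable_d2.
rewrite iidS//.
apply: (@le_trans _ _ (\int[gv]_v1 \int[gv]_v2 (F v1 v2)%:E)%E).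
  have n1 := nnm_iidS gv np.
  apply: int_le => //; first exact: (nnm_int gv nF).
  move=> v1; rewrite iidS; last exact: (nnm_consr v1 np).
  apply: int_le; first exact: (nnm_iidS gv (nnm_consr v1 np)).
    exact: (nnm_pair2 v1 nF).
  move=> v2.
  apply: (@le_trans _ _ ((D * (d2 x xc + d2 (st x v1) xc))%:E +
      \int[iid gv n.*2]_v (path_cost v (st (st x v1) v2) (stc xc (addv v1 v2)))%:E)%E).
    rewrite le_eqVlt; apply/orP; left; apply/eqP.
    under eq_integral => v _ do rewrite /= EFinD.
    rewrite int_add ?int_cst//; last exact: nnm_path_cost.
    by apply: nnm_cst; rewrite lee_fin mulr_ge0 ?addr_ge0 ?d2_ge0// ltW.
  by rewrite /F EFinD; apply: leeD2l; exact: IH.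
have nd1 : nnm (fun v1 => (d2 (st x v1) xc)%:E).
  by apply: nnm_d2 => //; exact: mst.
have nd2 : nnm (fun p : vec * vec => (d2 (st (st x p.1) p.2) (stc xc (addv p.1 p.2)))%:E).
  exact: nnm_d2.
pose A := D * d2 x xc + E n * cn.
have A0 : 0 <= A by rewrite addr_ge0// mulr_ge0// ?d2_ge0// ltW.
have -> : (\int[gv]_v1 \int[gv]_v2 (F v1 v2)%:E = A%:E +
    (D%:E * \int[gv]_v1 (d2 (st x v1) xc)%:E +
     (E n)%:E * \int[gv]_v1 \int[gv]_v2 (d2 (st (st x v1) v2) (stc xc (addv v1 v2)))%:E))%E.
  transitivity (\int[gv]_v1 (A%:E + (D%:E * (d2 (st x v1) xc)%:E +
     (E n)%:E * \int[gv]_v2 (d2 (st (st x v1) v2) (stc xc (addv v1 v2)))%:E)))%E.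
    apply: eq_integral => v1 _.
    rewrite -int_scale; [|exact: (nnm_pair2 v1 nd2)|exact: E0].
    rewrite addeA -EFinM -EFinD.
    transitivity (\int[gv]_v2 ((A + D * d2 (st x v1) xc)%:E +
       (E n)%:E * (d2 (st (st x v1) v2) (stc xc (addv v1 v2)))%:E))%E.
      apply: eq_integral => v2 _; rewrite -EFinM -EFinD; congr EFin; rewrite /F /A; ring.
    rewrite int_add ?int_cst//.
      by apply: nnm_cst; rewrite lee_fin addr_ge0// mulr_ge0 ?d2_ge0// ltW.
    by apply: nnm_mul; [apply: nnm_cst; rewrite lee_fin|exact: (nnm_pair2 v1 nd2)].
  have n2 : nnm (fun v1 => (D%:E * (d2 (st x v1) xc)%:E)%E).
    by apply: nnm_mul => //; apply: nnm_cst; rewrite lee_fin ltW.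
  have n3 := nnm_int gv nd2.
  have n4 : nnm (fun v1 => ((E n)%:E *
      \int[gv]_v2 (d2 (st (st x v1) v2) (stc xc (addv v1 v2)))%:E)%E).
    by apply: nnm_mul => //; apply: nnm_cst; rewrite lee_fin.
  rewrite int_add; [|by apply: nnm_cst; rewrite lee_fin|exact: nnm_add].
  rewrite int_cst int_add//; congr (_ + (_ + _))%E; rewrite int_scale//.
  exact: ltW.
have [[_ Lb Ls Bb Bs] [mb ms]] := reg.
have h1 := step_distance Bb Bs mb ms l x xc.
have h2 := two_steps K0 Lb Ls Bb Bs mb ms l x xc.
apply: (@le_trans _ _ (A%:E + (D%:E * (2 * d2 x xc + 2 * step_cst dx K * D)%:E +
  (E n)%:E * ((1 + (3 + 4 * mix_cst dx K) * D) * d2 x xc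
    + 2 * mix_cst dx K * step_cst dx K * D ^+ 2)%:E))%E).
  apply: leeD2l; apply: leeD; apply: lee_wpmul2l => //; rewrite lee_fin//; exact: ltW.
rewrite -!EFinM -!EFinD lee_fin /A (exprS (1 + C * D) n) -/(E n).
have X0 := d2_ge0 x xc; set X := d2 x xc in X0 *.
have s0 := step_cst_ge0 dx K0; have x0 := mix_cst_ge0 dx K0.
set c1 := mix_cst dx K in x0 *; set c2 := step_cst dx K in s0 *.
have hC : C = 6 + 4 * c1 + 2 * c1 * c2 + 2 * c2 by [].
(* The running cost is inflated by [E n >= 1], so that it joins the terms already multiplied by
   [E n]. *)
have e1 : D * X + (D * (2 * X + 2 * c2 * D)) <= E n * (D * (3 * X + 2 * c2 * D)).
  rewrite -[leLHS]mul1r; have -> : D * X + D * (2 * X + 2 * c2 * D) = D * (3 * X + 2 * c2 * D) by ring.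
  apply: ler_wpM2r => //; apply: mulr_ge0; first exact: ltW.
  apply: addr_ge0; first exact: mulr_ge0.
  by apply: mulr_ge0 (ltW D0); exact: mulr_ge0.
have -> : D * X + E n * cn + (D * (2 * X + 2 * c2 * D) +
    E n * ((1 + (3 + 4 * c1) * D) * X + 2 * c1 * c2 * D ^+ 2)) =
    (D * X + D * (2 * X + 2 * c2 * D)) +
    E n * (cn + ((1 + (3 + 4 * c1) * D) * X + 2 * c1 * c2 * D ^+ 2)) by ring.
apply: (le_trans (lerD e1 (lexx _))).
rewrite -mulrDr -[leRHS]mulrA [leRHS]mulrCA; apply: ler_wpM2l => //.
have -> : n.+1%:R * (C * D ^+ 2) = cn + C * D ^+ 2 by rewrite /cn -natr1; ring.
have h3 : 0 <= C * D * (cn + C * D ^+ 2).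
  by apply: mulr_ge0 => //; apply: addr_ge0 => //; apply: mulr_ge0 => //; exact: sqr_ge0.
have h4 : 0 <= (c1 * c2) * D * X by do 2!(apply: mulr_ge0 => //); [exact: mulr_ge0|exact: ltW].
have h5 : 0 <= c2 * D * X by do 2!(apply: mulr_ge0 => //); exact: ltW.
have h6 : 0 <= c1 * D ^+ 2 by apply: mulr_ge0 => //; exact: sqr_ge0.
have h7 : 0 <= D ^+ 2 by exact: sqr_ge0.
have -> : (1 + C * D) * (X + (cn + C * D ^+ 2)) =
  X + C * D * X + cn + C * D ^+ 2 + C * D * (cn + C * D ^+ 2) by ring.
rewrite hC in h3 *; lra.
Qed.

Definition coupling_cst : R := expR C * (1 + C).

Lemma coupling_cst_ge0 : 0 <= coupling_cst.
Proof. by rewrite mulr_ge0 ?expR_ge0// addr_ge0. Qed.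

Lemma int_path_cost_level x xc :
  (\int[iid gv (2 ^ l.+1)]_v (path_cost v x xc)%:E <=
   (coupling_cst * (d2 x xc + D))%:E)%E.
Proof.
have e : (2 ^ l).*2 = (2 ^ l.+1)%N by rewrite expnS mul2n.
rewrite -e; apply: (le_trans (int_path_cost _ _ _)); rewrite lee_fin.
(* There are [2 ^ l] coarse steps of length [2 * D] in the unit interval: the growth factor stays
   below [expR C] and the accumulated error is [C * D / 2]. *)
have nD : (2 ^ l)%:R * D = 2^-1.
  by rewrite natrX /delta exprS invfM mulrCA mulfV ?mulr1// expf_neq0.
have h1 : (1 + C * D) ^+ (2 ^ l) <= expR C.
  apply: (@le_trans _ _ (expR (C * D) ^+ (2 ^ l))).
    by apply: lerXn2r; rewrite ?nnegrE ?expR_ge0// ?addr_ge0// expR_ge1Dx.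
  by rewrite -expRM_natl ler_expR mulrCA nD ler_piMr// invf_le1// ler1n.
have X0 := d2_ge0 x xc.
rewrite /coupling_cst -mulrA; apply: ler_pM => //.
- by rewrite exprn_ge0// addr_ge0.
- by rewrite addr_ge0// !mulr_ge0// ltW.
have -> : (2 ^ l)%:R * (C * D ^+ 2) = C * D / 2.
  by rewrite expr2 mulrCA (mulrCA _ D) mulrA nD; field.
have h2 := mulr_ge0 C0 X0; have h3 := DC0; have h4 := ltW D0; lra.
Qed.

End coupled_paths.

(** * Maximal coupling and selection *)

Section bounded_means.
Context {R : realType} d (T : measurableType d) (mu : probability T R).

(** Signed integrands occur only in conditional means given the data, where they are bounded; [mean]
    is reserved for these. *)
Definition bmeas d' (S : measurableType d') (f : S -> R) : Prop :=
  measurable_fun setT f /\ bounded_real f.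

Definition mean (f : T -> R) : R := Rintegral mu setT f.

Lemma bmeas_integrable (f : T -> R) : bmeas f -> mu.-integrable setT (EFin \o f).
Proof.
move=> [mf [M fM]]; apply: measurable_bounded_integrable => //; first exact: fin_num_fun_lty.
exists M; split; first exact: num_real.
by move=> M' MM' x _ /=; apply: le_trans (ltW MM').
Qed.

Lemma meanE (f : T -> R) : bmeas f -> (\int[mu]_x (f x)%:E = (mean f)%:E)%E.
Proof.
by move=> /bmeas_integrable bf; rewrite /mean /Rintegral fineK// integrable_fin_num.
Qed.

Lemma bmeas_cst d' (S : measurableType d') (c : R) : bmeas (fun _ : S => c).
Proof. by split => //; exists `|c|. Qed.

Lemma bmeasD d' (S : measurableType d') (f g : S -> R) :
  bmeas f -> bmeas g -> bmeas (fun x => f x + g x).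
Proof.
move=> [mf [M fM]] [mg [M' gM]]; split; first exact: measurable_funD.
by exists (M + M') => x; apply: (le_trans (ler_normD _ _)); exact: lerD.
Qed.

Lemma bmeasM d' (S : measurableType d') (f g : S -> R) :
  bmeas f -> bmeas g -> bmeas (fun x => f x * g x).
Proof.
move=> [mf [M fM]] [mg [M' gM]]; split; first exact: measurable_funM.
by exists (M * M') => x; rewrite normrM; exact: ler_pM.
Qed.

Lemma bmeasZ d' (S : measurableType d') (c : R) (f : S -> R) :
  bmeas f -> bmeas (fun x => c * f x).
Proof. by move=> bf; apply: bmeasM => //; exact: bmeas_cst. Qed.

Lemma bmeas_sqr d' (S : measurableType d') (f : S -> R) :
  bmeas f -> bmeas (fun x => f x ^+ 2).
Proof. by move=> bf; exact: bmeasM. Qed.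

Lemma bmeas_comp d1 d2 (S1 : measurableType d1) (S2 : measurableType d2)
    (f : S2 -> R) (g : S1 -> S2) :
  bmeas f -> measurable_fun setT g -> bmeas (fun x => f (g x)).
Proof.
by move=> [mf [M fM]] mg; split; [exact: measurableT_comp|exists M => x; exact: fM].
Qed.

Lemma meanD (f g : T -> R) : bmeas f -> bmeas g ->
  mean (fun x => f x + g x) = mean f + mean g.
Proof. by move=> bf bg; rewrite /mean RintegralD//; exact: bmeas_integrable. Qed.

Lemma meanB (f g : T -> R) : bmeas f -> bmeas g ->
  mean (fun x => f x - g x) = mean f - mean g.
Proof. by move=> bf bg; rewrite /mean RintegralB//; exact: bmeas_integrable. Qed.

Lemma meanZ (c : R) (f : T -> R) : bmeas f -> mean (fun x => c * f x) = c * mean f.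
Proof. by move=> bf; rewrite /mean RintegralZl//; exact: bmeas_integrable. Qed.

Lemma mean_cst (c : R) : mean (fun=> c) = c.
Proof. by apply: EFin_inj; rewrite -meanE ?int_cst//; exact: bmeas_cst. Qed.

Lemma mean_ge0 (f : T -> R) : (forall x, 0 <= f x) -> 0 <= mean f.
Proof. by move=> f0; exact: Rintegral_ge0. Qed.

Lemma mean_shift_sqr (f : T -> R) (a : R) : bmeas f ->
  mean (fun x => (a + f x) ^+ 2) = a ^+ 2 + 2 * a * mean f + mean (fun x => f x ^+ 2).
Proof.
move=> bf; rewrite -[a ^+ 2 in RHS]mean_cst -meanZ// -!meanD.
- by congr mean; apply/funext => x; ring.
- by apply: bmeasD; [exact: bmeas_cst|exact: bmeasZ].
- exact: bmeas_sqr.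
- exact: bmeas_cst.
- exact: bmeasZ.
Qed.

Lemma mean_sqr_ge (f : T -> R) : bmeas f -> mean f ^+ 2 <= mean (fun x => f x ^+ 2).
Proof.
move=> bf; have := mean_ge0 (fun x => sqr_ge0 (- mean f + f x)).
by rewrite mean_shift_sqr//; nra.
Qed.

Lemma nnm_bmeas d' (S : measurableType d') (f : S -> R) :
  bmeas f -> (forall x, 0 <= f x) -> nnm (fun x => (f x)%:E).
Proof. by move=> [mf _] f0; exact: nnm_EFin. Qed.

End bounded_means.

Section iid_means.
Context {R : realType} d (T : measurableType d) (mu : probability T R).

Lemma measurable_sum_tnth n (f : T -> R) : measurable_fun setT f ->
  measurable_fun setT (fun u : n.-tuple T => \sum_(i < n) f (tnth u i)).
Proof.
move=> mf; apply: measurable_sum => i.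
by apply: (measurableT_comp mf); exact: measurable_tnth.
Qed.

Lemma iid_sum_sqr n (f : T -> R) (a : R) : bmeas f ->
  (\int[iid mu n]_u ((a + \sum_(i < n) f (tnth u i)) ^+ 2)%:E =
   ((a + n%:R * mean mu f) ^+ 2
    + n%:R * (mean mu (fun x => f x ^+ 2) - mean mu f ^+ 2))%:E)%E.
Proof.
move=> bf.
have nn m c : nnm (fun u : m.-tuple T => ((c + \sum_(i < m) f (tnth u i)) ^+ 2)%:E).
  apply: nnm_EFin => [|u]; last exact: sqr_ge0.
  apply: measurable_funX; apply: measurable_funD => //.
  by case: bf => mf _; exact: measurable_sum_tnth.
elim: n a => [|n IH] a.
  rewrite iid0; last exact: nn.
  by rewrite big_ord0 !mul0r !addr0.
rewrite iidS; last exact: nn.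
transitivity (\int[mu]_v (((a + n%:R * mean mu f) + f v) ^+ 2 +
   n%:R * (mean mu (fun x => f x ^+ 2) - mean mu f ^+ 2))%:E)%E.
  apply: eq_integral => v _; rewrite (_ : a + _ + f v = (a + f v) + n%:R * mean mu f); last by ring.
  rewrite -IH; apply: eq_integral => u _; rewrite big_ord_recl tnth0 addrA.
  by congr ((_ + _) ^+ 2)%:E; apply: eq_bigr => i _; rewrite tnthS.
have b1 : bmeas (fun v => (a + n%:R * mean mu f + f v) ^+ 2).
  by apply: bmeas_sqr; apply: bmeasD => //; exact: bmeas_cst.
rewrite meanE; last by apply: bmeasD => //; exact: bmeas_cst.
rewrite meanD//; last exact: bmeas_cst.
by rewrite mean_cst mean_shift_sqr//; congr EFin; rewrite -natr1; ring.
Qed.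

(** Squared bias plus variance; the variance is replaced by the second moment, which is all that is
    controlled later. *)
Lemma iid_mean_sqr n (f : T -> R) : (0 < n)%N -> bmeas f ->
  (\int[iid mu n]_u ((n%:R^-1 * \sum_(i < n) f (tnth u i)) ^+ 2)%:E <=
   (n%:R^-1 * mean mu (fun x => f x ^+ 2) + mean mu f ^+ 2)%:E)%E.
Proof.
move=> n0 bf; have nR : 0 < n%:R :> R by rewrite ltr0n.
have nn : nnm (fun u : n.-tuple T => ((0 + \sum_(i < n) f (tnth u i)) ^+ 2)%:E).
  apply: nnm_EFin => [|u]; last exact: sqr_ge0.
  apply: measurable_funX; apply: measurable_funD => //.
  by case: bf => mf _; exact: measurable_sum_tnth.
have -> : (\int[iid mu n]_u ((n%:R^-1 * \sum_(i < n) f (tnth u i)) ^+ 2)%:E =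
    \int[iid mu n]_u ((n%:R^-1 ^+ 2)%:E * ((0 + \sum_(i < n) f (tnth u i)) ^+ 2)%:E))%E.
  by apply: eq_integral => u _; rewrite -EFinM add0r exprMn.
rewrite int_scale ?sqr_ge0// iid_sum_sqr// -EFinM lee_fin add0r.
set m := mean mu f; set s := mean mu _.
have -> : n%:R^-1 ^+ 2 * ((n%:R * m) ^+ 2 + n%:R * (s - m ^+ 2)) =
    m ^+ 2 + n%:R^-1 * s - n%:R^-1 * m ^+ 2 by field; rewrite gt_eqF.
have : 0 <= n%:R^-1 * m ^+ 2 by rewrite mulr_ge0 ?sqr_ge0// invr_ge0 ltW.
lra.
Qed.

Lemma iid_coord n (i : 'I_n) (f : T -> \bar R) : nnm f ->
  (\int[iid mu n]_u f (tnth u i) = \int[mu]_x f x)%E.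
Proof.
move=> nf; pose g (j : 'I_n) (x : T) := if j == i then f x else 1%E.
have ng j : nnm (g j).
  by rewrite /g; case: eqP => _ //; exact: nnm_cst.
transitivity (\int[iid mu n]_u \big[*%E/1%E]_(j < n) g j (tnth u j))%E.
  apply: eq_integral => u _; rewrite (bigD1 i)//= /g eqxx big1 ?mule1//.
  by move=> j /negbTE ->.
rewrite iid_prod// (bigD1 i)//= /g; under eq_integral do rewrite eqxx.
rewrite big1 ?mule1// => j /negbTE ji.
by under eq_integral do rewrite ji; exact: int_cst.
Qed.

Lemma iid_mean n (f : T -> R) : (0 < n)%N -> measurable_fun setT f ->
  (forall x, 0 <= f x) ->
  (\int[iid mu n]_u (n%:R^-1 * \sum_(i < n) f (tnth u i))%:E = \int[mu]_x (f x)%:E)%E.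
Proof.
move=> n0 mf f0; have nR : 0 < n%:R :> R by rewrite ltr0n.
have nf : nnm (fun x => (f x)%:E) by exact: nnm_EFin.
have nfi (i : 'I_n) : nnm (fun u : n.-tuple T => (f (tnth u i))%:E).
  by apply: (nnm_comp nf); exact: measurable_tnth.
under eq_integral => u _ do rewrite EFinM -sumEFin.
rewrite int_scale ?invr_ge0 ?ltW//; last exact: nnm_sum.
rewrite int_sum//.
under eq_bigr => i _ do rewrite (iid_coord i nf).
rewrite big_const_ord; set I := (\int[mu]_x _)%E.
have I0 : (0 <= I)%E by apply: integral_ge0 => x _; rewrite lee_fin.
have -> : iter n (fun y => (I + y)%E) 0%E = (n%:R%:E * I)%E.
  elim: (n) => [|m IH] /=; first by rewrite mul0e.
  by rewrite IH -natr1 EFinD ge0_muleDl ?lee_fin// mul1e addeC.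
by rewrite muleA -EFinM mulVf ?mul1e// gt_eqF.
Qed.

End iid_means.

Section measurable_inverse.
Context {R : realType}.

(** Away from zero the inverse is [expR (- ln (f x))], and the convention [0^-1 = 0] settles the
    zero set. *)
Lemma measurable_inv_ge0 d (T : measurableType d) (f : T -> R) :
  measurable_fun setT f -> (forall x, 0 <= f x) ->
  measurable_fun setT (fun x => (f x)^-1).
Proof.
move=> mf f0.
have -> : (fun x => (f x)^-1) = (fun x => if f x == 0 then 0 else expR (- ln (f x))).
  apply/funext => x; case: eqP => [->|/eqP fx]; first by rewrite invr0.
  by rewrite expRN lnK// posrE lt_neqAle eq_sym fx f0.
apply: measurable_fun_ifT => //.
  exact: (measurable_fun_eqr mf).
apply: measurable_expR_comp; apply: measurable_funN.
exact: (measurableT_comp (@measurable_ln R)).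
Qed.

End measurable_inverse.
Section maximal_coupling_theory.
Context {R : realType} (N : nat) (r1 r2 : 'I_N -> R).
Hypotheses (r1_ge0 : forall i, 0 <= r1 i) (r2_ge0 : forall i, 0 <= r2 i).
Hypotheses (r1_sum : \sum_i r1 i = 1) (r2_sum : \sum_i r2 i = 1).

Definition overlap : R := \sum_i Num.min (r1 i) (r2 i).

Let m i := Num.min (r1 i) (r2 i).
Let m_ge0 i : 0 <= m i. Proof. by rewrite le_min r1_ge0 r2_ge0. Qed.
Let m1 i : 0 <= r1 i - m i. Proof. by rewrite subr_ge0 ge_min lexx. Qed.
Let m2 i : 0 <= r2 i - m i. Proof. by rewrite subr_ge0 ge_min lexx orbT. Qed.

Let sum1 : \sum_i (r1 i - m i) = 1 - overlap. Proof. by rewrite sumrB r1_sum. Qed.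
Let sum2 : \sum_i (r2 i - m i) = 1 - overlap. Proof. by rewrite sumrB r2_sum. Qed.

Lemma overlap_ge0 : 0 <= overlap. Proof. by apply: sumr_ge0 => i _; exact: m_ge0. Qed.

Lemma overlap_le1 : overlap <= 1.
Proof. by rewrite -subr_ge0 -sum1; apply: sumr_ge0 => i _; exact: m1. Qed.

Let mc := maximal_coupling r1 r2.

Let mcE i j : mc i j = overlap * (if i == j then m i / overlap else 0) +
  (1 - overlap) * ((r1 i - m i) / (1 - overlap) * ((r2 j - m j) / (1 - overlap))).
Proof. by []. Qed.

(** In the degenerate cases [overlap = 0] and [overlap = 1] the numerators vanish along with the
    denominators, so the formula keeps the right marginals. *)
Let mulKd (x s : R) : (s = 0 -> x = 0) -> s * (x / s) = x.
Proof.
have [-> /(_ erefl) ->|s0 _] := eqVneq s 0; first by rewrite mul0r.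
by rewrite mulrC divfK.
Qed.

Let m_eq0 i : overlap = 0 -> m i = 0.
Proof.
move=> ov0; apply/eqP; rewrite eq_le m_ge0 andbT -ov0 /overlap (bigD1 i)//= lerDl.
by apply: sumr_ge0 => j _; exact: m_ge0.
Qed.

Let d_eq0 (r : 'I_N -> R) i : (forall i, 0 <= r i - m i) ->
  \sum_i (r i - m i) = 1 - overlap -> 1 - overlap = 0 -> r i - m i = 0.
Proof.
move=> r0 rs ov0; apply/eqP; rewrite eq_le r0 andbT -ov0 -rs (bigD1 i)//= lerDl.
by apply: sumr_ge0 => j _; exact: r0.
Qed.

Lemma maximal_coupling_ge0 i j : 0 <= mc i j.
Proof.
have ov0 := overlap_ge0; have ov1 := overlap_le1.
rewrite mcE addr_ge0// mulr_ge0//; last by rewrite mulr_ge0// divr_ge0// subr_ge0.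
- by case: ifP => // _; rewrite divr_ge0.
- by rewrite subr_ge0.
Qed.

Let diag_sum i (f : 'I_N -> R) : 
  \sum_j overlap * (if i == j then m i / overlap else 0) * f j = m i * f i.
Proof.
rewrite (bigD1 i)//= eqxx big1 ?addr0; last first.
  by move=> j /negbTE; rewrite eq_sym => ->; rewrite mulr0 mul0r.
by congr (_ * _); apply: mulKd; exact: m_eq0.
Qed.

Lemma maximal_coupling_fst i : \sum_j mc i j = r1 i.
Proof.
under eq_bigr => j _ do rewrite mcE -[X in X + _]mulr1.
rewrite big_split /= (diag_sum i (fun=> 1)) mulr1.
rewrite -mulr_sumr -mulr_sumr -mulr_suml sum2.
have [ov1|ov1] := eqVneq (1 - overlap) 0.
  by rewrite ov1 mul0r addr0; have := d_eq0 i m1 sum1 ov1; move/eqP; rewrite subr_eq0 => /eqP.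
by rewrite divff// mulr1 mulrC divfK// addrC subrK.
Qed.

Lemma maximal_coupling_snd j : \sum_i mc i j = r2 j.
Proof.
under eq_bigr => i _ do rewrite mcE -[X in X + _]mulr1.
rewrite big_split /=.
have -> : \sum_i overlap * (if i == j then m i / overlap else 0) * 1 = m j.
  rewrite -[RHS]mulr1 -[RHS](diag_sum j (fun=> 1)); apply: eq_bigr => i _.
  by rewrite eq_sym; case: eqP => // ->.
rewrite -mulr_sumr -mulr_suml -mulr_suml sum1.
have [ov1|ov1] := eqVneq (1 - overlap) 0.
  by rewrite ov1 mul0r addr0; have := d_eq0 j m2 sum2 ov1; move/eqP; rewrite subr_eq0 => /eqP.
by rewrite divff// mul1r mulrC divfK// addrC subrK.
Qed.

Lemma maximal_coupling_sum : \sum_i \sum_j mc i j = 1.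
Proof. by under eq_bigr do rewrite maximal_coupling_fst. Qed.

(** The common part of the coupling sits on the diagonal; the residual part has mass [1 - overlap],
    where [g] is bounded crudely by [M]. *)
Lemma maximal_coupling_le (g : 'I_N -> 'I_N -> R) (M : R) :
  (forall i j, 0 <= g i j <= M) ->
  \sum_i \sum_j mc i j * g i j <= \sum_i m i * g i i + M * (1 - overlap).
Proof.
move=> gM; have ov1 := overlap_le1.
under eq_bigr => i _.
  under eq_bigr => j _ do rewrite mcE mulrDl.
  rewrite big_split /= diag_sum; over.
rewrite big_split /= lerD2l.
apply: (@le_trans _ _ (\sum_i \sum_j
  (1 - overlap) * ((r1 i - m i) / (1 - overlap) * ((r2 j - m j) / (1 - overlap))) * M)).
  apply: ler_sum => i _; apply: ler_sum => j _; apply: ler_wpM2l.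
    by rewrite !mulr_ge0// ?invr_ge0 ?subr_ge0// -subr_ge0.
  by case/andP: (gM i j).
under eq_bigr do rewrite -mulr_suml -mulr_sumr -mulr_sumr -mulr_suml sum2.
rewrite -mulr_suml -mulr_sumr -mulr_suml -mulr_suml sum1 mulrC.
have [->|ov0] := eqVneq (1 - overlap) 0; first by rewrite !mul0r.
by rewrite divff// !mulr1.
Qed.

End maximal_coupling_theory.

Section selection_weights.
Context {R : realType} (N : nat) (G Gc : 'I_N -> R).
Hypothesis N0 : (0 < N)%N.
Hypotheses (G0 : forall i, 0 < G i) (Gc0 : forall i, 0 < Gc i).

Local Notation S := (\sum_i G i).
Local Notation Sc := (\sum_i Gc i).

Lemma sum_gt0 (f : 'I_N -> R) : (forall i, 0 < f i) -> 0 < \sum_i f i.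
Proof.
move=> f0; rewrite (bigD1 (Ordinal N0))//= ltr_wpDr//.
by apply: sumr_ge0 => i _; exact: ltW.
Qed.

Lemma normalized_sum (f : 'I_N -> R) : (forall i, 0 < f i) ->
  \sum_i (f i / \sum_j f j) = 1.
Proof. by move=> f0; rewrite -mulr_suml divff// gt_eqF// sum_gt0. Qed.

Local Notation r1 := (fun i => G i / S).
Local Notation r2 := (fun i => Gc i / Sc).

Lemma normalized_ge0 (f : 'I_N -> R) i : (forall i, 0 < f i) ->
  0 <= f i / \sum_j f j.
Proof. by move=> f0; rewrite divr_ge0// ltW// sum_gt0. Qed.

(** Let [s] be the larger of the two sums. Dividing the other family by [s] as well only decreases
    its weights, so each term of [1 - overlap] is at most [|G i - Gc i| / s]: no lower bound on the
    potentials is required. *)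
Lemma overlap_gap (T : R) : T <= Num.max S Sc -> 0 < T ->
  (1 - overlap r1 r2) * T <= \sum_i `|G i - Gc i|.
Proof.
move=> TS T0; have S0 := sum_gt0 G0; have Sc0 := sum_gt0 Gc0.
have ov1 : 0 <= 1 - overlap r1 r2.
  by rewrite subr_ge0; apply: overlap_le1; exact: normalized_sum.
have key (f fc : 'I_N -> R) (s sc : R) : (forall i, 0 < fc i) -> 0 < s -> 0 < sc -> sc <= s ->
    \sum_i f i / s = 1 -> T <= s ->
    (1 - \sum_i Num.min (f i / s) (fc i / sc)) * T <= \sum_i `|f i - fc i|.
  move=> fc0 s0 sc0 scs fs Ts.
  apply: (@le_trans _ _ ((1 - \sum_i Num.min (f i / s) (fc i / sc)) * s)).
    apply: ler_wpM2l => //; rewrite subr_ge0 -fs; apply: ler_sum => i _.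
    by rewrite ge_min lexx.
  rewrite -fs -sumrB mulr_suml; apply: ler_sum => i _.
  rewrite mulrBl divfK ?gt_eqF// lerBlDr.
  have [_|_] := leP (f i / s) (fc i / sc).
    by rewrite divfK ?gt_eqF// lerDr.
  have h : fc i <= fc i / sc * s by rewrite mulrAC ler_pdivlMr// ler_pM2l.
  by apply: (le_trans _ (lerD (lexx _) h)); rewrite -lerBlDr ler_norm.
have [ss|ss] := leP Sc S.
  by apply: key => //; [exact: normalized_sum|move: TS; rewrite max_l].
under [leRHS]eq_bigr do rewrite distrC.
have -> : overlap r1 r2 = \sum_i Num.min (Gc i / Sc) (G i / S).
  by apply: eq_bigr => i _; rewrite minC.
by apply: key => //; [exact: ltW|exact: normalized_sum|move: TS; rewrite max_r// ltW].
Qed.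

Variables (le ls : 'I_N -> R) (g : 'I_N -> 'I_N -> R).
Hypotheses (ls0 : forall i, 0 < ls i) (le0 : forall i, 0 <= le i).
Hypotheses (g_bound : forall i j, 0 <= g i j <= 2) (g_diag : forall i, g i i = le i).

Definition avg (f : 'I_N -> R) : R := N%:R^-1 * \sum_i f i.

Let NR : 0 < N%:R :> R. Proof. by rewrite ltr0n. Qed.

Lemma avg_ge0 (f : 'I_N -> R) : (forall i, 0 <= f i) -> 0 <= avg f.
Proof. by move=> f0; rewrite mulr_ge0 ?invr_ge0//; apply: sumr_ge0. Qed.

(** [H] stands for [G] or [Gc]; in the application [le] and [ls] are root distances at the ends and
    starts of the paths, and [g] those between the selected parents. One factor [avg H] cancels the
    normalization of the weights and the other keeps the bound quadratic in the potentials. *)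
Let coupled_le (H : 'I_N -> R) : (forall i, 0 < H i) ->
  \sum_i H i <= Num.max S Sc ->
  (forall i, Num.min (r1 i) (r2 i) <= H i / \sum_j H j) ->
  avg H ^+ 2 * (\sum_i \sum_j maximal_coupling r1 r2 i j * g i j) <=
  avg (fun i => (avg le / 2 + le i / 2 + avg ls) * H i ^+ 2 + (G i - Gc i) ^+ 2 / ls i).
Proof.
move=> H0 HS mH; have SH := sum_gt0 H0; set T := \sum_i H i in HS mH SH *.
have r1p i : 0 <= r1 i by exact: normalized_ge0.
have r2p i : 0 <= r2 i by exact: normalized_ge0.
have h1 := maximal_coupling_le r1p r2p (normalized_sum G0) (normalized_sum Gc0) g_bound.
have h2 := overlap_gap HS SH.
have h3 : T * (\sum_i \sum_j maximal_coupling r1 r2 i j * g i j) <=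
    \sum_i H i * le i + 2 * \sum_i `|G i - Gc i|.
  apply: (le_trans (ler_wpM2l (ltW SH) h1)); rewrite mulrDr; apply: lerD.
    rewrite mulr_sumr; apply: ler_sum => i _; rewrite g_diag mulrA.
    apply: ler_wpM2r => //; apply: (le_trans (ler_wpM2l (ltW SH) (mH i))).
    by rewrite mulrC divfK// gt_eqF.
  by rewrite mulrCA ler_pM2l// mulrC.
have e : avg H ^+ 2 * (\sum_i \sum_j maximal_coupling r1 r2 i j * g i j) =
    N%:R^-1 * (N%:R^-1 * (T * (T * (\sum_i \sum_j maximal_coupling r1 r2 i j * g i j)))).
  by rewrite /avg -/T; ring.
rewrite e /avg ler_pM2l ?invr_gt0//.
apply: (@le_trans _ _ (N%:R^-1 * (T * (\sum_i H i * le i + 2 * \sum_i `|G i - Gc i|)))).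
  by rewrite ler_pM2l ?invr_gt0// ler_pM2l.
have -> : T * (\sum_i H i * le i + 2 * \sum_i `|G i - Gc i|) =
    \sum_i (H i * (\sum_a H a * le a) + H i * (2 * \sum_j `|G j - Gc j|)).
  by rewrite big_split /= -!mulr_suml mulrDr.
have h4 i : H i * \sum_a H a * le a <= \sum_a (H i ^+ 2 * le a / 2 + H a ^+ 2 * le a / 2).
  rewrite mulr_sumr; apply: ler_sum => a _.
  have := mulr_ge0 (sqr_ge0 (H i - H a)) (le0 a); nra.
(* Young's inequality with weight [ls j]: the first moment of the gap is traded for its square
   divided by the start distance, which has the right size in mean. *)
have h5 i : H i * (2 * \sum_j `|G j - Gc j|) <=
    \sum_j (H i ^+ 2 * ls j + (G j - Gc j) ^+ 2 / ls j).
  rewrite mulr_sumr mulr_sumr; apply: ler_sum => j _.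
  rewrite -[(G j - Gc j) ^+ 2]real_normK ?num_real//; set x := `|_|.
  have lj := ls0 j; have := divr_ge0 (sqr_ge0 (H i * ls j - x)) (ltW lj).
  have -> : (H i * ls j - x) ^+ 2 / ls j = H i ^+ 2 * ls j + x ^+ 2 / ls j - H i * (2 * x).
    by field; rewrite gt_eqF.
  lra.
apply: (@le_trans _ _ (N%:R^-1 * \sum_i
   (\sum_a (H i ^+ 2 * le a / 2 + H a ^+ 2 * le a / 2)
    + \sum_j (H i ^+ 2 * ls j + (G j - Gc j) ^+ 2 / ls j)))).
  by rewrite ler_pM2l ?invr_gt0//; apply: ler_sum => i _; apply: lerD.
have -> : \sum_i (\sum_a (H i ^+ 2 * le a / 2 + H a ^+ 2 * le a / 2)
    + \sum_j (H i ^+ 2 * ls j + (G j - Gc j) ^+ 2 / ls j)) =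
    \sum_i (H i ^+ 2 * (\sum_a le a) / 2 + H i ^+ 2 * \sum_j ls j) +
    N%:R * \sum_i (H i ^+ 2 * le i / 2 + (G i - Gc i) ^+ 2 / ls i).
  have nE (x : R) : N%:R * x = \sum_(i < N) x by rewrite sumr_const card_ord mulr_natl.
  rewrite nE -big_split /=.
  apply: eq_bigr => i _; rewrite !big_split /= !mulr_sumr mulr_suml.
  by ring.
rewrite mulrDr mulrA mulVf ?gt_eqF// mul1r mulr_sumr -big_split /=.
by rewrite le_eqVlt; apply/orP; left; apply/eqP; apply: eq_bigr => i _; ring.
Qed.

Variables (Z Zc k : R).
Hypothesis k0 : 0 <= k.

(** The three coefficient families of the quadratic form in [G], [Gc] and [G - Gc]. They do not
    involve the current data block, so the form can be averaged over the block term by term. *)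
Definition fine_coef i : R := 2 * (Z - Zc) ^+ 2 + k * Z ^+ 2 * (avg le / 2 + le i / 2 + avg ls).
Definition coarse_coef i : R := k * Zc ^+ 2 * (avg le / 2 + le i / 2 + avg ls).
Definition gap_coef i : R := 2 * Zc ^+ 2 + k * (Z ^+ 2 + Zc ^+ 2) / ls i.

Let coef0 i : 0 <= avg le / 2 + le i / 2 + avg ls.
Proof.
have := avg_ge0 le0; have := avg_ge0 (fun i => ltW (ls0 i)); have := le0 i; lra.
Qed.

Lemma fine_coef_ge0 i : 0 <= fine_coef i.
Proof.
apply: addr_ge0; first by apply: mulr_ge0 => //; exact: sqr_ge0.
by apply: mulr_ge0 => //; apply: mulr_ge0 => //; exact: sqr_ge0.
Qed.

Lemma coarse_coef_ge0 i : 0 <= coarse_coef i.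
Proof. by apply: mulr_ge0 => //; apply: mulr_ge0 => //; exact: sqr_ge0. Qed.

Lemma gap_coef_ge0 i : 0 <= gap_coef i.
Proof.
apply: addr_ge0; first by apply: mulr_ge0 => //; exact: sqr_ge0.
apply: divr_ge0; last exact: ltW.
by apply: mulr_ge0 => //; apply: addr_ge0; exact: sqr_ge0.
Qed.

(** The left side is the functional [lyap] after one round, averaged over the new particles, with
    [k] the loss in the mutation step; the right side is ready for averaging over the data. *)
Lemma selection_bound :
  (Z * avg G - Zc * avg Gc) ^+ 2 + ((Z * avg G) ^+ 2 + (Zc * avg Gc) ^+ 2) *
    (k * \sum_i \sum_j maximal_coupling r1 r2 i j * g i j) <=
  avg (fun i => fine_coef i * G i ^+ 2 + coarse_coef i * Gc i ^+ 2
                + gap_coef i * (G i - Gc i) ^+ 2).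
Proof.
have p1 : S <= Num.max S Sc by rewrite le_max lexx.
have p2 : Sc <= Num.max S Sc by rewrite le_max lexx orbT.
have p3 i : Num.min (r1 i) (r2 i) <= G i / S by rewrite ge_min lexx.
have p4 i : Num.min (r1 i) (r2 i) <= Gc i / Sc by rewrite ge_min lexx orbT.
have hG := coupled_le G0 p1 p3; have hGc := coupled_le Gc0 p2 p4.
set M := \sum_i \sum_j _ in hG hGc *.
have jensen (f : 'I_N -> R) : avg f ^+ 2 <= avg (fun i => f i ^+ 2) by exact: mean_sqr_le.
have j1 := jensen G; have j2 := jensen (fun i => G i - Gc i).
have eB : avg (fun i => G i - Gc i) = avg G - avg Gc by rewrite /avg sumrB mulrBr.
rewrite eB in j2.
(* The difference is [(Z - Zc) * avg G + Zc * (avg G - avg Gc)]. *)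
have s1 : (Z * avg G - Zc * avg Gc) ^+ 2 <=
    2 * (Z - Zc) ^+ 2 * avg G ^+ 2 + 2 * Zc ^+ 2 * (avg G - avg Gc) ^+ 2.
  have := sqr_ge0 ((Z - Zc) * avg G - Zc * (avg G - avg Gc)); nra.
have s2 : 2 * (Z - Zc) ^+ 2 * avg G ^+ 2 <= 2 * (Z - Zc) ^+ 2 * avg (fun i => G i ^+ 2).
  by apply: ler_wpM2l => //; apply: mulr_ge0 => //; exact: sqr_ge0.
have s3 : 2 * Zc ^+ 2 * (avg G - avg Gc) ^+ 2 <= 2 * Zc ^+ 2 * avg (fun i => (G i - Gc i) ^+ 2).
  by apply: ler_wpM2l => //; apply: mulr_ge0 => //; exact: sqr_ge0.
have s4 := ler_wpM2l (mulr_ge0 k0 (sqr_ge0 Z)) hG.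
have s5 := ler_wpM2l (mulr_ge0 k0 (sqr_ge0 Zc)) hGc.
have -> : ((Z * avg G) ^+ 2 + (Zc * avg Gc) ^+ 2) * (k * M) =
  k * Z ^+ 2 * (avg G ^+ 2 * M) + k * Zc ^+ 2 * (avg Gc ^+ 2 * M) by ring.
have -> : avg (fun i => fine_coef i * G i ^+ 2 + coarse_coef i * Gc i ^+ 2
                + gap_coef i * (G i - Gc i) ^+ 2) =
  2 * (Z - Zc) ^+ 2 * avg (fun i => G i ^+ 2) + 2 * Zc ^+ 2 * avg (fun i => (G i - Gc i) ^+ 2)
  + (k * Z ^+ 2 * avg (fun i => (avg le / 2 + le i / 2 + avg ls) * G i ^+ 2 + (G i - Gc i) ^+ 2 / ls i)
  + k * Zc ^+ 2 * avg (fun i => (avg le / 2 + le i / 2 + avg ls) * Gc i ^+ 2 + (G i - Gc i) ^+ 2 / ls i)).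
  have A (c : R) f : c * avg f = N%:R^-1 * \sum_i c * f i.
    by rewrite /avg mulrCA mulr_sumr.
  rewrite !A -!mulrDr -!big_split /=; congr (_ * _); apply: eq_bigr => i _.
  by rewrite /fine_coef /coarse_coef /gap_coef; ring.
lra.
Qed.

Let avg_cst (c : R) : avg (fun=> c) = c.
Proof. by rewrite /avg sumr_const card_ord -[c *+ N]mulr_natl mulrA mulVf ?gt_eqF// mul1r. Qed.

Let avgD (f f' : 'I_N -> R) : avg (fun i => f i + f' i) = avg f + avg f'.
Proof. by rewrite /avg big_split mulrDr. Qed.

Let avgZ (c : R) (f : 'I_N -> R) : avg (fun i => c * f i) = c * avg f.
Proof. by rewrite /avg -mulr_sumr mulrCA. Qed.

Let avg_coef : avg (fun i => avg le / 2 + le i / 2 + avg ls) = avg le + avg ls.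
Proof.
rewrite avgD avg_cst avgD avg_cst.
have -> : avg (fun i => le i / 2) = avg le / 2.
  by rewrite /avg -mulr_suml mulrA.
by field.
Qed.

Lemma fine_coef_avg : avg fine_coef = 2 * (Z - Zc) ^+ 2 + k * Z ^+ 2 * (avg le + avg ls).
Proof. by rewrite avgD avg_cst avgZ avg_coef. Qed.

Lemma coarse_coef_avg : avg coarse_coef = k * Zc ^+ 2 * (avg le + avg ls).
Proof. by rewrite avgZ avg_coef. Qed.

End selection_weights.
Section measurable_closure.
Context {R : realType} d (T : measurableType d).

Lemma meas_fst d1 d2 (A : measurableType d1) (B : measurableType d2) (f : T -> A * B) :
  measurable_fun setT f -> measurable_fun setT (fun t => (f t).1).
Proof. exact: measurableT_comp. Qed.

Lemma meas_snd d1 d2 (A : measurableType d1) (B : measurableType d2) (f : T -> A * B) :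
  measurable_fun setT f -> measurable_fun setT (fun t => (f t).2).
Proof. exact: measurableT_comp. Qed.

Lemma meas_tnth d1 (A : measurableType d1) n (f : T -> n.-tuple A) (i : 'I_n) :
  measurable_fun setT f -> measurable_fun setT (fun t => tnth (f t) i).
Proof. by move=> mf; exact: (measurableT_comp (measurable_tnth i)). Qed.

Lemma meas_behead d1 (A : measurableType d1) n (f : T -> n.+1.-tuple A) :
  measurable_fun setT f -> measurable_fun setT (fun t => [tuple of behead (f t)]).
Proof. by move=> mf; exact: (measurableT_comp (@measurable_behead _ A n)). Qed.

Lemma meas_sqr (f : T -> R) :
  measurable_fun setT f -> measurable_fun setT (fun t => f t ^+ 2).
Proof. exact: measurable_funX. Qed.

Lemma meas_sum (I : Type) (s : seq I) (f : I -> T -> R) :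
  (forall i, measurable_fun setT (f i)) ->
  measurable_fun setT (fun t => \sum_(i <- s) f i t).
Proof. by move=> mf; exact: measurable_sum. Qed.

Lemma meas_avg n (f : 'I_n -> T -> R) : (forall i, measurable_fun setT (f i)) ->
  measurable_fun setT (fun t => avg (fun i => f i t)).
Proof. by move=> mf; apply: measurable_funM => //; exact: meas_sum. Qed.

Lemma meas_sqrt (f : T -> R) :
  measurable_fun setT f -> measurable_fun setT (fun t => Num.sqrt (f t)).
Proof. by move=> mf; exact: (measurableT_comp measurable_sqrt). Qed.

End measurable_closure.

Ltac meas_step :=
  first [ assumption | exact: measurable_cst | exact: measurable_id
        | apply: meas_avg => ? | apply: meas_sum => ?
        | apply: meas_sqr | apply: meas_sqrt
        | apply: measurable_fun_pair
        | apply: measurable_funD | apply: measurable_funB | apply: measurable_funM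
        | apply: measurable_funN
        | apply: meas_fst | apply: meas_snd | apply: meas_tnth | apply: meas_behead ].
Ltac meas := repeat meas_step.

Section mixture_kernel.
Context {R : realType} d1 d2 d3 (S : measurableType d1) (V : measurableType d2)
  (E : measurableType d3) (J : finType).
Variables (g : probability V R) (w : J -> S -> R) (F : J -> S -> V -> E).
Hypotheses (w0 : forall j s, 0 <= w j s) (w1 : forall s, \sum_j w j s = 1).
Hypothesis mw : forall j, measurable_fun setT (w j).
Hypothesis mF : forall j, measurable_fun setT (fun p : S * V => F j p.1 p.2).

Let mFs s j : measurable_fun setT (F j s).
Proof. exact: (measurableT_comp (mF j) (measurable_pair1 s)). Qed.

Definition kmix s : probability E R := sval (cid (int_finite_mixture g
  (fun j => w0 j s) (w1 s) (mFs s))).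

Lemma kmixE s f : nnm f ->
  (\int[kmix s]_x f x = \sum_j (w j s)%:E * \int[g]_v f (F j s v))%E.
Proof. by rewrite /kmix; case: cid => /= m; apply. Qed.

Lemma nnm_kmix (f : E -> \bar R) : nnm f -> nnm (fun s => \int[kmix s]_x f x)%E.
Proof.
move=> nf; under eq_fun do rewrite kmixE//.
apply: nnm_sum => j; apply: nnm_mul; first exact: nnm_EFin.
exact: (nnm_int g (nnm_comp nf (mF j))).
Qed.

Lemma measurable_kmix C : measurable C -> measurable_fun setT (fun s => kmix s C).
Proof.
move=> mC; have [+ _] := nnm_kmix (nnm_indic mC).
by congr measurable_fun; apply/funext => s; rewrite int_indicT.
Qed.

Lemma kmix_set s C : measurable C ->
  kmix s C = (\sum_j (w j s)%:E * \int[g]_v (\1_C (F j s v))%:E)%E.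
Proof. by move=> mC; rewrite -int_indicT// kmixE//; exact: nnm_indic. Qed.

Lemma mean_kmix s (f : E -> R) : bmeas f ->
  mean (kmix s) f = \sum_j w j s * mean g (fun v => f (F j s v)).
Proof.
move=> bf; have [mf [M fM]] := bf.
(* [kmixE] covers nonnegative integrands only; the shift by the bound [M] is undone because the
   weights sum to one. *)
pose f' x := f x + M.
have bf' : bmeas f' by apply: bmeasD => //; exact: bmeas_cst.
have f'0 x : 0 <= f' x by have := fM x; rewrite ler_norml => /andP[]; rewrite /f'; lra.
have bfj j : bmeas (fun v => f (F j s v)) by exact: bmeas_comp.
have : mean (kmix s) f' = \sum_j w j s * mean g (fun v => f' (F j s v)).
  apply: EFin_inj; rewrite -meanE// kmixE; last exact: nnm_bmeas.
  rewrite -sumEFin; apply: eq_bigr => j _; rewrite EFinM -meanE//.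
  exact: bmeas_comp.
rewrite meanD//; last exact: bmeas_cst.
have e j : w j s * mean g (fun v => f' (F j s v)) =
    w j s * mean g (fun v => f (F j s v)) + w j s * M.
  by rewrite meanD ?mean_cst ?mulrDr//; exact: bmeas_cst.
under eq_bigr do rewrite e.
rewrite big_split /= -mulr_suml w1 mul1r mean_cst => h.
exact: (addIr M) h.
Qed.

End mixture_kernel.

(** * Coupled particle filters over i.i.d. data blocks *)

Section coupled_particles.
Context {R : realType} dX dW dF dC dB (X : measurableType dX)
  (W : measurableType dW) (Ef : measurableType dF) (Ec : measurableType dC)
  (B : measurableType dB).
(** The section abstracts the model to what the argument needs: [q] is a squared distance kept
    between [D] and [2], [dl] a path cost, and the analytic input consists of the second moments of
    the potentials and [path_gap]. In the application [c1] and [c2] are the same at all levels and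
    only [D] depends on the level. *)
Variables (gam : probability W R) (mu : probability B R) (N : nat).
Variables (Pf : X -> W -> Ef) (Pc : X -> W -> Ec).
Variables (endf stf : Ef -> X) (endc stc : Ec -> X).
Variables (Gf : B -> Ef -> R) (Gc : B -> Ec -> R).
Variables (dl : Ef -> Ec -> R) (q : X -> X -> R) (xs : X) (D c1 c2 : R).
Hypothesis N0 : (0 < N)%N.

Hypothesis mPf : forall d (T : measurableType d) (f : T -> X) (g : T -> W),
  measurable_fun setT f -> measurable_fun setT g ->
  measurable_fun setT (fun t => Pf (f t) (g t)).
Hypothesis mPc : forall d (T : measurableType d) (f : T -> X) (g : T -> W),
  measurable_fun setT f -> measurable_fun setT g ->
  measurable_fun setT (fun t => Pc (f t) (g t)).
Hypothesis mendf : forall d (T : measurableType d) (f : T -> Ef),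
  measurable_fun setT f -> measurable_fun setT (fun t => endf (f t)).
Hypothesis mendc : forall d (T : measurableType d) (f : T -> Ec),
  measurable_fun setT f -> measurable_fun setT (fun t => endc (f t)).
Hypothesis mstf : forall d (T : measurableType d) (f : T -> Ef),
  measurable_fun setT f -> measurable_fun setT (fun t => stf (f t)).
Hypothesis mstc : forall d (T : measurableType d) (f : T -> Ec),
  measurable_fun setT f -> measurable_fun setT (fun t => stc (f t)).
Hypothesis mGf : forall d (T : measurableType d) (f : T -> B) (g : T -> Ef),
  measurable_fun setT f -> measurable_fun setT g ->
  measurable_fun setT (fun t => Gf (f t) (g t)).
Hypothesis mGc : forall d (T : measurableType d) (f : T -> B) (g : T -> Ec),
  measurable_fun setT f -> measurable_fun setT g ->
  measurable_fun setT (fun t => Gc (f t) (g t)).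
Hypothesis mdl : forall d (T : measurableType d) (f : T -> Ef) (g : T -> Ec),
  measurable_fun setT f -> measurable_fun setT g ->
  measurable_fun setT (fun t => dl (f t) (g t)).
Hypothesis mq : forall d (T : measurableType d) (f g : T -> X),
  measurable_fun setT f -> measurable_fun setT g ->
  measurable_fun setT (fun t => q (f t) (g t)).

Hypotheses (Gf0 : forall y e, 0 < Gf y e) (Gc0 : forall y e, 0 < Gc y e).
Hypothesis Gf_bounded : forall y, exists M, forall e, Gf y e <= M.
Hypothesis Gc_bounded : forall y, exists M, forall e, Gc y e <= M.
Hypotheses (dl0 : forall e ec, 0 <= dl e ec).
Hypotheses (D0 : 0 < D) (qD : forall x xc, D <= q x xc) (q2 : forall x xc, q x xc <= 2).
Hypothesis qxx : forall x, q x x = D.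
Hypotheses (stfP : forall x v, stf (Pf x v) = x) (stcP : forall x v, stc (Pc x v) = x).
Hypotheses (c1_ge0 : 0 <= c1) (c2_ge0 : 0 <= c2).
Hypothesis Gf_sqr : forall e, (\int[mu]_y (Gf y e ^+ 2)%:E <= c1%:E)%E.
Hypothesis Gc_sqr : forall e, (\int[mu]_y (Gc y e ^+ 2)%:E <= c1%:E)%E.
Hypothesis G_gap : forall e ec,
  (\int[mu]_y ((Gf y e - Gc y ec) ^+ 2)%:E <= (c1 * dl e ec)%:E)%E.
Hypothesis path_gap : forall x xc,
  (\int[gam]_v (dl (Pf x v) (Pc xc v) + q (endf (Pf x v)) (endc (Pc xc v)))%:E
   <= (c2 * q x xc)%:E)%E.

Ltac cmeas := repeat first
  [ meas_step | apply: mPf | apply: mPc | apply: mendf | apply: mendc | apply: mstf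
  | apply: mstc | apply: mGf | apply: mGc | apply: mdl | apply: mq ].

Local Notation E := (Ef * Ec)%type.
Local Notation ST := (B * N.-tuple E)%type.

Definition fine_weight (s : ST) i : R := Gf s.1 (tnth s.2 i).1 / \sum_j Gf s.1 (tnth s.2 j).1.
Definition coarse_weight (s : ST) i : R := Gc s.1 (tnth s.2 i).2 / \sum_j Gc s.1 (tnth s.2 j).2.

Definition sel (ab : 'I_N * 'I_N) (s : ST) : R :=
  maximal_coupling (fine_weight s) (coarse_weight s) ab.1 ab.2.

Definition draw (ab : 'I_N * 'I_N) (s : ST) (v : W) : E :=
  (Pf (endf (tnth s.2 ab.1).1) v, Pc (endc (tnth s.2 ab.2).2) v).

Lemma fine_weight_ge0 s i : 0 <= fine_weight s i.
Proof. by apply: normalized_ge0 => // j; exact: Gf0. Qed.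

Lemma coarse_weight_ge0 s i : 0 <= coarse_weight s i.
Proof. by apply: normalized_ge0 => // j; exact: Gc0. Qed.

Lemma fine_weight_sum s : \sum_i fine_weight s i = 1.
Proof. by apply: normalized_sum => // j; exact: Gf0. Qed.

Lemma coarse_weight_sum s : \sum_i coarse_weight s i = 1.
Proof. by apply: normalized_sum => // j; exact: Gc0. Qed.

Lemma sel_ge0 ab s : 0 <= sel ab s.
Proof.
apply: maximal_coupling_ge0; [exact: fine_weight_ge0|exact: coarse_weight_ge0|
  exact: fine_weight_sum].
Qed.

Lemma sel_sum s : \sum_ab sel ab s = 1.
Proof.
rewrite -(pair_bigA _ (fun a b => sel (a, b) s)) /=.
apply: maximal_coupling_sum; [exact: fine_weight_ge0|exact: coarse_weight_ge0|
  exact: fine_weight_sum|exact: coarse_weight_sum].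
Qed.

Lemma meas_fine_weight i : measurable_fun setT (fun s => fine_weight s i).
Proof.
apply: measurable_funM; first by cmeas.
apply: measurable_inv_ge0; first by cmeas.
by move=> s; apply: sumr_ge0 => j _; exact: ltW.
Qed.

Lemma meas_coarse_weight i : measurable_fun setT (fun s => coarse_weight s i).
Proof.
apply: measurable_funM; first by cmeas.
apply: measurable_inv_ge0; first by cmeas.
by move=> s; apply: sumr_ge0 => j _; exact: ltW.
Qed.

Lemma meas_sel ab : measurable_fun setT (sel ab).
Proof.
have mm i : measurable_fun setT (fun s => Num.min (fine_weight s i) (coarse_weight s i)).
  by apply: measurable_minr; [exact: meas_fine_weight|exact: meas_coarse_weight].
have mo : measurable_fun setT (fun s => overlap (fine_weight s) (coarse_weight s)).
  by apply: meas_sum => i; exact: mm.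
have mio : measurable_fun setT (fun s => (overlap (fine_weight s) (coarse_weight s))^-1).
  apply: measurable_inv_ge0 => // s; apply: overlap_ge0; [exact: fine_weight_ge0|exact: coarse_weight_ge0].
have mio1 : measurable_fun setT (fun s => (1 - overlap (fine_weight s) (coarse_weight s))^-1).
  apply: measurable_inv_ge0 => [|s]; first exact: measurable_funB.
  by rewrite subr_ge0; apply: overlap_le1; exact: fine_weight_sum.
have mf := meas_fine_weight ab.1; have mc := meas_coarse_weight ab.2.
have m1 := mm ab.1; have m2 := mm ab.2.
rewrite /sel /maximal_coupling /=; apply: measurable_funD; apply: measurable_funM => //.
- by case: (ab.1 == ab.2) => //; exact: measurable_funM.
- exact: measurable_funB.
- by apply: measurable_funM; apply: measurable_funM => //; exact: measurable_funB.
Qed.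

Lemma meas_draw ab : measurable_fun setT (fun p : ST * W => draw ab p.1 p.2).
Proof. rewrite /draw; cmeas. Qed.

Definition kap : ST -> probability E R := kmix gam sel_ge0 sel_sum meas_draw.

Definition updcpf (a : R * R) (y : B) (u : N.-tuple E) : R * R :=
  (a.1 * avg (fun i => Gf y (tnth u i).1), a.2 * avg (fun i => Gc y (tnth u i).2)).

Lemma meas_updcpf : measurable_fun setT
  (fun p : ((R * R) * B) * N.-tuple E => updcpf p.1.1 p.1.2 p.2).
Proof. rewrite /updcpf; cmeas. Qed.

Lemma meas_kap C : measurable C -> measurable_fun setT (fun s => kap s C).
Proof. by apply: measurable_kmix; exact: meas_sel. Qed.

Lemma meas_start : measurable_fun setT (fun v => (Pf xs v, Pc xs v)).
Proof. cmeas. Qed.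

Definition kinit : probability E R := sval (cid (int_push gam meas_start)).

Lemma kinitE f : nnm f -> (\int[kinit]_e f e = \int[gam]_v f (Pf xs v, Pc xs v))%E.
Proof. by rewrite /kinit; case: cid => /= m; apply. Qed.

Local Notation Tr := (transition mu updcpf kap).
Local Notation Ch := (chain mu (1 : R, 1 : R) updcpf kinit kap).

Definition lam x xc : R := Num.sqrt (q x xc).
Definition lam_start (e : E) : R := lam (stf e.1) (stc e.2).
Definition q_end (e : E) : R := q (endf e.1) (endc e.2).
Definition Th (e : E) : R := lam_start e + (dl e.1 e.2 + q_end e) / lam_start e.

(* Since [q] is not small on pairs that were decoupled, [dl + q_end] is measured
   relatively to [sqrt q] at the start: this makes [Th] of order [sqrt D] in mean,
   and at least [sqrt q] at the end point, so that a draw from [kap] has a mean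
   [Th] controlled by the current one. *)
Definition lyap (s : (R * R) * N.-tuple E) : R :=
  (s.1.1 - s.1.2) ^+ 2 + (s.1.1 ^+ 2 + s.1.2 ^+ 2) * avg (fun i => Th (tnth s.2 i)).

Let q_gt0 x xc : 0 < q x xc. Proof. exact: (lt_le_trans D0 (qD _ _)). Qed.
Let lam_gt0 x xc : 0 < lam x xc. Proof. by rewrite sqrtr_gt0 q_gt0. Qed.
Let lam_sqr x xc : lam x xc ^+ 2 = q x xc. Proof. by rewrite sqr_sqrtr// ltW// q_gt0. Qed.
Let lam_le2 x xc : lam x xc <= 2.
Proof.
have := lam_sqr x xc; have := q2 x xc; have := lam_gt0 x xc; nra.
Qed.

Let ls_gt0 e : 0 < lam_start e. Proof. exact: lam_gt0. Qed.
Let qe_ge0 e : 0 <= q_end e. Proof. exact: (ltW (q_gt0 _ _)). Qed.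

Lemma Th_ge0 e : 0 <= Th e.
Proof.
apply: addr_ge0 (ltW (ls_gt0 e)) _.
exact: divr_ge0 (addr_ge0 (dl0 _ _) (qe_ge0 e)) (ltW (ls_gt0 e)).
Qed.

Lemma gap_le_Th e : dl e.1 e.2 + q_end e <= 2 * Th e.
Proof.
have l0 := ls_gt0 e; have l2 : lam_start e <= 2 by exact: lam_le2.
have a0 : 0 <= dl e.1 e.2 + q_end e by rewrite addr_ge0.
rewrite /Th; set a := _ + q_end e in a0 *; set s := lam_start e in l0 l2 *.
have h : a <= 2 * (a / s) by rewrite mulrA ler_pdivlMr// mulrC ler_wpM2r.
lra.
Qed.

(** From [s + t ^+ 2 / s >= 2 * t] with [s], [t] the root distances at start and end. This closes
    the recursion, as the end of one path is the start of the next. *)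
Lemma lam_end_le_Th e : lam (endf e.1) (endc e.2) <= Th e.
Proof.
have l0 := ls_gt0 e; set t := lam _ _; have t2 : t ^+ 2 = q_end e by exact: lam_sqr.
have t0 : 0 < t by exact: lam_gt0.
rewrite /Th -t2; set s := lam_start e in l0 *.
have h : 0 <= (s - t) ^+ 2 / s by rewrite divr_ge0 ?sqr_ge0// ltW.
have h2 : 0 <= dl e.1 e.2 / s by rewrite divr_ge0// ltW.
have e1 : (s - t) ^+ 2 / s = s + t ^+ 2 / s - 2 * t by field; rewrite gt_eqF.
rewrite mulrDl; lra.
Qed.

Lemma start_gap_le_Th e : lam_start e + dl e.1 e.2 / lam_start e <= Th e.
Proof.
by rewrite /Th lerD2l ler_pM2r ?invr_gt0// lerDl.
Qed.

Lemma meas_Th d (T : measurableType d) (f : T -> E) : measurable_fun setT f ->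
  measurable_fun setT (fun t => Th (f t)).
Proof.
move=> mf; have mls : measurable_fun setT (fun t => lam_start (f t)).
  by rewrite /lam_start /lam; cmeas.
apply: measurable_funD => //; apply: measurable_funM.
  by rewrite /q_end; cmeas.
by apply: measurable_inv_ge0 => // t; exact: ltW.
Qed.

Lemma nnm_Th : nnm (fun e => (Th e)%:E).
Proof. by apply: nnm_EFin => [|e]; [exact: meas_Th|exact: Th_ge0]. Qed.

Lemma nnm_lyap : nnm (fun s => (lyap s)%:E).
Proof.
apply: nnm_EFin => [|s]; last first.
  apply: addr_ge0; first exact: sqr_ge0.
  apply: mulr_ge0; first by rewrite addr_ge0 ?sqr_ge0.
  by apply: avg_ge0 => // i; exact: Th_ge0.
rewrite /lyap; apply: measurable_funD; first by cmeas.
apply: measurable_funM; first by cmeas.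
by apply: meas_avg => i; apply: meas_Th; cmeas.
Qed.

(** [path_gap] is linear in [q]; division by [sqrt q] at the start, constant during the draw, makes
    it linear in [sqrt q]. *)
Lemma Th_path x xc :
  (\int[gam]_v (Th (Pf x v, Pc xc v))%:E <= ((1 + c2) * lam x xc)%:E)%E.
Proof.
have l0 := lam_gt0 x xc.
have np : nnm (fun v => (dl (Pf x v) (Pc xc v) + q (endf (Pf x v)) (endc (Pc xc v)))%:E).
  apply: nnm_EFin => [|v]; first by cmeas.
  by apply: addr_ge0 => //; apply: ltW; exact: q_gt0.
have -> : (\int[gam]_v (Th (Pf x v, Pc xc v))%:E = \int[gam]_v ((lam x xc)%:E +
    (lam x xc)^-1%:E * (dl (Pf x v) (Pc xc v) + q (endf (Pf x v)) (endc (Pc xc v)))%:E))%E.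
  apply: eq_integral => v _; rewrite -EFinM -EFinD; congr EFin.
  by rewrite /Th /lam_start /q_end /= stfP stcP [X in _ + X]mulrC.
have li0 : 0 <= (lam x xc)^-1 by rewrite invr_ge0 ltW.
rewrite int_add; last 2 first.
- by apply: nnm_cst; rewrite lee_fin ltW.
- by apply: nnm_mul => //; exact: nnm_cst.
rewrite int_cst int_scale//.
apply: (@le_trans _ _ ((lam x xc)%:E + (lam x xc)^-1%:E * (c2 * q x xc)%:E)%E).
  by apply: leeD2l; apply: lee_wpmul2l; [rewrite lee_fin|exact: path_gap].
rewrite -EFinM -EFinD lee_fin -lam_sqr.
by rewrite le_eqVlt; apply/orP; left; apply/eqP; field; rewrite gt_eqF.
Qed.

Lemma Th_kap s : (\int[kap s]_e (Th e)%:E <=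
  ((1 + c2) * \sum_a \sum_b sel (a, b) s *
     lam (endf (tnth s.2 a).1) (endc (tnth s.2 b).2))%:E)%E.
Proof.
rewrite kmixE; last exact: nnm_Th.
rewrite (pair_bigA _ (fun a b => sel (a, b) s *
     lam (endf (tnth s.2 a).1) (endc (tnth s.2 b).2))) /= mulr_sumr -sumEFin.
apply: lee_sum => -[a b] _ /=; rewrite mulrCA EFinM.
by apply: lee_wpmul2l; [rewrite lee_fin sel_ge0|exact: Th_path].
Qed.

Lemma int_quadratic (u : N.-tuple E) (al be ep : 'I_N -> R) :
  (forall i, 0 <= al i) -> (forall i, 0 <= be i) -> (forall i, 0 <= ep i) ->
  (\int[mu]_y (avg (fun i => al i * Gf y (tnth u i).1 ^+ 2
     + be i * Gc y (tnth u i).2 ^+ 2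
     + ep i * (Gf y (tnth u i).1 - Gc y (tnth u i).2) ^+ 2))%:E <=
   (c1 * avg (fun i => al i + be i + ep i * dl (tnth u i).1 (tnth u i).2))%:E)%E.
Proof.
move=> al0 be0 ep0.
have ns (f : B -> R) : measurable_fun setT f -> nnm (fun y => (f y ^+ 2)%:E).
  by move=> mf; apply: nnm_EFin => [|y]; [exact: meas_sqr|exact: sqr_ge0].
have n1 i : nnm (fun y => (Gf y (tnth u i).1 ^+ 2)%:E) by apply: ns; cmeas.
have n2 i : nnm (fun y => (Gc y (tnth u i).2 ^+ 2)%:E) by apply: ns; cmeas.
have n3 i : nnm (fun y => ((Gf y (tnth u i).1 - Gc y (tnth u i).2) ^+ 2)%:E).
  by apply: ns; cmeas.
have nc (c : R) (f : B -> \bar R) : 0 <= c -> nnm f -> nnm (fun y => c%:E * f y)%E.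
  by move=> h nf; apply: nnm_mul => //; apply: nnm_cst; rewrite lee_fin.
have n4 i := nc _ _ (al0 i) (n1 i); have n5 i := nc _ _ (be0 i) (n2 i).
have n6 i := nc _ _ (ep0 i) (n3 i).
have n7 i := nnm_add (nnm_add (n4 i) (n5 i)) (n6 i).
under eq_integral => y _.
  rewrite /avg EFinM -sumEFin.
  under eq_bigr => i _ do rewrite !EFinD !EFinM.
  over.
rewrite int_scale; [|exact: nnm_sum|by rewrite invr_ge0].
rewrite int_sum//.
have -> : c1 * avg (fun i => al i + be i + ep i * dl (tnth u i).1 (tnth u i).2) =
  N%:R^-1 * \sum_i (al i * c1 + be i * c1 + ep i * (c1 * dl (tnth u i).1 (tnth u i).2)).
  by rewrite /avg mulrCA mulr_sumr; congr (_ * _); apply: eq_bigr => i _; ring.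
rewrite EFinM -sumEFin; apply: lee_wpmul2l; first by rewrite lee_fin invr_ge0.
apply: lee_sum => i _.
rewrite (int_add _ (nnm_add (n4 i) (n5 i)) (n6 i)) (int_add _ (n4 i) (n5 i)).
rewrite (int_scale _ (n1 i) (al0 i)) (int_scale _ (n2 i) (be0 i)) (int_scale _ (n3 i) (ep0 i)).
by rewrite 2!EFinD 3!EFinM; apply: leeD; [apply: leeD|]; apply: lee_wpmul2l; rewrite ?lee_fin.
Qed.

Lemma lyap_upd a y u :
  (\int[iid (kap (y, u)) N]_u' (lyap (updcpf a y u, u'))%:E =
   (((updcpf a y u).1 - (updcpf a y u).2) ^+ 2)%:E +
   ((updcpf a y u).1 ^+ 2 + (updcpf a y u).2 ^+ 2)%:E * \int[kap (y, u)]_e (Th e)%:E)%E.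
Proof.
set a' := updcpf a y u; rewrite /lyap /=.
have c0 : 0 <= a'.1 ^+ 2 + a'.2 ^+ 2 by rewrite addr_ge0 ?sqr_ge0.
have mT : measurable_fun setT Th by exact: (meas_Th (@measurable_id _ _ _)).
have nT : nnm (fun u' : N.-tuple E => (avg (fun i => Th (tnth u' i)))%:E).
  apply: nnm_EFin => [|u']; first by apply: meas_avg => i; apply: meas_Th; cmeas.
  by apply: avg_ge0 => // i; exact: Th_ge0.
under eq_integral => u' _ do rewrite EFinD [X in (_ + X)%E]EFinM.
rewrite int_add; last 2 first.
- by apply: nnm_cst; rewrite lee_fin sqr_ge0.
- by apply: nnm_mul => //; apply: nnm_cst; rewrite lee_fin.
by rewrite int_cst int_scale// iid_mean//; exact: Th_ge0.
Qed.

(** [2 * (1 + c2)] comes from the terms with [lam] at start and end, [4] from the mean of [dl]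
    through [gap_le_Th], and [c1] from averaging the squared potentials. *)
Definition growth : R := c1 * (6 + 2 * c2).

Lemma growth_ge0 : 0 <= growth.
Proof. by apply: mulr_ge0 => //; rewrite addr_ge0// mulr_ge0. Qed.

(** The new particles are averaged first, given the block; [selection_bound] then leaves a quadratic
    form in the potentials whose coefficients are fixed by the old particles, and the block is
    averaged last. *)
Lemma transition_lyap s :
  (Tr (fun s => (lyap s)%:E) s <= growth%:E * (lyap s)%:E)%E.
Proof.
case: s => [[Z Zc] u]; rewrite /transition.
pose le i := lam (endf (tnth u i).1) (endc (tnth u i).2).
pose ls i := lam_start (tnth u i).
pose g a b := lam (endf (tnth u a).1) (endc (tnth u b).2).
have le0 i : 0 <= le i by exact: (ltW (lam_gt0 _ _)).
have ls0 i : 0 < ls i by exact: ls_gt0.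
have gb a b : 0 <= g a b <= 2 by rewrite (ltW (lam_gt0 _ _)) lam_le2.
have k0 : 0 <= 1 + c2 by rewrite addr_ge0.
pose al := fine_coef le ls Z Zc (1 + c2).
pose be := coarse_coef le ls Zc (1 + c2).
pose ep := gap_coef ls Z Zc (1 + c2).
have al0 i : 0 <= al i by exact: fine_coef_ge0.
have be0 i : 0 <= be i by exact: coarse_coef_ge0.
have ep0 i : 0 <= ep i by exact: gap_coef_ge0.
apply: (@le_trans _ _ (\int[mu]_y (avg (fun i => al i * Gf y (tnth u i).1 ^+ 2
     + be i * Gc y (tnth u i).2 ^+ 2
     + ep i * (Gf y (tnth u i).1 - Gc y (tnth u i).2) ^+ 2))%:E)%E).
  apply: int_le.
  - exact: (nnm_transition_s meas_updcpf meas_kap _ nnm_lyap).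
  - apply: nnm_EFin => [|y]; first by cmeas.
    apply: avg_ge0 => // i; apply: addr_ge0; first apply: addr_ge0;
      by apply: mulr_ge0 => //; exact: sqr_ge0.
  move=> y; rewrite [leLHS]lyap_upd /=.
  have h := Th_kap (y, u).
  apply: (@le_trans _ _ (((Z * avg (fun i => Gf y (tnth u i).1) -
      Zc * avg (fun i => Gc y (tnth u i).2)) ^+ 2)%:E +
     ((Z * avg (fun i => Gf y (tnth u i).1)) ^+ 2 +
      (Zc * avg (fun i => Gc y (tnth u i).2)) ^+ 2)%:E *
     ((1 + c2) * \sum_a \sum_b sel (a, b) (y, u) * g a b)%:E)%E).
    by apply: leeD2l; apply: lee_wpmul2l => //; rewrite lee_fin addr_ge0 ?sqr_ge0.
  rewrite -EFinM -EFinD lee_fin.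
  exact: (selection_bound N0 (fun i => Gf0 y (tnth u i).1)
    (fun i => Gc0 y (tnth u i).2) ls0 le0 gb (fun=> erefl) Z Zc k0).
apply: (le_trans (int_quadratic u al0 be0 ep0)); rewrite -EFinM lee_fin.
rewrite /growth -mulrA; apply: ler_wpM2l => //.
have avgD (f f' : 'I_N -> R) : avg (fun i => f i + f' i) = avg f + avg f'.
  by rewrite /avg big_split mulrDr.
have avgZ (c : R) (f : 'I_N -> R) : avg (fun i => c * f i) = c * avg f.
  by rewrite /avg -mulr_sumr mulrCA.
have avg_le (f f' : 'I_N -> R) : (forall i, f i <= f' i) -> avg f <= avg f'.
  by move=> ff; rewrite ler_wpM2l ?invr_ge0//; apply: ler_sum.
pose T i := Th (tnth u i).
pose di i := dl (tnth u i).1 (tnth u i).2.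
have T0 i : 0 <= T i by exact: Th_ge0.
have aT0 : 0 <= avg T by exact: avg_ge0.
(* Each average left by the data integration is dominated by the one quantity that [lyap]
   records. *)
have hle : avg le <= avg T by apply: avg_le => i; exact: lam_end_le_Th.
have hls : avg ls + avg (fun i => di i / ls i) <= avg T.
  by rewrite -avgD; apply: avg_le => i; exact: start_gap_le_Th.
have hdi : avg di <= 2 * avg T.
  rewrite -avgZ; apply: avg_le => i; apply: le_trans (gap_le_Th (tnth u i)).
  by rewrite lerDl.
rewrite 2!avgD /al /be fine_coef_avg// coarse_coef_avg//.
have -> : avg (fun i => ep i * di i) =
    2 * Zc ^+ 2 * avg di + (1 + c2) * (Z ^+ 2 + Zc ^+ 2) * avg (fun i => di i / ls i).
  by rewrite -!avgZ -avgD; congr avg; apply/funext => i; rewrite /ep /gap_coef; ring.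
rewrite /lyap /= -/T.
have Z0 := sqr_ge0 Z; have Zc0 := sqr_ge0 Zc; have ZZ0 := sqr_ge0 (Z - Zc).
set A := (Z - Zc) ^+ 2 in ZZ0 *; set z := Z ^+ 2 in Z0 *; set zc := Zc ^+ 2 in Zc0 *.
set T' := avg T in aT0 hle hls hdi *; set a1 := avg le in hle *.
set a2 := avg ls in hls *; set a3 := avg (fun i => _ / _) in hls *.
set a4 := avg di in hdi *.
have k1 : 0 <= (1 + c2) * (z + zc) by rewrite mulr_ge0// addr_ge0.
have m1 := ler_wpM2l k1 (lerD hle hls).
have m2 := ler_wpM2l Zc0 hdi.
have m3 : 0 <= z * T' by rewrite mulr_ge0.
have m4 : 0 <= c2 * A by rewrite mulr_ge0.
lra.
Qed.

Lemma init_lyap : (Ch 0 (fun s => (lyap s)%:E) <= (2 * (1 + c2) * Num.sqrt D)%:E)%E.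
Proof.
rewrite /chain /lyap /= subrr expr0n /= expr1n -[1 + 1]/(2).
have nT : nnm (fun u' : N.-tuple E => (avg (fun i => Th (tnth u' i)))%:E).
  apply: nnm_EFin => [|u']; first by apply: meas_avg => i; apply: meas_Th; cmeas.
  by apply: avg_ge0 => // i; exact: Th_ge0.
under eq_integral => u' _ do rewrite add0r EFinM.
rewrite int_scale// iid_mean//; [|exact: (meas_Th (@measurable_id _ _ _))|exact: Th_ge0].
rewrite kinitE; last exact: nnm_Th.
have := Th_path xs xs; rewrite /lam qxx => h.
by rewrite -mulrA EFinM; apply: lee_wpmul2l.
Qed.

Lemma chain_lyap p :
  (Ch p (fun s => (lyap s)%:E) <= (2 * (1 + c2) * Num.sqrt D * growth ^+ p)%:E)%E.
Proof.
elim: p => [|p IH]; first by rewrite expr0 mulr1; exact: init_lyap.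
rewrite /=; apply: (@le_trans _ _ (Ch p (fun s => growth%:E * (lyap s)%:E)%E)).
  apply: (chain_le _ _ _ meas_updcpf meas_kap).
  - exact: (nnm_transition _ meas_updcpf meas_kap nnm_lyap).
  - apply: nnm_mul; last exact: nnm_lyap.
    by apply: nnm_cst; rewrite lee_fin growth_ge0.
  - exact: transition_lyap.
rewrite (chain_scale _ _ _ meas_updcpf meas_kap p nnm_lyap growth_ge0).
apply: (@le_trans _ _ (growth%:E * (2 * (1 + c2) * Num.sqrt D * growth ^+ p)%:E)%E).
  by apply: lee_wpmul2l => //; rewrite lee_fin growth_ge0.
by rewrite -EFinM lee_fin exprS; lra.
Qed.

(** Contribution of one pair to the difference of the two unnormalized estimators: [V] and [Vc] are
    values-to-go, functions of the remaining blocks and of the current state, and [a] holds the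
    products of normalizing constants. *)
Definition contrib n (V Vc : n.-tuple B * X -> R) (y0 : B) (y : n.-tuple B)
    (a : R * R) (e : E) : R :=
  a.1 * (Gf y0 e.1 * V (y, endf e.1)) - a.2 * (Gc y0 e.2 * Vc (y, endc e.2)).

(* The bounds that survive one backward step of the (unnormalized) filter, with
   the remaining [n] data blocks as arguments. *)
Record test_pair n (V Vc : n.-tuple B * X -> R) (c : R) : Prop := {
  tp_measf : measurable_fun setT V;
  tp_measc : measurable_fun setT Vc;
  tp_bndf : forall y, exists M, forall x, `|V (y, x)| <= M;
  tp_bndc : forall y, exists M, forall x, `|Vc (y, x)| <= M;
  tp_sqrf : forall x, (\int[iid mu n]_y (V (y, x) ^+ 2)%:E <= c%:E)%E;
  tp_sqrc : forall x, (\int[iid mu n]_y (Vc (y, x) ^+ 2)%:E <= c%:E)%E;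
  tp_gap : forall x xc,
    (\int[iid mu n]_y ((V (y, x) - Vc (y, xc)) ^+ 2)%:E <= (c * q x xc)%:E)%E }.

Lemma meas_contrib n (V Vc : n.-tuple B * X -> R) d (T : measurableType d)
    (y0 : T -> B) (y : T -> n.-tuple B) (a : T -> R * R) (e : T -> E) :
  measurable_fun setT V -> measurable_fun setT Vc ->
  measurable_fun setT y0 -> measurable_fun setT y -> measurable_fun setT a ->
  measurable_fun setT e ->
  measurable_fun setT (fun t => contrib V Vc (y0 t) (y t) (a t) (e t)).
Proof.
move=> mV mVc my0 my ma me.
have h1 : measurable_fun setT (fun t => V (y t, endf (e t).1)).
  by apply: (measurableT_comp mV); cmeas.
have h2 : measurable_fun setT (fun t => Vc (y t, endc (e t).2)).
  by apply: (measurableT_comp mVc); cmeas.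
rewrite /contrib; cmeas.
Qed.

Lemma bmeas_contrib n (V Vc : n.-tuple B * X -> R) c y0 y a : test_pair V Vc c ->
  bmeas (contrib V Vc y0 y a).
Proof.
move=> tp; split; first by apply: meas_contrib => //; [exact: tp_measf tp|exact: tp_measc tp].
have [M1 h1] := tp_bndf tp y; have [M2 h2] := tp_bndc tp y.
have [M3 h3] := Gf_bounded y0; have [M4 h4] := Gc_bounded y0.
exists (`|a.1| * (M3 * M1) + `|a.2| * (M4 * M2)) => e.
apply: (le_trans (ler_normB _ _)); rewrite !normrM; apply: lerD; apply: ler_wpM2l => //.
  by apply: ler_pM => //; rewrite gtr0_norm//.
by apply: ler_pM => //; rewrite gtr0_norm//.
Qed.

Let int_lin2 d (T : measurableType d) (m : probability T R) (f g : T -> \bar R) (a b : R) :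
  nnm f -> nnm g -> 0 <= a -> 0 <= b ->
  (\int[m]_x (a%:E * f x + b%:E * g x) = a%:E * \int[m]_x f x + b%:E * \int[m]_x g x)%E.
Proof.
move=> nf ng a0 b0.
have n1 : nnm (fun x => a%:E * f x)%E by apply: nnm_mul => //; exact: nnm_cst.
have n2 : nnm (fun x => b%:E * g x)%E by apply: nnm_mul => //; exact: nnm_cst.
by rewrite (int_add _ n1 n2) (int_scale _ nf a0) (int_scale _ ng b0).
Qed.

Let nnm_lin2 d (T : measurableType d) (f g : T -> \bar R) (a b : R) :
  nnm f -> nnm g -> 0 <= a -> 0 <= b -> nnm (fun x => a%:E * f x + b%:E * g x)%E.
Proof.
by move=> nf ng a0 b0; apply: nnm_add; apply: nnm_mul => //; exact: nnm_cst.
Qed.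

(** The difference of products is telescoped into differences of the constants, of the potentials
    and of the values-to-go; the square of three terms costs the factor [3]. The block [y0] is
    independent of the later ones, so second moments multiply. *)
Lemma contrib_sqr n (V Vc : n.-tuple B * X -> R) c a e : 0 <= c -> test_pair V Vc c ->
  (\int[mu]_y0 \int[iid mu n]_y (contrib V Vc y0 y a e ^+ 2)%:E <=
   (3 * c1 * c * ((a.1 - a.2) ^+ 2 + a.2 ^+ 2 * (dl e.1 e.2 + q_end e)))%:E)%E.
Proof.
move=> c0 tp; have mV := tp_measf tp; have mVc := tp_measc tp.
have nsq d (T : measurableType d) (f : T -> R) : measurable_fun setT f ->
    nnm (fun y => (f y ^+ 2)%:E).
  by move=> mf; apply: nnm_EFin => [|y]; [exact: meas_sqr|exact: sqr_ge0].
have mVe : measurable_fun setT (fun y => V (y, endf e.1)).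
  exact: (measurableT_comp mV (measurable_pair2 _)).
have mVce : measurable_fun setT (fun y => Vc (y, endc e.2)).
  exact: (measurableT_comp mVc (measurable_pair2 _)).
pose al y0 := 3 * (a.1 - a.2) ^+ 2 * Gf y0 e.1 ^+ 2 +
  3 * a.2 ^+ 2 * (Gf y0 e.1 - Gc y0 e.2) ^+ 2.
pose be y0 := 3 * a.2 ^+ 2 * Gc y0 e.2 ^+ 2.
have al0 y0 : 0 <= al y0.
  by apply: addr_ge0; apply: mulr_ge0; rewrite ?sqr_ge0//; apply: mulr_ge0; rewrite ?sqr_ge0.
have be0 y0 : 0 <= be y0.
  by apply: mulr_ge0; rewrite ?sqr_ge0//; apply: mulr_ge0; rewrite ?sqr_ge0.
have nV := nsq _ _ _ mVe.
have nVV := nsq _ _ _ (measurable_funB mVe mVce).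
have nin : nnm (fun p : B * n.-tuple B => (contrib V Vc p.1 p.2 a e ^+ 2)%:E).
  by apply: nsq; apply: meas_contrib => //; cmeas.
have mG1 : measurable_fun setT (fun y0 => Gf y0 e.1) by cmeas.
have mG2 : measurable_fun setT (fun y0 => Gc y0 e.2) by cmeas.
have nG1 := nsq _ _ _ mG1; have nG2 := nsq _ _ _ mG2.
have nG3 := nsq _ _ _ (measurable_funB mG1 mG2).
have inner y0 : (\int[iid mu n]_y (contrib V Vc y0 y a e ^+ 2)%:E <=
    (c * al y0 + c * q_end e * be y0)%:E)%E.
  apply: (@le_trans _ _ (\int[iid mu n]_y ((al y0)%:E * (V (y, endf e.1) ^+ 2)%:E +
      (be y0)%:E * ((V (y, endf e.1) - Vc (y, endc e.2)) ^+ 2)%:E))%E).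
    apply: int_le; first exact: (nnm_pair2 y0 nin).
      exact: (nnm_lin2 nV nVV (al0 y0) (be0 y0)).
    move=> y; rewrite -!EFinM -EFinD lee_fin /contrib /al /be.
    set g := Gf _ _; set gc := Gc _ _; set v := V _; set vc := Vc _.
    set p1 := (a.1 - a.2) * g * v; set p2 := a.2 * (g - gc) * v; set p3 := a.2 * gc * (v - vc).
    have -> : a.1 * (g * v) - a.2 * (gc * vc) = p1 + p2 + p3 by rewrite /p1 /p2 /p3; ring.
    have -> : (3 * (a.1 - a.2) ^+ 2 * g ^+ 2 + 3 * a.2 ^+ 2 * (g - gc) ^+ 2) * v ^+ 2 +
      3 * a.2 ^+ 2 * gc ^+ 2 * (v - vc) ^+ 2 = 3 * (p1 ^+ 2 + p2 ^+ 2 + p3 ^+ 2).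
      by rewrite /p1 /p2 /p3; ring.
    have := sqr_ge0 (p1 - p2); have := sqr_ge0 (p1 - p3); have := sqr_ge0 (p2 - p3); lra.
  rewrite (int_lin2 _ nV nVV (al0 y0) (be0 y0)).
  have -> : (c * al y0 + c * q_end e * be y0)%:E =
      ((al y0)%:E * c%:E + (be y0)%:E * (c * q_end e)%:E)%E.
    by rewrite -!EFinM -EFinD; congr EFin; ring.
  apply: leeD; apply: lee_wpmul2l; rewrite ?lee_fin//.
    exact: (tp_sqrf tp).
  exact: (tp_gap tp).
have qe0 := qe_ge0 e.
have A0 : 0 <= 3 * (a.1 - a.2) ^+ 2 by rewrite mulr_ge0// sqr_ge0.
have B0 : 0 <= 3 * a.2 ^+ 2 by rewrite mulr_ge0// sqr_ge0.
have nal : nnm (fun y0 => (al y0)%:E) by apply: nnm_EFin => //; rewrite /al; cmeas.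
have nbe : nnm (fun y0 => (be y0)%:E) by apply: nnm_EFin => //; rewrite /be; cmeas.
have cq0 : 0 <= c * q_end e by rewrite mulr_ge0.
apply: (@le_trans _ _ (\int[mu]_y0 (c%:E * (al y0)%:E + (c * q_end e)%:E * (be y0)%:E))%E).
  apply: int_le; first exact: (nnm_int (iid mu n) nin).
    exact: (nnm_lin2 nal nbe c0 cq0).
  by move=> y0; rewrite -!EFinM -EFinD.
rewrite (int_lin2 _ nal nbe c0 cq0).
have -> : (\int[mu]_y0 (al y0)%:E = \int[mu]_y0
    ((3 * (a.1 - a.2) ^+ 2)%:E * (Gf y0 e.1 ^+ 2)%:E +
     (3 * a.2 ^+ 2)%:E * ((Gf y0 e.1 - Gc y0 e.2) ^+ 2)%:E))%E.
  by apply: eq_integral => y0 _; rewrite -!EFinM -EFinD.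
have -> : (\int[mu]_y0 (be y0)%:E = (3 * a.2 ^+ 2)%:E * \int[mu]_y0 (Gc y0 e.2 ^+ 2)%:E)%E.
  by rewrite -(int_scale _ nG2 B0); apply: eq_integral => y0 _; rewrite -EFinM.
rewrite (int_lin2 _ nG1 nG3 A0 B0).
apply: (@le_trans _ _ (c%:E * ((3 * (a.1 - a.2) ^+ 2)%:E * c1%:E +
     (3 * a.2 ^+ 2)%:E * (c1 * dl e.1 e.2)%:E) +
   (c * q_end e)%:E * ((3 * a.2 ^+ 2)%:E * c1%:E))%E).
  apply: leeD; apply: lee_wpmul2l; rewrite ?lee_fin//.
    apply: leeD; apply: lee_wpmul2l.
    - by rewrite lee_fin.
    - exact: Gf_sqr.
    - by rewrite lee_fin.
    - exact: G_gap.
  by apply: lee_wpmul2l; [rewrite lee_fin|exact: Gc_sqr].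
rewrite -!(EFinM, EFinD) lee_fin.
by rewrite le_eqVlt; apply/orP; left; apply/eqP; ring.
Qed.

(** Recasts the second moment in the shape of [lyap], so that [chain_lyap] controls the conditional
    variances. The factor [3] doubles through [gap_le_Th]. *)
Lemma contrib_sqr_lyap n (V Vc : n.-tuple B * X -> R) c a e : 0 <= c -> test_pair V Vc c ->
  (\int[iid mu n.+1]_y (contrib V Vc (tnth y ord0) [tuple of behead y] a e ^+ 2)%:E <=
   (6 * c1 * c)%:E * (((a.1 - a.2) ^+ 2)%:E + (a.1 ^+ 2 + a.2 ^+ 2)%:E * (Th e)%:E))%E.
Proof.
move=> c0 tp.
rewrite iidS; last first.
  apply: nnm_EFin => [|y]; last exact: sqr_ge0.
  by apply: meas_sqr; apply: meas_contrib; [exact: tp_measf tp|exact: tp_measc tp| | | |]; cmeas.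
apply: (@le_trans _ _ (\int[mu]_y0 \int[iid mu n]_y (contrib V Vc y0 y a e ^+ 2)%:E)%E).
  rewrite le_eqVlt; apply/orP; left; apply/eqP; apply: eq_integral => y0 _.
  apply: eq_integral => y _; rewrite tnth0; congr ((contrib _ _ _ _ _ _ ^+ 2)%:E).
  exact: val_inj.
apply: (le_trans (contrib_sqr a e c0 tp)).
rewrite -!(EFinM, EFinD) lee_fin.
have h := gap_le_Th e; have T0 := Th_ge0 e.
have -> : 6 * c1 * c * ((a.1 - a.2) ^+ 2 + (a.1 ^+ 2 + a.2 ^+ 2) * Th e) =
  3 * c1 * c * (2 * (a.1 - a.2) ^+ 2 + 2 * ((a.1 ^+ 2 + a.2 ^+ 2) * Th e)) by ring.
apply: ler_wpM2l; first by rewrite !mulr_ge0.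
have h1 := ler_wpM2l (sqr_ge0 a.2) h; have h2 := mulr_ge0 (sqr_ge0 a.1) T0.
have := sqr_ge0 (a.1 - a.2); lra.
Qed.

(** One backward step of the unnormalized Feynman-Kac semigroup; only the path noise is averaged,
    the data block becomes an argument. *)
Definition stepf n (V : n.-tuple B * X -> R) (p : n.+1.-tuple B * X) : R :=
  mean gam (fun v => Gf (tnth p.1 ord0) (Pf p.2 v) *
                     V ([tuple of behead p.1], endf (Pf p.2 v))).
Definition stepc n (V : n.-tuple B * X -> R) (p : n.+1.-tuple B * X) : R :=
  mean gam (fun v => Gc (tnth p.1 ord0) (Pc p.2 v) *
                     V ([tuple of behead p.1], endc (Pc p.2 v))).

Let meas_mean d (S : measurableType d) (h : S * W -> R) : measurable_fun setT h ->
  measurable_fun setT (fun s => mean gam (fun v => h (s, v))).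
Proof.
move=> mh; have mE : measurable_fun setT (EFin \o h) by exact/measurable_EFinP.
have np : nnm ((EFin \o h)^\+)%E.
  by split=> [|x]; [exact: measurable_funepos|exact: funepos_ge0].
have nn : nnm ((EFin \o h)^\-)%E.
  by split=> [|x]; [exact: measurable_funeneg|exact: funeneg_ge0].
apply: (measurableT_comp (fine_measurable measurableT)).
under eq_fun do rewrite integralE.
apply: emeasurable_funB.
  have [+ _] := nnm_int gam np; congr measurable_fun; apply/funext => s.
  by apply: eq_integral => v _; rewrite !funeposE.
have [+ _] := nnm_int gam nn; congr measurable_fun; apply/funext => s.
by apply: eq_integral => v _; rewrite !funenegE.
Qed.

Lemma meas_stepf n (V : n.-tuple B * X -> R) : measurable_fun setT V ->
  measurable_fun setT (stepf V).
Proof.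
move=> mV; apply: (meas_mean (h := fun p => Gf (tnth p.1.1 ord0) (Pf p.1.2 p.2) *
                     V ([tuple of behead p.1.1], endf (Pf p.1.2 p.2)))).
apply: measurable_funM; first by cmeas.
by apply: (measurableT_comp mV); cmeas.
Qed.

Lemma meas_stepc n (V : n.-tuple B * X -> R) : measurable_fun setT V ->
  measurable_fun setT (stepc V).
Proof.
move=> mV; apply: (meas_mean (h := fun p => Gc (tnth p.1.1 ord0) (Pc p.1.2 p.2) *
                     V ([tuple of behead p.1.1], endc (Pc p.1.2 p.2)))).
apply: measurable_funM; first by cmeas.
by apply: (measurableT_comp mV); cmeas.
Qed.

Lemma mean_contrib n (V Vc : n.-tuple B * X -> R) c (y : n.+1.-tuple B) a x xc :
  test_pair V Vc c ->
  mean gam (fun v => contrib V Vc (tnth y ord0) [tuple of behead y] a (Pf x v, Pc xc v)) =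
  a.1 * stepf V (y, x) - a.2 * stepc Vc (y, xc).
Proof.
move=> tp; have mV := tp_measf tp; have mVc := tp_measc tp.
have mid : measurable_fun setT (id : W -> W) by exact: measurable_id.
have mp : measurable_fun setT (fun v => (Pf x v, Pc xc v)) by cmeas.
have bc a' := bmeas_comp (bmeas_contrib (tnth y ord0) [tuple of behead y] a' tp) mp.
have b1 : bmeas (fun v => Gf (tnth y ord0) (Pf x v) *
                     V ([tuple of behead y], endf (Pf x v))).
  have := bc (1, 0); congr bmeas; apply/funext => v.
  by rewrite /contrib /= mul1r mul0r subr0.
have b2 : bmeas (fun v => Gc (tnth y ord0) (Pc xc v) *
                     Vc ([tuple of behead y], endc (Pc xc v))).
  have := bc (0, -1); congr bmeas; apply/funext => v.
  by rewrite /contrib /= mulN1r mul0r sub0r opprK.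
rewrite /contrib /= meanB; [|exact: bmeasZ|exact: bmeasZ].
by rewrite !meanZ.
Qed.

(** The largest of the constants that [step_sqr] yields for [a] equal to [(1, 0)], [(0, 1)] and
    [(1, 1)]; the [2] is the bound on [q]. *)
Definition test_rate : R := 3 * c1 * (1 + 2 * c2).

Lemma test_rate_ge0 : 0 <= test_rate.
Proof. by rewrite /test_rate !mulr_ge0// addr_ge0// mulr_ge0. Qed.

(** Jensen over the path noise, then the data are integrated before the noise. The weights [a] are
    free so that one computation gives the three bounds of [test_pair_step]. *)
Lemma step_sqr n (V Vc : n.-tuple B * X -> R) c a x xc : 0 <= c -> test_pair V Vc c ->
  (\int[iid mu n.+1]_y ((a.1 * stepf V (y, x) - a.2 * stepc Vc (y, xc)) ^+ 2)%:E <=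
   (3 * c1 * c * ((a.1 - a.2) ^+ 2 + a.2 ^+ 2 * (c2 * q x xc)))%:E)%E.
Proof.
move=> c0 tp; have mV := tp_measf tp; have mVc := tp_measc tp.
pose F (p : n.+1.-tuple B * W) :=
  contrib V Vc (tnth p.1 ord0) [tuple of behead p.1] a (Pf x p.2, Pc xc p.2).
have mF : measurable_fun setT F by apply: meas_contrib => //; cmeas.
have nF : nnm (fun p => (F p ^+ 2)%:E).
  by apply: nnm_EFin => [|p]; [exact: meas_sqr|exact: sqr_ge0].
have bF y : bmeas (fun v => F (y, v)).
  apply: (bmeas_comp (bmeas_contrib (tnth y ord0) [tuple of behead y] a tp)
    (g := fun v => (Pf x v, Pc xc v))); cmeas.
have nF2 : nnm (fun y => \int[gam]_v (F (y, v) ^+ 2)%:E)%E by exact: nnm_int nF.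
apply: (@le_trans _ _ (\int[iid mu n.+1]_y \int[gam]_v (F (y, v) ^+ 2)%:E)%E).
  apply: int_le => //.
    apply: nnm_EFin => [|y]; last exact: sqr_ge0.
    apply: meas_sqr; apply: measurable_funB; apply: measurable_funM => //.
      by apply: (measurableT_comp (meas_stepf mV)); cmeas.
    by apply: (measurableT_comp (meas_stepc mVc)); cmeas.
  move=> y; rewrite -(mean_contrib y a x xc tp) meanE; last exact: bmeas_sqr.
  by rewrite lee_fin; have := mean_sqr_ge gam (bF y).
rewrite [leLHS](int_swap _ _ nF).
have nv : nnm (fun v => (dl (Pf x v) (Pc xc v) + q (endf (Pf x v)) (endc (Pc xc v)))%:E).
  apply: nnm_EFin => [|v]; first by cmeas.
  by apply: addr_ge0 => //; apply: ltW; exact: q_gt0.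
have k0 : 0 <= 3 * c1 * c by rewrite !mulr_ge0.
have a20 : 0 <= 3 * c1 * c * a.2 ^+ 2 by rewrite mulr_ge0// sqr_ge0.
have a10 : 0 <= 3 * c1 * c * (a.1 - a.2) ^+ 2 by rewrite mulr_ge0// sqr_ge0.
apply: (@le_trans _ _ (\int[gam]_v ((3 * c1 * c * (a.1 - a.2) ^+ 2)%:E +
   (3 * c1 * c * a.2 ^+ 2)%:E *
   (dl (Pf x v) (Pc xc v) + q (endf (Pf x v)) (endc (Pc xc v)))%:E))%E).
  apply: int_le.
  - have nF' : nnm (fun p : W * n.+1.-tuple B => (F (p.2, p.1) ^+ 2)%:E).
      apply: (nnm_comp nF); cmeas.
    exact: nnm_int nF'.
  - apply: nnm_add; first exact: nnm_cst.
    by apply: nnm_mul => //; exact: nnm_cst.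
  move=> v; rewrite iidS; last exact: (nnm_pair1 v nF).
  apply: (@le_trans _ _ (\int[mu]_y0 \int[iid mu n]_y
      (contrib V Vc y0 y a (Pf x v, Pc xc v) ^+ 2)%:E)%E).
    rewrite le_eqVlt; apply/orP; left; apply/eqP; apply: eq_integral => y0 _.
    apply: eq_integral => y _; rewrite /F /= tnth0; congr ((contrib _ _ _ _ _ _ ^+ 2)%:E).
    exact: val_inj.
  apply: (le_trans (contrib_sqr a _ c0 tp)).
  rewrite -!(EFinM, EFinD) lee_fin /q_end /=.
  by rewrite le_eqVlt; apply/orP; left; apply/eqP; ring.
rewrite int_add; last 2 first.
- exact: nnm_cst.
- by apply: nnm_mul => //; exact: nnm_cst.
rewrite int_cst int_scale//.
apply: (@le_trans _ _ ((3 * c1 * c * (a.1 - a.2) ^+ 2)%:E +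
   (3 * c1 * c * a.2 ^+ 2)%:E * (c2 * q x xc)%:E)%E).
  by apply: leeD2l; apply: lee_wpmul2l; [rewrite lee_fin|exact: path_gap].
rewrite -!(EFinM, EFinD) lee_fin.
by rewrite le_eqVlt; apply/orP; left; apply/eqP; ring.
Qed.

Let mean_bound (f : W -> R) M : measurable_fun setT f -> (forall v, `|f v| <= M) ->
  `|mean gam f| <= M.
Proof.
move=> mf fM; have bf : bmeas f by split=> //; exists M.
have bM : bmeas (fun _ : W => M) by exact: bmeas_cst.
have h1 : 0 <= mean gam (fun v => M - f v).
  by apply: mean_ge0 => v; have := fM v; rewrite ler_norml => /andP[_]; lra.
have h2 : 0 <= mean gam (fun v => M + f v).
  by apply: mean_ge0 => v; have := fM v; rewrite ler_norml => /andP[]; lra.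
by move: h1 h2; rewrite meanB// meanD// mean_cst ler_norml => h1 h2; apply/andP; split; lra.
Qed.

Lemma test_pair_step n (V Vc : n.-tuple B * X -> R) c : 0 <= c -> test_pair V Vc c ->
  test_pair (stepf V) (stepc Vc) (test_rate * c).
Proof.
move=> c0 tp; have mV := tp_measf tp; have mVc := tp_measc tp.
have cc0 : 0 <= c1 * c by rewrite mulr_ge0.
have ccc0 : 0 <= c2 * (c1 * c) by rewrite mulr_ge0.
split.
- exact: meas_stepf.
- exact: meas_stepc.
- move=> y; have [M1 h1] := tp_bndf tp [tuple of behead y].
  have [M3 h3] := Gf_bounded (tnth y ord0); exists (M3 * M1) => x.
  apply: mean_bound => [|v].
    apply: measurable_funM; first by cmeas.
    by apply: (measurableT_comp mV); cmeas.
  by rewrite normrM; apply: ler_pM => //; rewrite gtr0_norm.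
- move=> y; have [M1 h1] := tp_bndc tp [tuple of behead y].
  have [M3 h3] := Gc_bounded (tnth y ord0); exists (M3 * M1) => x.
  apply: mean_bound => [|v].
    apply: measurable_funM; first by cmeas.
    by apply: (measurableT_comp mVc); cmeas.
  by rewrite normrM; apply: ler_pM => //; rewrite gtr0_norm.
- move=> x; have := step_sqr (1, 0) x x c0 tp; rewrite /= => h.
  apply: le_trans (le_trans h _).
    rewrite le_eqVlt; apply/orP; left; apply/eqP; apply: eq_integral => y _.
    by rewrite mul1r mul0r subr0.
  by rewrite lee_fin expr0n /= mul0r addr0 subr0 expr1n mulr1 /test_rate; lra.
- move=> x; have := step_sqr (0, 1) x x c0 tp; rewrite /= => h.
  apply: le_trans (le_trans h _).
    rewrite le_eqVlt; apply/orP; left; apply/eqP; apply: eq_integral => y _.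
    by rewrite mul1r mul0r sub0r sqrrN.
  rewrite lee_fin sub0r sqrrN expr1n mul1r /test_rate.
  have := ler_wpM2l ccc0 (q2 x x); lra.
- move=> x xc; have := step_sqr (1, 1) x xc c0 tp; rewrite /= => h.
  apply: le_trans (le_trans h _).
    by rewrite le_eqVlt; apply/orP; left; apply/eqP; apply: eq_integral => y _; rewrite !mul1r.
  rewrite lee_fin subrr expr0n /= add0r expr1n mul1r /test_rate.
  have q0 := ltW (q_gt0 x xc).
  have := mulr_ge0 cc0 q0; have := mulr_ge0 ccc0 q0; lra.
Qed.

Definition estimate n (V Vc : n.-tuple B * X -> R) (y : n.+1.-tuple B)
    (s : (R * R) * N.-tuple E) : R :=
  avg (fun i => contrib V Vc (tnth y ord0) [tuple of behead y] s.1 (tnth s.2 i)).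

Definition estimate_sqr n (V Vc : n.-tuple B * X -> R) (s : (R * R) * N.-tuple E) : \bar R :=
  (\int[iid mu n.+1]_y (estimate V Vc y s ^+ 2)%:E)%E.

Lemma meas_estimate n (V Vc : n.-tuple B * X -> R) d (T : measurableType d)
    (y : T -> n.+1.-tuple B) (s : T -> (R * R) * N.-tuple E) :
  measurable_fun setT V -> measurable_fun setT Vc ->
  measurable_fun setT y -> measurable_fun setT s ->
  measurable_fun setT (fun t => estimate V Vc (y t) (s t)).
Proof.
by move=> mV mVc my ms; apply: meas_avg => i; apply: meas_contrib => //; cmeas.
Qed.

Lemma nnm_estimate n (V Vc : n.-tuple B * X -> R) d (T : measurableType d)
    (y : T -> n.+1.-tuple B) (s : T -> (R * R) * N.-tuple E) :
  measurable_fun setT V -> measurable_fun setT Vc ->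
  measurable_fun setT y -> measurable_fun setT s ->
  nnm (fun t => (estimate V Vc (y t) (s t) ^+ 2)%:E).
Proof.
move=> mV mVc my ms; apply: nnm_EFin => [|t]; last exact: sqr_ge0.
by apply: meas_sqr; exact: meas_estimate.
Qed.

Lemma nnm_estimate_sqr n (V Vc : n.-tuple B * X -> R) :
  measurable_fun setT V -> measurable_fun setT Vc -> nnm (estimate_sqr V Vc).
Proof.
move=> mV mVc.
apply: (nnm_int (iid mu n.+1) (f := fun p => (estimate V Vc p.2 p.1 ^+ 2)%:E)).
by apply: nnm_estimate => //; cmeas.
Qed.

(** Unbiasedness of selection: the marginals of the maximal coupling are the two weights, and their
    denominators cancel against the new normalizing constants in [updcpf]. The dependence between
    the two indices disappears by linearity. *)
Lemma mean_kap_contrib n (V Vc : n.-tuple B * X -> R) c y0 (y : n.+1.-tuple B) a u :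
  test_pair V Vc c ->
  mean (kap (y0, u)) (contrib V Vc (tnth y ord0) [tuple of behead y] (updcpf a y0 u)) =
  avg (fun i => contrib (stepf V) (stepc Vc) y0 y a (tnth u i)).
Proof.
move=> tp; set a' := updcpf a y0 u.
rewrite mean_kmix; last exact: (bmeas_contrib _ _ _ tp).
pose A i := stepf V (y, endf (tnth u i).1); pose C i := stepc Vc (y, endc (tnth u i).2).
transitivity (\sum_(ab : 'I_N * 'I_N) (sel ab (y0, u) * (a'.1 * A ab.1)
    - sel ab (y0, u) * (a'.2 * C ab.2))).
  by apply: eq_bigr => ab _; rewrite -mulrBr -(mean_contrib _ _ _ _ tp).
rewrite sumrB -(pair_bigA _ (fun i j => sel (i, j) (y0, u) * (a'.1 * A i))) /=.
rewrite -(pair_bigA _ (fun i j => sel (i, j) (y0, u) * (a'.2 * C j))) /=.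
have e1 : \sum_i \sum_j sel (i, j) (y0, u) * (a'.1 * A i) =
    N%:R^-1 * \sum_i a.1 * (Gf y0 (tnth u i).1 * A i).
  rewrite mulr_sumr; apply: eq_bigr => i _; rewrite -mulr_suml.
  rewrite /sel (maximal_coupling_fst (fine_weight_ge0 _) (coarse_weight_ge0 _)
    (fine_weight_sum _) (coarse_weight_sum _)).
  rewrite /fine_weight /a' /updcpf /avg /=; field.
  by rewrite gt_eqF ?ltr0n// gt_eqF// sum_gt0.
have e2 : \sum_i \sum_j sel (i, j) (y0, u) * (a'.2 * C j) =
    N%:R^-1 * \sum_i a.2 * (Gc y0 (tnth u i).2 * C i).
  rewrite exchange_big mulr_sumr /=; apply: eq_bigr => i _; rewrite -mulr_suml.
  rewrite /sel (maximal_coupling_snd (fine_weight_ge0 _) (coarse_weight_ge0 _)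
    (fine_weight_sum _) (coarse_weight_sum _)).
  rewrite /coarse_weight /a' /updcpf /avg /=; field.
  by rewrite gt_eqF ?ltr0n// gt_eqF// sum_gt0.
by rewrite e1 e2 -mulrBr -sumrB.
Qed.

Let iid_contrib_sqr n (V Vc : n.-tuple B * X -> R) c (k : probability E R) a :
  0 <= c -> test_pair V Vc c ->
  (\int[iid k N]_u estimate_sqr V Vc (a, u) <=
   (N%:R^-1)%:E * ((6 * c1 * c)%:E * (((a.1 - a.2) ^+ 2)%:E
      + (a.1 ^+ 2 + a.2 ^+ 2)%:E * \int[k]_e (Th e)%:E)) +
   \int[iid mu n.+1]_y (mean k (contrib V Vc (tnth y ord0) [tuple of behead y] a) ^+ 2)%:E)%E.
Proof.
move=> c0 tp; have mV := tp_measf tp; have mVc := tp_measc tp.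
have ni0 : 0 <= N%:R^-1 :> R by rewrite invr_ge0.
pose f y e := contrib V Vc (tnth y ord0) [tuple of behead y] a e.
have nf : nnm (fun p : n.+1.-tuple B * E => (f p.1 p.2 ^+ 2)%:E).
  apply: nnm_EFin => [|p]; last exact: sqr_ge0.
  by apply: meas_sqr; apply: meas_contrib => //; cmeas.
have nE : nnm (fun p : N.-tuple E * n.+1.-tuple B => (estimate V Vc p.2 (a, p.1) ^+ 2)%:E).
  by apply: nnm_estimate => //; cmeas.
have n1 : nnm (fun y => \int[k]_e (f y e ^+ 2)%:E)%E by exact: (nnm_int k nf).
have n2 : nnm (fun y => (mean k (f y) ^+ 2)%:E).
  apply: nnm_EFin => [|y]; last exact: sqr_ge0.
  have mf : measurable_fun setT (fun p : n.+1.-tuple B * E => f p.1 p.2).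
    by apply: meas_contrib => //; cmeas.
  apply: meas_sqr; rewrite /mean.
  have mE : measurable_fun setT (EFin \o (fun p : n.+1.-tuple B * E => f p.1 p.2)).
    exact/measurable_EFinP.
  have np : nnm ((EFin \o (fun p : n.+1.-tuple B * E => f p.1 p.2))^\+)%E.
    by split=> [|x]; [exact: measurable_funepos|exact: funepos_ge0].
  have nn : nnm ((EFin \o (fun p : n.+1.-tuple B * E => f p.1 p.2))^\-)%E.
    by split=> [|x]; [exact: measurable_funeneg|exact: funeneg_ge0].
  apply: (measurableT_comp (fine_measurable measurableT)).
  under eq_fun do rewrite integralE.
  apply: emeasurable_funB.
    have [+ _] := nnm_int k np; congr measurable_fun; apply/funext => s.
    by apply: eq_integral => v _; rewrite !funeposE.
  have [+ _] := nnm_int k nn; congr measurable_fun; apply/funext => s.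
  by apply: eq_integral => v _; rewrite !funenegE.
rewrite /estimate_sqr (int_swap _ _ nE).
apply: (@le_trans _ _ (\int[iid mu n.+1]_y ((N%:R^-1)%:E * \int[k]_e (f y e ^+ 2)%:E +
    (mean k (f y) ^+ 2)%:E))%E).
  apply: int_le.
  - have nE' : nnm (fun p : n.+1.-tuple B * N.-tuple E => (estimate V Vc p.1 (a, p.2) ^+ 2)%:E).
      by apply: nnm_estimate => //; cmeas.
    exact: nnm_int nE'.
  - by apply: nnm_add => //; apply: nnm_mul => //; apply: nnm_cst; rewrite lee_fin.
  move=> y; have bf := bmeas_contrib (tnth y ord0) [tuple of behead y] a tp.
  have bf2 := bmeas_sqr bf; rewrite /f (meanE _ bf2).
  by rewrite -EFinM -EFinD; exact: iid_mean_sqr.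
rewrite int_add//; last by apply: nnm_mul => //; apply: nnm_cst; rewrite lee_fin.
apply: leeD2r; rewrite int_scale//; apply: lee_wpmul2l; first by rewrite lee_fin.
rewrite (int_swap _ _ nf).
have a0 : 0 <= a.1 ^+ 2 + a.2 ^+ 2 by rewrite addr_ge0 ?sqr_ge0.
have k0 : 0 <= 6 * c1 * c by rewrite !mulr_ge0.
have nc : nnm (fun e => (((a.1 - a.2) ^+ 2)%:E + (a.1 ^+ 2 + a.2 ^+ 2)%:E * (Th e)%:E)%E).
  apply: nnm_add; first by apply: nnm_cst; rewrite lee_fin sqr_ge0.
  by apply: nnm_mul; [exact: nnm_cst|exact: nnm_Th].
apply: (@le_trans _ _ (\int[k]_e ((6 * c1 * c)%:E * (((a.1 - a.2) ^+ 2)%:E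
      + (a.1 ^+ 2 + a.2 ^+ 2)%:E * (Th e)%:E)))%E).
  apply: int_le.
  - have nf' : nnm (fun p : E * n.+1.-tuple B => (f p.2 p.1 ^+ 2)%:E).
      apply: nnm_EFin => [|p]; last exact: sqr_ge0.
      by apply: meas_sqr; apply: meas_contrib => //; cmeas.
    exact: nnm_int nf'.
  - by apply: nnm_mul => //; exact: nnm_cst.
  by move=> e; exact: (contrib_sqr_lyap a e c0 tp).
rewrite int_scale//; apply: lee_wpmul2l => //.
rewrite int_add; [|by apply: nnm_cst; rewrite lee_fin sqr_ge0|]; last first.
  by apply: nnm_mul; [exact: nnm_cst|exact: nnm_Th].
by rewrite int_cst int_scale//; exact: nnm_Th.
Qed.

(* Bias and variance of the next round given the current one: the conditional
   mean of the estimate is the estimate for the test pair moved one step back. *)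
Lemma transition_estimate n (V Vc : n.-tuple B * X -> R) c s :
  0 <= c -> test_pair V Vc c ->
  (Tr (estimate_sqr V Vc) s <= (N%:R^-1 * (6 * c1 * c))%:E * Tr (fun s => (lyap s)%:E) s +
    estimate_sqr (stepf V) (stepc Vc) s)%E.
Proof.
move=> c0 tp; have mV := tp_measf tp; have mVc := tp_measc tp.
have mS := meas_stepf mV; have mSc := meas_stepc mVc.
have nl := nnm_transition_s meas_updcpf meas_kap s nnm_lyap.
have ne := nnm_transition_s meas_updcpf meas_kap s (nnm_estimate_sqr mV mVc).
have k0 : 0 <= N%:R^-1 * (6 * c1 * c) by rewrite !mulr_ge0// invr_ge0.
have nS : nnm (fun p : B * n.+1.-tuple B =>
    (avg (fun i => contrib (stepf V) (stepc Vc) p.1 p.2 s.1 (tnth s.2 i)) ^+ 2)%:E).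
  apply: nnm_EFin => [|p]; last exact: sqr_ge0.
  by apply: meas_sqr; apply: meas_avg => i; apply: meas_contrib => //; cmeas.
have nS2 := nnm_int (iid mu n.+1) nS.
have -> : estimate_sqr (stepf V) (stepc Vc) s = (\int[mu]_y0 \int[iid mu n.+1]_y
    (avg (fun i => contrib (stepf V) (stepc Vc) y0 y s.1 (tnth s.2 i)) ^+ 2)%:E)%E.
  rewrite /estimate_sqr iidS; last by apply: nnm_estimate => //; cmeas.
  apply: eq_integral => y0 _; apply: eq_integral => y _; congr ((_ ^+ 2)%:E).
  rewrite /estimate; congr avg; apply/funext => i; rewrite tnth0.
  by congr contrib; exact: val_inj.
rewrite /transition -int_scale//.
apply: (@le_trans _ _ (\int[mu]_y0 ((N%:R^-1 * (6 * c1 * c))%:E *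
    (\int[iid (kap (y0, s.2)) N]_u (lyap (updcpf s.1 y0 s.2, u))%:E) +
    \int[iid mu n.+1]_y
    (avg (fun i => contrib (stepf V) (stepc Vc) y0 y s.1 (tnth s.2 i)) ^+ 2)%:E))%E); last first.
  rewrite int_add//; apply: nnm_mul => //; exact: nnm_cst.
apply: int_le => //.
  by apply: nnm_add => //; apply: nnm_mul => //; exact: nnm_cst.
move=> y0; apply: (le_trans (iid_contrib_sqr (kap (y0, s.2)) (updcpf s.1 y0 s.2) c0 tp)).
rewrite lyap_upd EFinM muleA; apply: leeD2l.
rewrite le_eqVlt; apply/orP; left; apply/eqP; apply: eq_integral => y _.
by rewrite (mean_kap_contrib y0 y s.1 s.2 tp).
Qed.

(** Each round contributes its variance, [6 * c1] times the bound [2 * (1 + c2) * growth ^+ p] of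
    [chain_lyap]; the remaining error is the same problem one round earlier, with the test pair
    worsened by [test_rate]. The summand [test_rate] of the base case is the bias. *)
Fixpoint estimate_cst (p : nat) : R :=
  match p with
  | 0 => 12 * c1 * (1 + c2) + test_rate
  | p.+1 => 12 * c1 * (1 + c2) * growth ^+ p.+1 + estimate_cst p * test_rate
  end.

Lemma estimate_cst_ge0 p : 0 <= estimate_cst p.
Proof.
have k0 : 0 <= 12 * c1 * (1 + c2) by rewrite !mulr_ge0// addr_ge0.
elim: p => [|p IH] /=; first by rewrite addr_ge0// test_rate_ge0.
by rewrite addr_ge0// mulr_ge0// ?test_rate_ge0// exprn_ge0// growth_ge0.
Qed.

(** The last round is peeled off by [transition_estimate]: its variance costs [sqrt D / N], and its
    conditional mean is the estimate for the stepped test pair. The bias shows up only in the first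
    round. *)
Lemma chain_estimate p n (V Vc : n.-tuple B * X -> R) c : 0 <= c -> test_pair V Vc c ->
  (Ch p (estimate_sqr V Vc) <=
   (estimate_cst p * c * (Num.sqrt D / N%:R + D))%:E)%E.
Proof.
have r0 : 0 <= Num.sqrt D / N%:R by rewrite divr_ge0// sqrtr_ge0.
have DD0 := ltW D0.
elim: p n V Vc c => [|p IH] n V Vc c c0 tp;
    have mV := tp_measf tp; have mVc := tp_measc tp;
    have tp' := test_pair_step c0 tp; have tc0 : 0 <= test_rate * c
      by [rewrite mulr_ge0// test_rate_ge0].
  apply: (le_trans (iid_contrib_sqr kinit (1, 1) c0 tp)) => /=.
  have h1 : (\int[kinit]_e (Th e)%:E <= ((1 + c2) * Num.sqrt D)%:E)%E.
    rewrite kinitE; last exact: nnm_Th.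
    by have := Th_path xs xs; rewrite /lam qxx.
  (* The bias: both components start at [xs], so the mean is the gap of the stepped test pair at
     equal points, where [q xs xs = D]. *)
  have h2 : (\int[iid mu n.+1]_y (mean kinit
      (contrib V Vc (tnth y ord0) [tuple of behead y] (1, 1)) ^+ 2)%:E <=
      (test_rate * c * D)%:E)%E.
    apply: le_trans (_ : _ <= (test_rate * c * q xs xs)%:E)%E _; last by rewrite qxx.
    apply: le_trans (tp_gap tp' xs xs).
    rewrite le_eqVlt; apply/orP; left; apply/eqP; apply: eq_integral => y _.
    congr ((_ ^+ 2)%:E).
    have bf := bmeas_contrib (tnth y ord0) [tuple of behead y] (1, 1) tp.
    transitivity (mean gam (fun v => contrib V Vc (tnth y ord0) [tuple of behead y] (1, 1)
        (Pf xs v, Pc xs v))).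
      (* [kinitE] needs a nonnegative integrand, hence the shift by [M]. *)
      have [mf [M fM]] := bf.
      pose f' e := contrib V Vc (tnth y ord0) [tuple of behead y] (1, 1) e + M.
      have bM : bmeas (fun _ : E => M) by exact: bmeas_cst.
      have bf' : bmeas f' by exact: bmeasD.
      have f'0 e : 0 <= f' e by have := fM e; rewrite ler_norml => /andP[]; rewrite /f'; lra.
      have bc := bmeas_comp bf meas_start.
      have bc' := bmeas_comp bf' meas_start.
      have : mean kinit f' = mean gam (fun v => f' (Pf xs v, Pc xs v)).
        apply: EFin_inj; rewrite -meanE// -meanE//.
        by apply: kinitE; exact: nnm_bmeas.
      rewrite /f' (meanD kinit bf bM) (meanD gam bc (bmeas_cst W M)).
      by rewrite !mean_cst => /addIr.
    by rewrite (mean_contrib y (1, 1) xs xs tp) /= !mul1r.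
  apply: (@le_trans _ _ ((N%:R^-1)%:E * ((6 * c1 * c)%:E * (((1 - 1) ^+ 2)%:E +
      (1 ^+ 2 + 1 ^+ 2)%:E * ((1 + c2) * Num.sqrt D)%:E)) + (test_rate * c * D)%:E)%E).
    apply: leeD => //; apply: lee_wpmul2l; first by rewrite lee_fin invr_ge0.
    apply: lee_wpmul2l; first by rewrite lee_fin !mulr_ge0.
    apply: leeD2l; apply: lee_wpmul2l; last exact: h1.
    by rewrite lee_fin addr_ge0// expr1n.
  rewrite -!(EFinM, EFinD) lee_fin.
  have -> : N%:R^-1 * (6 * c1 * c * ((1 - 1) ^+ 2 + (1 ^+ 2 + 1 ^+ 2) * ((1 + c2) * Num.sqrt D)))
      = 12 * c1 * (1 + c2) * c * (Num.sqrt D / N%:R) by ring.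
  have k0 : 0 <= 12 * c1 * (1 + c2) * c by rewrite !mulr_ge0// addr_ge0.
  have h3 := mulr_ge0 tc0 r0; have h4 := mulr_ge0 k0 DD0.
  by rewrite mulrDl; lra.
rewrite /=; apply: (@le_trans _ _ (Ch p (fun s => ((N%:R^-1 * (6 * c1 * c))%:E *
    Tr (fun s => (lyap s)%:E) s + estimate_sqr (stepf V) (stepc Vc) s)%E))).
  have k0 : 0 <= N%:R^-1 * (6 * c1 * c) by rewrite !mulr_ge0// invr_ge0.
  have nl := nnm_transition mu meas_updcpf meas_kap nnm_lyap.
  have nst := nnm_estimate_sqr (meas_stepf mV) (meas_stepc mVc).
  apply: (chain_le _ _ _ meas_updcpf meas_kap).
  - exact: (nnm_transition _ meas_updcpf meas_kap (nnm_estimate_sqr mV mVc)).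
  - by apply: nnm_add => //; apply: nnm_mul => //; exact: nnm_cst.
  - by move=> s; exact: (transition_estimate s c0 tp).
have k0 : 0 <= N%:R^-1 * (6 * c1 * c) by rewrite !mulr_ge0// invr_ge0.
have nl := nnm_transition mu meas_updcpf meas_kap nnm_lyap.
have nst := nnm_estimate_sqr (meas_stepf mV) (meas_stepc mVc).
have nkl : nnm (fun s => ((N%:R^-1 * (6 * c1 * c))%:E * Tr (fun s => (lyap s)%:E) s)%E).
  by apply: nnm_mul => //; exact: nnm_cst.
rewrite (chain_add _ _ _ meas_updcpf meas_kap p nkl nst).
rewrite (chain_scale _ _ _ meas_updcpf meas_kap p nl k0).
apply: (@le_trans _ _ ((N%:R^-1 * (6 * c1 * c))%:E *
    (2 * (1 + c2) * Num.sqrt D * growth ^+ p.+1)%:E +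
    (estimate_cst p * (test_rate * c) * (Num.sqrt D / N%:R + D))%:E)%E).
  apply: leeD; last exact: (IH _ _ _ _ tc0 tp').
  by apply: lee_wpmul2l; [rewrite lee_fin|exact: (chain_lyap p.+1)].
rewrite -!(EFinM, EFinD) lee_fin /=.
have -> : N%:R^-1 * (6 * c1 * c) * (2 * (1 + c2) * Num.sqrt D * growth ^+ p.+1) =
    12 * c1 * (1 + c2) * growth ^+ p.+1 * c * (Num.sqrt D / N%:R) by ring.
have g0 : 0 <= growth ^+ p.+1 by rewrite exprn_ge0// growth_ge0.
have k1 : 0 <= 12 * c1 * (1 + c2) * growth ^+ p.+1 * c by rewrite !mulr_ge0// addr_ge0.
have h4 := mulr_ge0 k1 DD0.
set G := growth ^+ p.+1 in g0 k1 h4 *; set S := Num.sqrt D / N%:R in r0 *.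
by rewrite 2!mulrDl; lra.
Qed.

End coupled_particles.

(** * The filters at a fixed level *)

Section sequences_of_steps.
Context {R : realType} (dx : nat).
Local Notation vec := (dx.-tuple R).
Implicit Types (x : vec) (v : seq vec).

(** List form of [coarsen], recursing two increments at a time like [path_cost]. *)
Fixpoint pairs v : seq vec :=
  if v is v1 :: v2 :: v' then addv v1 v2 :: pairs v' else [::].

Lemma size_pairs v n : size v = n.*2 -> size (pairs v) = n.
Proof.
elim: n v => [|n IH] [|v1 [|v2 v]] //= [sv].
by rewrite (IH _ sv).
Qed.

Lemma nth_pairs x0 v n k : size v = n.*2 -> (k < n)%N ->
  nth x0 (pairs v) k = addv (nth x0 v k.*2) (nth x0 v k.*2.+1).
Proof.
elim: n v k => [//|n IH] [|v1 [|v2 v]] // k [sv]; case: k => [//|k].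
by rewrite ltnS /= => kn; rewrite (IH _ _ sv kn).
Qed.

Lemma coarsenE l (v : (2 ^ l.+1).-tuple vec) : tval (coarsen v) = pairs v.
Proof.
have sv : size v = (2 ^ l).*2 by rewrite size_tuple expnS mul2n.
pose x0 : vec := [tuple 0 | _ < dx].
apply: (@eq_from_nth _ x0); first by rewrite size_tuple (size_pairs sv).
move=> k; rewrite size_tuple => kl; rewrite (nth_pairs x0 sv kl).
by rewrite -(tnth_nth x0 (coarsen v) (Ordinal kl)) tnth_mktuple.
Qed.

End sequences_of_steps.

Section euler_paths.
Context {R : realType} (dx : nat) (b : dx.-tuple R -> dx.-tuple R)
  (sigma : dx.-tuple R -> 'M[R]_dx) (K : R).
Local Notation vec := (dx.-tuple R).
Hypothesis reg : euler_regular b sigma K.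

Definition euler_seq l (x : vec) (v : seq vec) : seq vec :=
  x :: scanl (euler_step b sigma l) x v.

Lemma meas_nth d (T : measurableType d) d' (S : measurableType d') (x0 : S) n
    (f : T -> n.-tuple S) k : measurable_fun setT f ->
  measurable_fun setT (fun t => nth x0 (f t) k).
Proof.
move=> mf; have [kn|nk] := ltnP k n.
  by under eq_fun do rewrite -(tnth_nth x0 (f _) (Ordinal kn)); exact: meas_tnth.
under eq_fun do rewrite nth_default ?size_tuple//; exact: measurable_cst.
Qed.

Lemma measurable_tuple d (T : measurableType d) d' (S : measurableType d') n
    (f : T -> n.-tuple S) :
  (forall i, measurable_fun setT (fun t => tnth (f t) i)) -> measurable_fun setT f.
Proof. by move=> mf; exact/measurable_fun_tnthP. Qed.

Lemma meas_euler_step l d (T : measurableType d) (f g : T -> vec) :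
  measurable_fun setT f -> measurable_fun setT g ->
  measurable_fun setT (fun t => euler_step b sigma l (f t) (g t)).
Proof. by case: reg => _ [mb ms]; exact: measurable_euler_step. Qed.

Lemma meas_euler_seq l n (x0 : vec) d (T : measurableType d) (X : T -> vec)
    (V : T -> n.-tuple vec) k :
  measurable_fun setT X -> measurable_fun setT V ->
  measurable_fun setT (fun t => nth x0 (euler_seq l (X t) (V t)) k).
Proof.
elim: n X V k => [|n IH] X V [|k] mX mV //=.
  by under eq_fun do rewrite (tuple0 (V _)) nth_nil; exact: measurable_cst.
have e t : scanl (euler_step b sigma l) (X t) (V t) =
    euler_seq l (euler_step b sigma l (X t) (thead (V t))) [tuple of behead (V t)].
  by rewrite [in LHS](tuple_eta (V t)).
under eq_fun do rewrite e; apply: IH; last exact: meas_behead.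
by apply: meas_euler_step => //; exact: meas_tnth.
Qed.

Lemma meas_euler_path l d (T : measurableType d) (X : T -> vec)
    (V : T -> (2 ^ l).-tuple vec) :
  measurable_fun setT X -> measurable_fun setT V ->
  measurable_fun setT (fun t => euler_path b sigma (X t) (V t)).
Proof.
move=> mX mV; apply: measurable_tuple => i.
under eq_fun do rewrite (tnth_nth [tuple 0 | _ < dx]).
exact: meas_euler_seq.
Qed.

Lemma meas_coarsen l d (T : measurableType d) (V : T -> (2 ^ l.+1).-tuple vec) :
  measurable_fun setT V -> measurable_fun setT (fun t => coarsen (V t)).
Proof.
move=> mV; apply: measurable_tuple => k.
under eq_fun do rewrite tnth_mktuple.
apply: measurable_tuple => i; under eq_fun do rewrite tnth_mktuple.
by apply: measurable_funD; apply: meas_tnth; exact: meas_nth.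
Qed.

Lemma path_costE l n (x0 : vec) (v : seq vec) x xc : size v = n.*2 ->
  path_cost b sigma l v x xc =
  delta R l.+1 * \sum_(k < n.*2) d2 (nth x0 (euler_seq l.+1 x v) k)
                   (nth x0 (euler_seq l xc (pairs v)) k./2) +
  d2 (nth x0 (euler_seq l.+1 x v) n.*2) (nth x0 (euler_seq l xc (pairs v)) n).
Proof.
elim: n v x xc => [|n IH] [|v1 [|v2 v]] //= x xc; first by rewrite big_ord0 mulr0 add0r.
move=> [sv]; rewrite (IH _ _ _ sv) !big_ord_recl /=.
set S := \sum_(i < n.*2) _; set S' := (X in d2 x xc + (_ + X)).
have -> : S' = S by apply: eq_bigr.
by ring.
Qed.

End euler_paths.

Section likelihood_bounds.
Context {R : realType} (m n : nat) (D : R).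

Lemma meas_lik d (T : measurableType d) (a : T -> 'I_m -> 'I_n -> R)
    (y : T -> m.-tuple (n.-tuple R)) :
  (forall k i, measurable_fun setT (fun t => a t k i)) -> measurable_fun setT y ->
  measurable_fun setT (fun t => lik D (a t) (y t)).
Proof.
move=> ma my; apply: measurable_expR_comp; apply: meas_sum => k.
apply: measurable_funB; first by apply: meas_sum => i; meas.
by apply: measurable_funM; [meas|apply: meas_sum => i; meas].
Qed.

(** The bound depends on the data and enters no constant; it only makes the conditional means given
    the data well defined. *)
Lemma lik_bounded (H : R) (y : m.-tuple (n.-tuple R)) : 0 <= D ->
  exists M, forall a : 'I_m -> 'I_n -> R,
    (forall k i, `|a k i| <= H) -> lik D a y <= M.
Proof.
move=> D0; exists (expR (\sum_k \sum_i H * `|tnth (tnth y k) i|)) => a aH.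
rewrite ler_expR; apply: ler_sum => k _.
have s0 : 0 <= D / 2 * \sum_i a k i ^+ 2.
  by rewrite mulr_ge0 ?divr_ge0//; apply: sumr_ge0 => i _; exact: sqr_ge0.
apply: (@le_trans _ _ (\sum_i a k i * tnth (tnth y k) i)); first by rewrite gerBl.
apply: ler_sum => i _; apply: (le_trans (ler_norm _)); rewrite normrM.
exact: ler_wpM2r.
Qed.

End likelihood_bounds.

Section observed_paths.
Context {R : realType} (dx dy : nat) (h : dx.-tuple R -> dy.-tuple R) (H K : R).
Local Notation vec := (dx.-tuple R).
Hypothesis mh : forall i, measurable_fun setT (fun x => tnth (h x) i).
Hypothesis hH : forall x i, `|tnth (h x) i| <= H.
Hypothesis hK : forall x y i, (tnth (h x) i - tnth (h y) i) ^+ 2 <= K * d2 x y.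

Definition obs l (u : level_path R dx l) (k : 'I_(2 ^ l)) (i : 'I_dy) : R :=
  tnth (h (tnth u (widen_ord (leqnSn _) k))) i.

Definition origin : vec := [tuple 0 | _ < dx].

(* A coarse state is observed on two consecutive fine time steps. *)
Definition obs2 l (u : level_path R dx l) (k : 'I_(2 ^ l.+1)) (i : 'I_dy) : R :=
  tnth (h (nth origin u k./2)) i.

Lemma meas_obs l d (T : measurableType d) (u : T -> level_path R dx l) k i :
  measurable_fun setT u -> measurable_fun setT (fun t => obs (u t) k i).
Proof.
move=> mu; apply: (measurableT_comp (mh i)).
by apply: meas_tnth.
Qed.

Lemma meas_obs2 l d (T : measurableType d) (u : T -> level_path R dx l) k i :
  measurable_fun setT u -> measurable_fun setT (fun t => obs2 (u t) k i).
Proof.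
by move=> mu; apply: (measurableT_comp (mh i)); exact: meas_nth.
Qed.

Lemma obs_sqdist l (u : level_path R dx l.+1) (uc : level_path R dx l) :
  sqdist (delta R l.+1) (obs u) (obs2 uc) <=
  dy%:R * K * (delta R l.+1 *
    \sum_(k < 2 ^ l.+1) d2 (nth origin u k) (nth origin uc k./2)).
Proof.
rewrite /sqdist mulrCA; apply: ler_wpM2l; first exact: ltW (delta_gt0 _).
rewrite mulr_sumr; apply: ler_sum => k _.
rewrite -mulrA mulr_natl -[dy in leRHS]card_ord -sumr_const; apply: ler_sum => i _.
by rewrite /obs /obs2 (tnth_nth origin); exact: hK.
Qed.

Lemma obs_sqdist_le l (u : level_path R dx l.+1) (uc : level_path R dx l) :
  sqdist (delta R l.+1) (obs u) (obs2 uc) <= dy%:R * (4 * H ^+ 2).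
Proof.
have D0 : 0 < delta R l.+1 by exact: delta_gt0.
have nD : delta R l.+1 * (2 ^ l.+1)%:R = 1 by rewrite natrX /delta mulVf// expf_neq0.
apply: (@le_trans _ _ (delta R l.+1 * \sum_(k < 2 ^ l.+1) dy%:R * (4 * H ^+ 2))).
  apply: ler_wpM2l; first exact: ltW.
  apply: ler_sum => k _; rewrite mulr_natl -[dy in leRHS]card_ord -sumr_const.
  apply: ler_sum => i _; have h1 := hH (tnth u (widen_ord (leqnSn _) k)) i.
  have h2 := hH (nth origin uc k./2) i; rewrite -/(obs u k i) -/(obs2 uc k i) in h1 h2 *.
  move: h1 h2; rewrite !ler_norml => /andP[h1 h2] /andP[h3 h4].
  by rewrite -subr_ge0; nra.
by rewrite sumr_const card_ord -[(_ * _) *+ _]mulr_natl mulrA nD mul1r.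
Qed.

End observed_paths.

Section level_estimate.
Context {R : realType} (dx dy : nat) (b : dx.-tuple R -> dx.-tuple R)
  (sigma : dx.-tuple R -> 'M[R]_dx) (h : dx.-tuple R -> dy.-tuple R) (K H Kh : R).
Local Notation vec := (dx.-tuple R).
Hypothesis reg : euler_regular b sigma K.
Hypothesis mh : forall i, measurable_fun setT (fun x => tnth (h x) i).
Hypothesis hH : forall x i, `|tnth (h x) i| <= H.
Hypothesis hK : forall x y i, (tnth (h x) i - tnth (h y) i) ^+ 2 <= Kh * d2 x y.
Hypothesis Kh0 : 0 <= Kh.

Definition block_lik l (y : (2 ^ l).-tuple (dy.-tuple R)) (u : level_path R dx l) : R :=
  lik (delta R l) (obs h u) y.
Definition block_lik2 l (y : (2 ^ l.+1).-tuple (dy.-tuple R)) (u : level_path R dx l) : R :=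
  lik (delta R l.+1) (obs2 h u) y.
Definition noise l : probability ((2 ^ l).-tuple vec) R :=
  iid (gvec dx (Num.sqrt (delta R l))) (2 ^ l).
Definition blocks l := gblock (2 ^ l) dy (delta R l).
Definition coarse_euler l (x : vec) (v : (2 ^ l.+1).-tuple vec) : level_path R dx l :=
  euler_path b sigma x (coarsen v).
Definition start l (u : level_path R dx l) : vec := tnth u ord0.
(* Truncated, for a bounded cost of decoupled pairs, and shifted, so that it never
   falls below the discretization error of one step. *)
Definition trunc_dist l (x y : vec) : R := Num.min 1 (d2 x y) + delta R l.
Definition level_dist l (u : level_path R dx l.+1) (uc : level_path R dx l) : R :=
  sqdist (delta R l.+1) (obs h u) (obs2 h uc).

(** The first summand serves pairs at distance at most one, the second bounds the observation gap of
    distant pairs, and [3] covers the truncated end distance in both cases. *)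
Definition path_cst : R := (1 + dy%:R * Kh) * coupling_cst dx K + dy%:R * (4 * H ^+ 2) + 3.

Lemma path_cst_ge0 : 0 <= path_cst.
Proof.
have [[K0 _ _ _ _] _] := reg.
have k0 : 0 <= dy%:R * Kh by rewrite mulr_ge0.
have h1 : 0 <= dy%:R * (4 * H ^+ 2) by rewrite mulr_ge0// mulr_ge0// sqr_ge0.
have := mulr_ge0 (addr_ge0 ler01 k0) (coupling_cst_ge0 reg); rewrite /path_cst; lra.
Qed.

Lemma meas_endpoint l d (T : measurableType d) (f : T -> level_path R dx l) :
  measurable_fun setT f -> measurable_fun setT (fun t => endpoint (f t)).
Proof. by move=> mf; exact: (meas_tnth _ mf). Qed.

Lemma meas_start_point l d (T : measurableType d) (f : T -> level_path R dx l) :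
  measurable_fun setT f -> measurable_fun setT (fun t => start (f t)).
Proof. by move=> mf; exact: (meas_tnth _ mf). Qed.

Lemma meas_block_lik l d (T : measurableType d)
    (y : T -> (2 ^ l).-tuple (dy.-tuple R)) (u : T -> level_path R dx l) :
  measurable_fun setT y -> measurable_fun setT u ->
  measurable_fun setT (fun t => block_lik (y t) (u t)).
Proof. by move=> my mu; apply: meas_lik => // k i; exact: meas_obs. Qed.

Lemma meas_block_lik2 l d (T : measurableType d)
    (y : T -> (2 ^ l.+1).-tuple (dy.-tuple R)) (u : T -> level_path R dx l) :
  measurable_fun setT y -> measurable_fun setT u ->
  measurable_fun setT (fun t => block_lik2 (y t) (u t)).
Proof. by move=> my mu; apply: meas_lik => // k i; exact: meas_obs2. Qed.

Lemma meas_coarse_euler l d (T : measurableType d) (X : T -> vec)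
    (V : T -> (2 ^ l.+1).-tuple vec) :
  measurable_fun setT X -> measurable_fun setT V ->
  measurable_fun setT (fun t => coarse_euler (X t) (V t)).
Proof.
move=> mX mV; apply: (meas_euler_path reg) => //; exact: meas_coarsen.
Qed.

Lemma meas_level_dist l d (T : measurableType d) (u : T -> level_path R dx l.+1)
    (uc : T -> level_path R dx l) :
  measurable_fun setT u -> measurable_fun setT uc ->
  measurable_fun setT (fun t => level_dist (u t) (uc t)).
Proof.
move=> mu muc; apply: measurable_funM; first exact: measurable_cst.
apply: meas_sum => k; apply: meas_sum => i; apply: meas_sqr.
by apply: measurable_funB; [exact: meas_obs|exact: meas_obs2].
Qed.

Lemma meas_trunc_dist l d (T : measurableType d) (f g : T -> vec) :
  measurable_fun setT f -> measurable_fun setT g ->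
  measurable_fun setT (fun t => trunc_dist l (f t) (g t)).
Proof.
move=> mf mg; apply: measurable_funD; last exact: measurable_cst.
by apply: measurable_minr; [exact: measurable_cst|exact: measurable_d2].
Qed.

Lemma block_lik_gt0 l (y : (2 ^ l).-tuple (dy.-tuple R)) u : 0 < block_lik y u.
Proof. exact: lik_gt0. Qed.

Lemma block_lik2_gt0 l (y : (2 ^ l.+1).-tuple (dy.-tuple R)) u : 0 < block_lik2 y u.
Proof. exact: lik_gt0. Qed.

Lemma block_lik_bounded l (y : (2 ^ l).-tuple (dy.-tuple R)) :
  exists M, forall u, block_lik y u <= M.
Proof.
have [M hM] := lik_bounded H y (ltW (delta_gt0 l)).
by exists M => u; apply: hM => k i; exact: hH.
Qed.

Lemma block_lik2_bounded l (y : (2 ^ l.+1).-tuple (dy.-tuple R)) :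
  exists M, forall u, block_lik2 y u <= M.
Proof.
have [M hM] := lik_bounded H y (ltW (delta_gt0 l.+1)).
by exists M => u; apply: hM => k i; exact: hH.
Qed.

Lemma level_delta l : (2 ^ l)%:R * delta R l = 1.
Proof. by rewrite natrX /delta mulfV// expf_neq0. Qed.

Lemma block_lik_sqr l (u : level_path R dx l) :
  (\int[blocks l]_y (block_lik y u ^+ 2)%:E <= (lik_cst dy H)%:E)%E.
Proof. by apply: lik_sqr; rewrite ?delta_gt0 ?level_delta// => k i; exact: hH. Qed.

Lemma block_lik2_sqr l (u : level_path R dx l) :
  (\int[blocks l.+1]_y (block_lik2 y u ^+ 2)%:E <= (lik_cst dy H)%:E)%E.
Proof. by apply: lik_sqr; rewrite ?delta_gt0 ?level_delta// => k i; exact: hH. Qed.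

Lemma block_lik_gap l (u : level_path R dx l.+1) (uc : level_path R dx l) :
  (\int[blocks l.+1]_y ((block_lik y u - block_lik2 y uc) ^+ 2)%:E <=
   (lik_cst dy H * level_dist u uc)%:E)%E.
Proof.
by apply: lik_diff; rewrite ?delta_gt0 ?level_delta// => k i; exact: hH.
Qed.

Lemma trunc_dist_ge l x y : delta R l <= trunc_dist l x y.
Proof. by rewrite lerDr le_min ler01 d2_ge0. Qed.

Lemma trunc_dist_le2 l x y : trunc_dist l x y <= 2.
Proof.
have h1 : Num.min 1 (d2 x y) <= 1 by rewrite ge_min lexx.
have h2 := delta_le1 l : delta R l <= 1.
by rewrite /trunc_dist; lra.
Qed.

Lemma trunc_distxx l x : trunc_dist l x x = delta R l.
Proof. by rewrite /trunc_dist d2xx min_r ?add0r. Qed.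

Lemma start_euler_path l x (v : (2 ^ l).-tuple vec) : start (euler_path b sigma x v) = x.
Proof. by rewrite /start (tnth_nth (origin dx)). Qed.

Lemma level_dist_path_cost l x xc (v : (2 ^ l.+1).-tuple vec) :
  level_dist (euler_path b sigma x v) (coarse_euler xc v) +
  d2 (endpoint (euler_path b sigma x v)) (endpoint (coarse_euler xc v)) <=
  (1 + dy%:R * Kh) * path_cost b sigma l v x xc.
Proof.
have e : (2 ^ l).*2 = (2 ^ l.+1)%N by rewrite expnS mul2n.
rewrite (path_costE _ _ _ (origin dx) (n := 2 ^ l)); last by rewrite size_tuple e.
rewrite e.
have D0 : 0 < delta R l.+1 by exact: delta_gt0.
have := obs_sqdist hK (euler_path b sigma x v) (coarse_euler xc v).
rewrite /endpoint !(tnth_nth (origin dx)) /= coarsenE -/(euler_seq b sigma l.+1 x v).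
rewrite -/(euler_seq b sigma l xc (pairs v)) -/(level_dist _ _).
set S := delta R l.+1 * _; set d := d2 _ _.
have S0 : 0 <= S by apply: mulr_ge0 (ltW D0) _; apply: sumr_ge0 => i _; exact: d2_ge0.
have d0 : 0 <= d by exact: d2_ge0.
have k0 : 0 <= dy%:R * Kh by rewrite mulr_ge0.
by have := mulr_ge0 k0 d0; rewrite /level_dist /coarse_euler; lra.
Qed.

Lemma path_gap_level l x xc :
  (\int[noise l.+1]_v (level_dist (euler_path b sigma x v) (coarse_euler xc v) +
     trunc_dist l.+1 (endpoint (euler_path b sigma x v)) (endpoint (coarse_euler xc v)))%:E
   <= (path_cst * trunc_dist l.+1 x xc)%:E)%E.
Proof.
have D0 : 0 < delta R l.+1 by exact: delta_gt0.
have [[K0 _ _ _ _] _] := reg.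
have cc0 := coupling_cst_ge0 reg.
have H0 : 0 <= dy%:R * (4 * H ^+ 2) by rewrite mulr_ge0// mulr_ge0// sqr_ge0.
have k0 : 0 <= dy%:R * Kh by rewrite mulr_ge0.
have mid : measurable_fun setT (id : (2 ^ l.+1).-tuple vec -> _) by exact: measurable_id.
have mc : measurable_fun setT (fun _ : (2 ^ l.+1).-tuple vec => x) by exact: measurable_cst.
have mcc : measurable_fun setT (fun _ : (2 ^ l.+1).-tuple vec => xc) by exact: measurable_cst.
have mf := meas_euler_path reg mc mid; have mg := meas_coarse_euler mcc mid.
have nl : nnm (fun v : (2 ^ l.+1).-tuple vec => (level_dist (euler_path b sigma x v) (coarse_euler xc v) +
     trunc_dist l.+1 (endpoint (euler_path b sigma x v)) (endpoint (coarse_euler xc v)))%:E).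
  apply: nnm_EFin => [|v].
    apply: measurable_funD; first exact: meas_level_dist.
    by apply: meas_trunc_dist; exact: meas_endpoint.
  apply: addr_ge0; first exact: (sqdist_ge0 D0).
  by apply: le_trans (trunc_dist_ge _ _ _); exact: ltW.
(* Distant pairs have [trunc_dist >= 1], so the trivial bounds suffice; for close pairs the
   truncation at the start is inactive and the Gronwall estimate applies. *)
have [le1|gt1] := leP (d2 x xc) 1; last first.
  apply: (@le_trans _ _ (\int[noise l.+1]_v (dy%:R * (4 * H ^+ 2) + 2)%:E)%E).
    apply: int_le => //; first by apply: nnm_cst; rewrite lee_fin addr_ge0.
    move=> v; rewrite lee_fin; apply: lerD; last exact: trunc_dist_le2.
    exact: (obs_sqdist_le hH).
  rewrite int_cst lee_fin /path_cst /trunc_dist min_l; last exact: ltW.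
  have h1 : 0 <= (1 + dy%:R * Kh) * coupling_cst dx K by rewrite mulr_ge0// addr_ge0.
  have h2 := mulr_ge0 path_cst_ge0 (ltW D0).
  by move: h2; rewrite /path_cst mulrDr mulr1; lra.
have e : (2 ^ l).*2 = (2 ^ l.+1)%N by rewrite expnS mul2n.
have npc : nnm (fun v : (2 ^ l.+1).-tuple vec => (path_cost b sigma l v x xc)%:E).
  by rewrite -e; apply: (nnm_path_cost reg).
apply: (@le_trans _ _ (\int[noise l.+1]_v ((1 + dy%:R * Kh)%:E *
    (path_cost b sigma l v x xc)%:E + (delta R l.+1)%:E))%E).
  apply: int_le => //.
    apply: nnm_add; last by apply: nnm_cst; rewrite lee_fin ltW.
    by apply: nnm_mul => //; apply: nnm_cst; rewrite lee_fin addr_ge0.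
  move=> v; rewrite -EFinM -EFinD lee_fin /trunc_dist addrA lerD2r.
  by apply: le_trans (level_dist_path_cost _ _ _); rewrite lerD2l ge_min lexx orbT.
rewrite int_add; last 2 first.
- by apply: nnm_mul => //; apply: nnm_cst; rewrite lee_fin addr_ge0.
- by apply: nnm_cst; rewrite lee_fin ltW.
rewrite int_cst int_scale//; last by rewrite addr_ge0.
apply: (@le_trans _ _ ((1 + dy%:R * Kh)%:E * (coupling_cst dx K * (d2 x xc + delta R l.+1))%:E
   + (delta R l.+1)%:E)%E).
  apply: leeD2r; apply: lee_wpmul2l; first by rewrite lee_fin addr_ge0.
  exact: (int_path_cost_level reg).
rewrite -EFinM -EFinD lee_fin /path_cst /trunc_dist min_r//.
have d0 := d2_ge0 x xc.
have h1 := mulr_ge0 H0 d0; have h2 := mulr_ge0 H0 (ltW D0).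
set A := (1 + dy%:R * Kh) * coupling_cst dx K.
have -> : (1 + dy%:R * Kh) * (coupling_cst dx K * (d2 x xc + delta R l.+1)) =
  A * d2 x xc + A * delta R l.+1 by rewrite /A; ring.
lra.
Qed.

End level_estimate.

(** * Second moments of the level estimators *)

Section filter_law.
Context {R : realType} d0 d1 d2 d3 (Om : measurableType d0)
  (D : measurableType d1) (A : measurableType d2) (E : measurableType d3).
Variables (N : nat) (Pr : probability Om R) (mu : probability D R).
Variables (a0 : A) (upd : A -> D -> N.-tuple E -> A).
Variables (k0 : probability E R) (k : D * N.-tuple E -> probability E R).
Hypothesis mupd : measurable_fun setT
  (fun p : (A * D) * N.-tuple E => upd p.1.1 p.1.2 p.2).
Hypothesis mk : forall C, measurable C -> measurable_fun setT (fun s => k s C).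
Variables (Y : nat -> Om -> D) (U : nat -> Om -> N.-tuple E) (G : nat -> set_system Om).
Hypothesis mG : forall p, G p `<=` measurable.
Hypothesis mYG : forall p r, measurable_fun [set: g_sigma_algebraType (G p)] (Y r).
Hypothesis mUG : forall p r, (r < p)%N ->
  measurable_fun [set: g_sigma_algebraType (G p)] (U r).
Hypothesis law_data : forall n (f : n.-tuple D -> \bar R), nnm f ->
  (\int[Pr]_w f (window Y 0 n w) = \int[iid mu n]_y f y)%E.
Hypothesis law_first : forall C (B : 'I_N -> set E), <<s G 0 >> C ->
  (forall i, measurable (B i)) ->
  (Pr (C `&` U 0 @^-1` rect B) = Pr C * \big[*%E/1%E]_(i < N) k0 (B i))%E.
Hypothesis law_next : forall p C (B : 'I_N -> set E), <<s G p.+1 >> C ->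
  (forall i, measurable (B i)) ->
  (Pr (C `&` U p.+1 @^-1` rect B) =
   \int[Pr]_(w in C) \big[*%E/1%E]_(i < N) k (Y p w, U p w) (B i))%E.

Let sG p : <<s G p >> `<=` measurable.
Proof. apply: smallest_sub; [exact: sigma_algebra_measurable|exact: mG]. Qed.

Let coarse p d (S : measurableType d) (X : Om -> S) :
  measurable_fun [set: g_sigma_algebraType (G p)] X -> measurable_fun setT X.
Proof. by move=> mX _ B mB; apply: (sG (p := p)); exact: (mX measurableT). Qed.

Let mU p : measurable_fun setT (U p).
Proof. exact: (coarse (mUG (ltnSn p))). Qed.

Let mwindow q p n : measurable_fun [set: g_sigma_algebraType (G q)] (window Y p n).
Proof.
apply/measurable_fun_tnthP => i.
have -> : (fun x => tnth x i) \o window Y p n = Y (p + i).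
  by apply/funext => w /=; rewrite tnth_mktuple.
exact: mYG.
Qed.

Let macc q p : (p <= q)%N ->
  measurable_fun [set: g_sigma_algebraType (G q)] (acc a0 upd Y U p).
Proof.
elim: p => [|p IH] pq; first exact: measurable_cst.
have mp : measurable_fun [set: g_sigma_algebraType (G q)]
    (fun w => ((acc a0 upd Y U p w, Y p w), U p w)).
  apply: measurable_fun_pair; last exact: mUG.
  by apply: measurable_fun_pair; [exact: IH (ltnW pq)|exact: mYG].
exact: (measurableT_comp mupd mp).
Qed.

(** [G p] contains the whole data and the rounds before [p], so the data window, the statistic and
    the old particles are all measurable with respect to it; [joint_law] then turns the rectangle
    identities into the hypotheses of [particle_law]. *)
Lemma filter_law p n (f : (n.-tuple D * A) * N.-tuple E -> \bar R) : nnm f ->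
  (\int[Pr]_w f ((window Y p n w, acc a0 upd Y U p w), U p w) =
   chain mu a0 upd k0 k p (fun s => \int[iid mu n]_y f ((y, s.1), s.2)))%E.
Proof.
move: p n f; apply: particle_law => //.
- move=> n f nf; apply: (joint_law (X := window Y 0 n) (U := U 0) (k := fun=> k0)) => //.
  + exact: (coarse (@mwindow 0 0 n)).
  + move=> C B mC mB.
    have mWC : <<s G 0 >> (window Y 0 n @^-1` C).
      by have := @mwindow 0 0 n measurableT C mC; rewrite setTI.
    rewrite (law_first mWC mB) integral_cst; first by rewrite muleC.
    exact: (sG mWC).
- move=> p n f nf.
  have mX : measurable_fun [set: g_sigma_algebraType (G p.+1)]
      (fun w => ((window Y p n.+1 w, acc a0 upd Y U p w), U p w)).
    apply: measurable_fun_pair; last exact: mUG.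
    by apply: measurable_fun_pair; [exact: mwindow|exact: macc].
  have Y0 w : tnth (window Y p n.+1 w) ord0 = Y p w by rewrite tnth_mktuple addn0.
  have := joint_law (X := fun w => ((window Y p n.+1 w, acc a0 upd Y U p w), U p w))
    (U := U p.+1) (k := fun s => k (tnth s.1.1 ord0, s.2)) (coarse mX) (mU p.+1) _ _ nf.
  move=> ->.
  + by apply: eq_integral => w _; rewrite Y0.
  + move=> C mC; apply: (measurableT_comp (mk mC)).
    meas.
  + move=> C B mC mB; set X := (fun w => _) in mX *.
    have mXC : <<s G p.+1 >> (X @^-1` C) by have := mX measurableT C mC; rewrite setTI.
    rewrite (law_next mXC mB).
    by apply: eq_integral => w _; rewrite Y0.
Qed.

End filter_law.

(** * Independence and law of the blocks of Brownian increments *)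

Section data_law.
Context {R : realType} (n : nat) d (Om : measurableType d) (Pr : probability Om R)
  (Y : R -> Om -> n.-tuple R).
Hypothesis BM : standard_brownian_motion Pr Y.

Definition increment l k w : n.-tuple R :=
  [tuple tnth (Y (k.+1%:R * delta R l) w) j - tnth (Y (k%:R * delta R l) w) j | j < n].

Definition block l p w : (2 ^ l).-tuple (n.-tuple R) :=
  [tuple increment l (p * 2 ^ l + k) w | k < 2 ^ l].

Let G l k : set_system Om := process_events Y [set s | 0 <= s <= k%:R * delta R l].

Let del0 l k : 0 <= k%:R * delta R l.
Proof. by rewrite mulr_ge0// ltW// delta_gt0. Qed.

Let GS l k : G l k `<=` G l k.+1.
Proof.
apply: bigcup_subset => s /= /andP[s0 sk]; rewrite s0 (le_trans sk)//.
by rewrite ler_wpM2r ?ler_nat// ltW// delta_gt0.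
Qed.

Lemma measurable_generated d' (S : measurableType d') (X : Om -> S) (F : set_system Om) :
  generated_by X `<=` F -> measurable_fun [set: g_sigma_algebraType F] X.
Proof.
move=> XF _ B mB; rewrite setTI; apply: sub_sigma_algebra.
by apply: XF; exists B => //; rewrite setTI.
Qed.

Let mY l k m : (m <= k)%N ->
  measurable_fun [set: g_sigma_algebraType (G l k)] (Y (m%:R * delta R l)).
Proof.
move=> mk; apply: measurable_generated => A YA; exists (m%:R * delta R l) => //=.
by rewrite del0 ler_wpM2r ?ler_nat// ltW// delta_gt0.
Qed.

Lemma measurable_increment d' (T : measurableType d') (f : T -> Om) l k :
  measurable_fun setT (fun t => Y (k.+1%:R * delta R l) (f t)) ->
  measurable_fun setT (fun t => Y (k%:R * delta R l) (f t)) ->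
  measurable_fun setT (fun t => increment l k (f t)).
Proof.
move=> m1 m2; apply: measurable_tuple => j; under eq_fun do rewrite tnth_mktuple.
by apply: measurable_funB; exact: meas_tnth.
Qed.

Let mV l k : measurable_fun [set: g_sigma_algebraType (G l k.+1)] (increment l k).
Proof.
apply: (measurable_increment (T := g_sigma_algebraType (G l k.+1)) (f := id)); exact: mY.
Qed.

Let sG l k : <<s G l k >> `<=` measurable.
Proof.
apply: smallest_sub; first exact: sigma_algebra_measurable.
move=> _ [s /= /andP[s0 _]] [B mB <-].
by case: BM => + _ _ _; move=> /(_ s s0); exact.
Qed.

Let coarse l k d' (S : measurableType d') (X : Om -> S) :
  measurable_fun [set: g_sigma_algebraType (G l k)] X -> measurable_fun setT X.
Proof. by move=> mX _ B mB; apply: (@sG l k); exact: (mX measurableT). Qed.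

Lemma gauss_set (s : R) (B : set R) : measurable B -> gauss s B = normal_prob 0 s B.
Proof.
move=> mB; rewrite -(int_indicT (gauss s) mB) gaussE; last exact: nnm_indic.
by rewrite integral_indic// setIT.
Qed.

Let increments_independent l :
  independent_of_past Pr (gvec n (Num.sqrt (delta R l))) (increment l) (G l).
Proof.
move=> k d' S X mX f nf.
apply: (joint_law (X := X) (U := increment l k)
  (k := fun=> gauss (Num.sqrt (delta R l)))) => //.
- exact: coarse mX.
- exact: coarse (@mV l k).
- move=> A B mA mB.
  have mXA : <<s G l k >> (X @^-1` A).
    by have := mX measurableT A mA; rewrite setTI.
  rewrite integral_cst; last exact: (sG mXA).
  rewrite [RHS]muleC.
  have kl : k%:R * delta R l < k.+1%:R * delta R l.
    by rewrite ltr_pM2r ?ltr_nat//; exact: delta_gt0.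
  have [_ _ _ /(_ _ _ _ _ (del0 l k) kl mXA mB)] := BM.
  have -> : k.+1%:R * delta R l - k%:R * delta R l = delta R l by rewrite -natr1; ring.
  move=> e; under [in RHS]eq_bigr => i _ do rewrite (gauss_set _ (mB i)).
  rewrite -e; congr (Pr (_ `&` _)); apply/seteqP; split=> w /= h i.
    by have := h i; rewrite tnth_mktuple.
  by rewrite tnth_mktuple; exact: h.
Qed.

Let window_blocks l := iid_window (@GS l) (@mV l) (@increments_independent l).

Let blocks_independent l :
  independent_of_past Pr (gblock (2 ^ l) n (delta R l)) (block l)
    (fun p => G l (p * 2 ^ l)).
Proof. by move=> p d' S X mX f nf; exact: window_blocks. Qed.

(** [iid_window] is applied at two scales: to the increments within a unit interval, which form a
    block, and then to the blocks themselves. *)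
Lemma block_law l m (f : m.-tuple ((2 ^ l).-tuple (n.-tuple R)) -> \bar R) : nnm f ->
  (\int[Pr]_w f (window (block l) 0 m w) =
   \int[iid (gblock (2 ^ l) n (delta R l)) m]_y f y)%E.
Proof.
move=> nf.
have GS' p : G l (p * 2 ^ l) `<=` G l (p.+1 * 2 ^ l).
  rewrite mulSn addnC; set m0 := (p * 2 ^ l)%N.
  elim: (2 ^ l)%N => [|q IH]; first by rewrite addn0.
  by rewrite addnS; exact: (subset_trans IH (@GS _ _)).
have mV' p : measurable_fun [set: g_sigma_algebraType (G l (p.+1 * 2 ^ l))] (block l p).
  by rewrite mulSn addnC; exact: (measurable_window (@GS l) (@mV l)).
(* A constant plays the past, since the window starts at time zero. *)
have nf2 : nnm (f \o snd : R * _ -> _) by apply: (nnm_comp nf); exact: measurable_snd.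
have := @iid_window _ _ _ _ _ _ _ _ _ GS' mV' (@blocks_independent l) m 0 _ _
  (fun=> 0 : R) (measurable_cst _) _ nf2.
by rewrite /= int_cst; apply.
Qed.

Lemma measurable_block l p (F : set_system Om) :
  (forall s, 0 <= s -> generated_by (Y s) `<=` F) ->
  measurable_fun [set: g_sigma_algebraType F] (block l p).
Proof.
move=> YF; apply: measurable_tuple => k.
under eq_fun do rewrite tnth_mktuple.
apply: (measurable_increment (T := g_sigma_algebraType F) (f := id));
  by apply: measurable_generated; exact: YF.
Qed.

End data_law.

(** * Potentials as likelihoods of fine data blocks *)

Section potentials_of_blocks.
Context {R : realType} (dx dy : nat) (h : dx.-tuple R -> dy.-tuple R).
Context d (Om : measurableType d) (Y : R -> Om -> dy.-tuple R).

Lemma sum_double (n : nat) (f : nat -> R) :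
  \sum_(i < n.*2) f i = \sum_(i < n) (f i.*2 + f i.*2.+1).
Proof.
elim: n => [|n IH]; first by rewrite !big_ord0.
by rewrite doubleS !big_ord_recr /= IH addrA.
Qed.

Lemma path_potentialE l p w (u : level_path R dx l) :
  path_potential h (data Y w) p u = block_lik h (block Y l p w) u.
Proof.
rewrite /path_potential /block_lik /lik expR_sum; apply: eq_bigr => k _.
rewrite /potential tnth_mktuple; apply: (congr1 expR).
apply: (congr2 (fun x y => x - y)); first by apply: eq_bigr => j _; rewrite tnth_mktuple.
by apply: (congr1 (GRing.mul _)); apply: eq_bigr => j _; rewrite expr2.
Qed.

Lemma coarse_incrementE l k w j :
  tnth (data Y w (k.+1%:R * delta R l)) j - tnth (data Y w (k%:R * delta R l)) j =
  tnth (increment Y l.+1 k.*2 w) j + tnth (increment Y l.+1 k.*2.+1 w) j.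
Proof.
rewrite /data !tnth_mktuple.
have e m : m%:R * delta R l = m.*2%:R * delta R l.+1 by rewrite deltaS -mul2n natrM; ring.
by rewrite !e doubleS; ring.
Qed.

(** A coarse increment is the sum of two fine ones and the coarse step is twice the fine one. Hence
    both filters of a pair are driven by the same fine block, and their potentials can be compared
    by [lik_diff]. *)
Lemma coarse_path_potentialE l p w (u : level_path R dx l) :
  path_potential h (data Y w) p u = block_lik2 h (block Y l.+1 p w) u.
Proof.
rewrite path_potentialE /block_lik /block_lik2 /lik; congr expR.
pose inc k j := tnth (increment Y l.+1 (p * 2 ^ l.+1 + k) w) j.
pose f k := \sum_j tnth (h (nth (origin dx) u k./2)) j * inc k j -
  delta R l.+1 / 2 * \sum_j tnth (h (nth (origin dx) u k./2)) j ^+ 2.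
have e : (2 ^ l).*2 = (2 ^ l.+1)%N by rewrite expnS mul2n.
transitivity (\sum_(k < 2 ^ l.+1) f k); last first.
  by apply: eq_bigr => k _; rewrite /f /obs2 tnth_mktuple.
rewrite -e sum_double; apply: eq_bigr => k _.
rewrite /f -uphalfE uphalf_double doubleK tnth_mktuple /obs (tnth_nth (origin dx)) /=.
rewrite -/(obs h u k) (deltaS l).
have -> : \sum_i tnth (h (nth (origin dx) u k)) i * tnth (increment Y l (p * 2 ^ l + k) w) i
  = \sum_i (tnth (h (nth (origin dx) u k)) i * inc k.*2 i +
            tnth (h (nth (origin dx) u k)) i * inc k.*2.+1 i).
  apply: eq_bigr => i _; rewrite -mulrDr; congr (_ * _).
  have ek : (p * 2 ^ l.+1 + k.*2 = (p * 2 ^ l + k).*2)%N.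
    by rewrite doubleD -(muln2 (p * _)) -mulnA muln2 e.
  by rewrite tnth_mktuple /inc addnS ek; exact: (coarse_incrementE l (p * 2 ^ l + k) w i).
by rewrite big_split /=; ring.
Qed.

End potentials_of_blocks.

Section euler_laws.
Context {R : realType} (dx : nat).

Lemma iid_integralE d (T : measurableType d) (mu : probability T R)
    (I : (T -> \bar R) -> \bar R) n (f : n.-tuple T -> \bar R) :
  (forall g, nnm g -> I g = \int[mu]_x g x)%E -> nnm f ->
  iid_integral I f = (\int[iid mu n]_u f u)%E.
Proof.
move=> HI; elim: n f => [|n IH] f nf; first by rewrite iid0.
rewrite /= iidS// -HI; last exact: nnm_iidS.
by congr I; apply/funext => v; rewrite IH//; exact: nnm_consr.
Qed.

Lemma gauss_vec_integralE n (v : R) (f : n.-tuple R -> \bar R) : nnm f ->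
  gauss_vec_integral v f = (\int[gvec n (Num.sqrt v)]_u f u)%E.
Proof. by move=> nf; apply: iid_integralE => // g ng; rewrite gaussE. Qed.

Lemma noise_integralE l (f : (2 ^ l).-tuple (dx.-tuple R) -> \bar R) : nnm f ->
  iid_integral (@gauss_vec_integral R dx (delta R l)) f = (\int[noise dx l]_v f v)%E.
Proof. by move=> nf; apply: iid_integralE => // g; exact: gauss_vec_integralE. Qed.

Context (b : dx.-tuple R -> dx.-tuple R) (sigma : dx.-tuple R -> 'M[R]_dx) (K : R).
Hypothesis reg : euler_regular b sigma K.

Lemma euler_lawE l x (B : set (level_path R dx l)) : measurable B ->
  euler_law b sigma x B = (\int[noise dx l]_v (\1_B (euler_path b sigma x v))%:E)%E.
Proof.
move=> mB; apply: noise_integralE; apply: (nnm_comp (nnm_indic mB)).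
by apply: (meas_euler_path reg); [exact: measurable_cst|exact: measurable_id].
Qed.

Lemma coupled_euler_lawE l x xc (B : set (level_path R dx l.+1 * level_path R dx l)) :
  measurable B ->
  coupled_euler_law b sigma x xc B =
  (\int[noise dx l.+1]_v (\1_B (euler_path b sigma x v, coarse_euler b sigma xc v))%:E)%E.
Proof.
move=> mB; apply: noise_integralE; apply: (nnm_comp (nnm_indic mB)).
apply: measurable_fun_pair.
  by apply: (meas_euler_path reg); [exact: measurable_cst|exact: measurable_id].
by apply: (meas_coarse_euler reg); [exact: measurable_cst|exact: measurable_id].
Qed.

Lemma int_indic_fin_num d1 d2 (T : measurableType d1) (S : measurableType d2)
    (mu : probability T R) (f : T -> S) (B : set S) :
  measurable_fun setT f -> measurable B ->
  (\int[mu]_x (\1_B (f x))%:E)%E \is a fin_num.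
Proof.
move=> mf mB; have ni : nnm (fun x => (\1_B (f x))%:E : \bar R).
  exact: (nnm_comp (nnm_indic mB)).
rewrite ge0_fin_numE; last by apply: integral_ge0 => x _; case: ni.
apply: (@le_lt_trans _ _ (\int[mu]_x 1)%E); last by rewrite int_cst ltry.
apply: int_le => // x.
by rewrite lee_fin indicE; case: (_ \in _).
Qed.

End euler_laws.

Section filtration.
Context {R : realType} (dx dy : nat) d (Om : measurableType d) (Pr : probability Om R)
  (Y : R -> Om -> dy.-tuple R).
Context (xstar : dx.-tuple R) (h : dx.-tuple R -> dy.-tuple R)
  (b : dx.-tuple R -> dx.-tuple R) (sigma : dx.-tuple R -> 'M[R]_dx).
Context (N : nat) (F : filters R dx N Om).
Hypothesis BM : standard_brownian_motion Pr Y.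
Hypothesis runs : runs_filters xstar h b sigma Pr Y F.

Definition past_events q p : set_system Om :=
  process_events Y [set s | 0 <= s] `|` level_events F q p `|`
      [set A | exists q' p', q' <> q /\ level_events F q' p' A].

Lemma generated_measurable d' (S : measurableType d') (X : Om -> S) :
  measurable_fun setT X -> generated_by X `<=` measurable.
Proof. by move=> mX _ [B mB <-]; exact: mX. Qed.

Lemma level_events_measurable q p : level_events F q p `<=` measurable.
Proof.
have [[mpf _ _] cpf] := runs.
case: q => [|l] A /=; first by move=> [r [i [_]]]; exact: generated_measurable.
have [mcpf midx _ _] := cpf l.
case=> [[r [i [_ []]]]|[r [i [s [_ [->|->]]]]]].
- by apply: generated_measurable; case: (mcpf r i).
- by apply: generated_measurable; case: (mcpf r i).
- by case: (midx r i s).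
- by case: (midx r i s).
Qed.

Lemma past_events_measurable q p : past_events q p `<=` measurable.
Proof.
move=> A [[[s s0 YA]|]|[q' [p' [_]]]].
- have [mY _ _ _] := BM.
  by apply: (generated_measurable (mY s s0)).
- exact: level_events_measurable.
- exact: level_events_measurable.
Qed.

Lemma measurable_past q p d' (S : measurableType d') (X : Om -> S) :
  measurable_fun [set: g_sigma_algebraType (past_events q p)] X ->
  measurable_fun setT X.
Proof.
move=> mX _ B mB; apply: (smallest_sub (@sigma_algebra_measurable _ Om)
  (@past_events_measurable q p)); exact: (mX measurableT).
Qed.

Lemma data_past q p s : 0 <= s -> generated_by (Y s) `<=` past_events q p.
Proof. by move=> s0 A YA; left; left; exists s. Qed.

Lemma measurable_block_past l q p r :
  measurable_fun [set: g_sigma_algebraType (past_events q p)] (block Y l r).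
Proof. by apply: measurable_block => s s0; exact: data_past. Qed.

Definition cpf_pairs l p w : N.-tuple (level_path R dx l.+1 * level_path R dx l) :=
  [tuple (cpf_fine F l p i w, cpf_coarse F l p i w) | i < N].

Definition pf_paths p w : N.-tuple (level_path R dx 0) :=
  [tuple pf_path F p i w | i < N].

Lemma measurable_cpf_pairs_past l p r : (r < p)%N ->
  measurable_fun [set: g_sigma_algebraType (past_events l.+1 p)] (cpf_pairs l r).
Proof.
move=> rp; apply: measurable_tuple => i; under eq_fun do rewrite tnth_mktuple.
apply: measurable_fun_pair; apply: measurable_generated => A XA; left; right; left.
  by exists r, i; split=> //; left.
by exists r, i; split=> //; right.
Qed.

Lemma measurable_pf_paths_past p r : (r < p)%N ->
  measurable_fun [set: g_sigma_algebraType (past_events 0 p)] (pf_paths r).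
Proof.
move=> rp; apply: measurable_tuple => i; under eq_fun do rewrite tnth_mktuple.
by apply: measurable_generated => A XA; left; right; exists r, i.
Qed.

End filtration.

Lemma setI_rect_mktuple T1 d (T2 : measurableType d) (C : set T1) N (X : 'I_N -> T1 -> T2) (B : 'I_N -> set T2) :
  C `&` (fun w => [tuple X i w | i < N]) @^-1` rect B =
  C `&` [set w | forall i, B i (X i w)].
Proof.
by congr (_ `&` _); apply/seteqP; split=> w /= + i => /(_ i); rewrite tnth_mktuple.
Qed.

(* Summing over the selected indices turns the joint law of indices and paths
   into the law of the paths alone. *)
Lemma marginal_law {R : realType} d (Om : measurableType d) (Pr : probability Om R)
    (J : finType) N (C : set Om) (S : 'I_N -> J -> set Om) (Bw : 'I_N -> set Om)
    (g : 'I_N -> J -> Om -> R) :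
  measurable C -> (forall i j, measurable (S i j)) -> (forall i, measurable (Bw i)) ->
  (forall i w, exists j, S i j w) ->
  (forall i j j' w, S i j w -> S i j' w -> j = j') ->
  (forall i j, measurable_fun setT (g i j)) -> (forall i j w, 0 <= g i j w) ->
  (forall s : 'I_N -> J,
    Pr (C `&` [set w | forall i, S i (s i) w /\ Bw i w]) =
    \int[Pr]_(w in C) \big[*%E/1%E]_(i < N) (g i (s i) w)%:E)%E ->
  (Pr (C `&` [set w | forall i, Bw i w]) =
   \int[Pr]_(w in C) \big[*%E/1%E]_(i < N) (\sum_j g i j w)%:E)%E.
Proof.
move=> mC mS mB Sex Suq mg g0 law.
have meas_all (T : 'I_N -> set Om) : (forall i, measurable (T i)) ->
    measurable [set w | forall i, T i w].
  move=> mT; rewrite (_ : mkset _ = \bigcap_(i in setT) T i).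
    by apply: fin_bigcap_measurable => //; exact: finite_finset.
  by apply/seteqP; split=> w /= h i; [move=> _|]; exact: h.
pose E (s : {ffun 'I_N -> J}) := C `&` [set w | forall i, S i (s i) w /\ Bw i w].
have mE s : measurable (E s).
  by apply: measurableI => //; apply: meas_all => i; exact: measurableI.
have mall : measurable (C `&` [set w | forall i, Bw i w]).
  by apply: measurableI => //; exact: meas_all.
transitivity (\sum_s Pr (E s))%E.
  transitivity (\sum_s \int[Pr]_w (\1_(E s) w)%:E)%E; last first.
    by apply: eq_bigr => s _; rewrite int_indicT.
  rewrite -int_sum; last by move=> s; exact: nnm_indic.
  rewrite -int_indicT//; apply: eq_integral => w _.
  rewrite sumEFin; congr EFin; rewrite indicE.
  have [/set_mem[Cw Bww]|nw] := boolP (w \in _); last first.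
    rewrite big1// => s _; rewrite indicE memNset// => -[Cw hw].
    by move/negP: nw; apply; apply/mem_set; split=> // i; case: (hw i).
  (* Exactly one index map is realized at [w]: [Sex] supplies it and [Suq] excludes the others. *)
  have /choice[s hs] : forall i, exists j, S i j w by move=> i; exact: Sex.
  rewrite (bigD1 [ffun i => s i]) //= big1 ?addr0.
    by rewrite indicE mem_set//; split=> // i; rewrite ffunE; split; [exact: hs|exact: Bww].
  move=> s' ne; rewrite indicE memNset// => -[_ hw]; move/eqP: ne; apply.
  by apply/ffunP => i; rewrite ffunE; case: (hw i) => + _; move=> /Suq/(_ (hs i)).
under eq_bigr => s _ do rewrite law.
under eq_bigr => s _ do under eq_integral => w _ do rewrite prodEFin.
rewrite -ge0_integral_sum//.
- apply: eq_integral => w _; rewrite prodEFin sumEFin; congr EFin.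
  (* Distributivity: a sum over index maps of products is a product of sums. *)
  by rewrite (bigA_distr_bigA (fun i j => g i j w)).
- move=> s; apply/measurable_EFinP; apply: measurable_funTS.
  by apply: measurable_prod => i _; exact: mg.
- by move=> s w _; rewrite lee_fin; apply: prodr_ge0 => i _; exact: g0.
Qed.

(** * Second moment of the coupled filter at a level *)

Section cpf_moment.
Context {R : realType} (dx dy : nat) d (Om : measurableType d) (Pr : probability Om R)
  (Y : R -> Om -> dy.-tuple R).
Context (xstar : dx.-tuple R) (h : dx.-tuple R -> dy.-tuple R)
  (b : dx.-tuple R -> dx.-tuple R) (sigma : dx.-tuple R -> 'M[R]_dx) (K H Kh : R).
Context (N : nat) (F : filters R dx N Om).
Hypothesis BM : standard_brownian_motion Pr Y.
Hypothesis runs : runs_filters xstar h b sigma Pr Y F.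
Hypothesis reg : euler_regular b sigma K.
Hypothesis mh : forall i, measurable_fun setT (fun x => tnth (h x) i).
Hypothesis hH : forall x i, `|tnth (h x) i| <= H.
Hypothesis hK : forall x y i, (tnth (h x) i - tnth (h y) i) ^+ 2 <= Kh * d2 x y.
Hypothesis Kh0 : 0 <= Kh.
Hypothesis N0 : (0 < N)%N.
Variable l : nat.

Let Ef := level_path R dx l.+1.
Let Ec := level_path R dx l.
Let Pf x (v : (2 ^ l.+1).-tuple (dx.-tuple R)) : Ef := euler_path b sigma x v.
Let Pc x (v : (2 ^ l.+1).-tuple (dx.-tuple R)) : Ec := coarse_euler b sigma x v.
Let Gf (y : (2 ^ l.+1).-tuple (dy.-tuple R)) (u : Ef) := block_lik h y u.
Let Gc (y : (2 ^ l.+1).-tuple (dy.-tuple R)) (u : Ec) := block_lik2 h y u.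
Let mPf := meas_euler_path reg (l := l.+1).
Let mPc := meas_coarse_euler reg (l := l).
Let mGf := meas_block_lik mh (l := l.+1).
Let mGc := meas_block_lik2 mh (l := l).
Let Gf0 : forall y e, 0 < Gf y e. Proof. by move=> y e; exact: block_lik_gt0. Qed.
Let Gc0 : forall y e, 0 < Gc y e. Proof. by move=> y e; exact: block_lik2_gt0. Qed.
Let kernel := @kap _ _ _ _ _ _ _ _ _ _ _ (noise dx l.+1) N Pf Pc _ _ Gf Gc N0
  mPf mPc (@meas_endpoint _ _ l.+1) (@meas_endpoint _ _ l) Gf0 Gc0.
Let kernel0 := @kinit _ _ _ _ _ _ _ _ _ (noise dx l.+1) Pf Pc xstar mPf mPc.
Let upd := @updcpf R _ _ _ _ _ _ N Gf Gc.
Let yb := block Y l.+1.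
Let U := cpf_pairs F l.

Let fine_weightE p w i :
  weight h (data Y w) p (fun j => cpf_fine F l p j w) i = fine_weight Gf (yb p w, U p w) i.
Proof.
rewrite /weight /fine_weight /= /Gf /yb path_potentialE tnth_mktuple; congr (_ / _).
by apply: eq_bigr => j _; rewrite path_potentialE tnth_mktuple.
Qed.

Let coarse_weightE p w i :
  weight h (data Y w) p (fun j => cpf_coarse F l p j w) i = coarse_weight Gc (yb p w, U p w) i.
Proof.
rewrite /weight /coarse_weight /= /Gc /yb coarse_path_potentialE tnth_mktuple; congr (_ / _).
by apply: eq_bigr => j _; rewrite coarse_path_potentialE tnth_mktuple.
Qed.

Let kernel0_law B : measurable B ->
  kernel0 B = coupled_euler_law b sigma xstar xstar B.
Proof.
move=> mB; rewrite (coupled_euler_lawE reg)// -(int_indicT kernel0 mB) kinitE//.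
exact: nnm_indic.
Qed.

Let draw_prob (ab : 'I_N * 'I_N) B
    (s : (2 ^ l.+1).-tuple (dy.-tuple R) * N.-tuple (Ef * Ec)) : R :=
  fine (\int[noise dx l.+1]_v
    (\1_B (draw Pf Pc (@endpoint R dx l.+1) (@endpoint R dx l) ab s v))%:E)%E.

Let mdraw ab := @meas_draw _ _ _ _ _ _ _ _ _ ((2 ^ l.+1).-tuple (dy.-tuple R)) N Pf Pc _ _
  mPf mPc (@meas_endpoint R dx l.+1) (@meas_endpoint R dx l) ab.

Let draw_probE ab B s : measurable B ->
  coupled_euler_law b sigma (endpoint (tnth s.2 ab.1).1) (endpoint (tnth s.2 ab.2).2) B =
  (draw_prob ab B s)%:E.
Proof.
move=> mB; rewrite (coupled_euler_lawE reg)// /draw_prob fineK//.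
apply: int_indic_fin_num => //.
have : measurable_fun setT (fun v : (2 ^ l.+1).-tuple (dx.-tuple R) => (s, v)).
  exact: measurable_fun_pair.
by move=> /(measurableT_comp (@mdraw ab)).
Qed.

Let kernel_law s B : measurable B ->
  kernel s B = (\sum_ab sel Gf Gc ab s * draw_prob ab B s)%:E.
Proof.
move=> mB; rewrite /kernel /kap kmix_set// -sumEFin; apply: eq_bigr => ab _.
by rewrite EFinM -draw_probE// (coupled_euler_lawE reg).
Qed.

Let mdraw_prob ab B : measurable B -> measurable_fun setT (draw_prob ab B).
Proof.
move=> mB; apply: (measurableT_comp (fine_measurable measurableT)).
have n1 := nnm_comp (@nnm_indic R _ _ _ mB) (@mdraw ab).
by have [] := nnm_int (noise dx l.+1) n1.
Qed.

Let law_first C (B : 'I_N -> set (Ef * Ec)) : <<s past_events Y F l.+1 0 >> C ->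
  (forall i, measurable (B i)) ->
  (Pr (C `&` U 0 @^-1` rect B) = Pr C * \big[*%E/1%E]_(i < N) kernel0 (B i))%E.
Proof.
move=> pC mB; have [_ /(_ l)[_ _ law _]] := runs.
rewrite setI_rect_mktuple (law _ _ pC mB); congr (_ * _)%E.
by apply: eq_bigr => i _; rewrite kernel0_law.
Qed.

Let law_next p C (B : 'I_N -> set (Ef * Ec)) : <<s past_events Y F l.+1 p.+1 >> C ->
  (forall i, measurable (B i)) ->
  (Pr (C `&` U p.+1 @^-1` rect B) =
   \int[Pr]_(w in C) \big[*%E/1%E]_(i < N) kernel (yb p w, U p w) (B i))%E.
Proof.
move=> pC mB; have [_ /(_ l)[mpaths midx _ law]] := runs.
have mC : measurable C.
  apply: smallest_sub pC; first exact: sigma_algebra_measurable.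
  exact: (past_events_measurable BM runs).
rewrite setI_rect_mktuple.
transitivity (\int[Pr]_(w in C) \big[*%E/1%E]_(i < N) (\sum_ab
    sel Gf Gc ab (yb p w, U p w) * draw_prob ab (B i) (yb p w, U p w))%:E)%E; last first.
  apply: eq_integral => w _; apply: eq_bigr => i _.
  by rewrite kernel_law.
have mpairs i : measurable_fun setT (fun w => (cpf_fine F l p.+1 i w, cpf_coarse F l p.+1 i w)).
  by have [] := mpaths p.+1 i => m1 m2; exact: measurable_fun_pair.
have myU : measurable_fun setT (fun w => (yb p w, U p w)).
  apply: measurable_fun_pair; apply: (measurable_past BM runs (q := l.+1) (p := p.+1)).
    exact: measurable_block_past.
  exact: measurable_cpf_pairs_past.
apply: (@marginal_law R _ Om Pr _ N C (fun i ab => [set w | cpf_fine_index F l p i w = ab.1]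
    `&` [set w | cpf_coarse_index F l p i w = ab.2])
  (fun i => (fun w => (cpf_fine F l p.+1 i w, cpf_coarse F l p.+1 i w)) @^-1` B i)
  (fun i ab w => sel Gf Gc ab (yb p w, U p w) * draw_prob ab (B i) (yb p w, U p w))) => //.
- move=> i ab; apply: measurableI; first by have [] := midx p i ab.1.
  by have [] := midx p i ab.2.
- by move=> i; rewrite -[X in measurable X]setTI; exact: mpairs.
- by move=> i w; exists (cpf_fine_index F l p i w, cpf_coarse_index F l p i w).
- by move=> i [a a'] [c c'] w [/= <- <-] [/= <- <-].
- move=> i ab; apply: measurable_funM.
    exact: (measurableT_comp (meas_sel N0 mGf mGc Gf0 Gc0 ab) myU).
  exact: (measurableT_comp (@mdraw_prob ab _ (mB i)) myU).
- move=> i ab w; apply: mulr_ge0; first exact: sel_ge0.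
  by apply: fine_ge0; apply: integral_ge0 => v _; rewrite lee_fin.
move=> s; have := law p C (fun i => (s i).1) (fun i => (s i).2) B pC mB.
have -> : [set w | forall i, ([set w | cpf_fine_index F l p i w = (s i).1] `&`
    [set w | cpf_coarse_index F l p i w = (s i).2]) w /\
    ((fun w => (cpf_fine F l p.+1 i w, cpf_coarse F l p.+1 i w)) @^-1` B i) w] =
  [set w | forall i, [/\ cpf_fine_index F l p i w = (s i).1,
     cpf_coarse_index F l p i w = (s i).2 &
     B i (cpf_fine F l p.+1 i w, cpf_coarse F l p.+1 i w)]].
  by apply/seteqP; split=> w /= hw i; have [] := hw i => // -[].
move=> ->; apply: eq_integral => w _; apply: eq_bigr => i _.
rewrite EFinM -draw_probE//; congr (_%:E * _)%E; last by rewrite !tnth_mktuple.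
by rewrite /sel; congr maximal_coupling; apply/funext => j;
  [exact: fine_weightE|exact: coarse_weightE].
Qed.

Let accE p w : acc (1 : R, 1 : R) upd yb U p w =
  (\prod_(r < p) (N%:R^-1 * \sum_(i < N) path_potential h (data Y w) r (cpf_fine F l r i w)),
   \prod_(r < p) (N%:R^-1 * \sum_(i < N) path_potential h (data Y w) r (cpf_coarse F l r i w))).
Proof.
elim: p => [|p IH]; first by rewrite !big_ord0.
rewrite /= IH /upd /updcpf !big_ord_recr /= /avg; congr (_ * (_ * _), _ * (_ * _));
  apply: eq_bigr => i _; rewrite tnth_mktuple; rewrite /Gf /Gc /=.
- by rewrite path_potentialE.
- by rewrite coarse_path_potentialE.
Qed.

Let test (phi : dx.-tuple R -> R) : 0.-tuple ((2 ^ l.+1).-tuple (dy.-tuple R)) * dx.-tuple R -> R :=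
  fun p => phi p.2.

(** At time [p.+1] the statistic covers [p] completed rounds, and the one remaining block is the one
    that weights the last paths. *)
Let PsiE phi p w : Psi h Y F p.+1 phi l.+1 w =
  estimate (@endpoint R dx l.+1) (@endpoint R dx l) Gf Gc (test phi) (test phi)
    (window yb p 1 w) (acc (1 : R, 1 : R) upd yb U p w, U p w).
Proof.
rewrite /estimate accE /contrib /avg /= /gamma_estimate /=.
rewrite sumrB mulrBr -!mulr_sumr; congr (_ - _); rewrite mulrCA; congr (_ * (_ * _));
  apply: eq_bigr => i _; rewrite !tnth_mktuple /test /= addn0 /Gf /Gc /yb.
- by rewrite path_potentialE.
- by rewrite coarse_path_potentialE.
Qed.

(** The squared difference of [phi] is at most [4 * s ^+ 2] and at most [Lp ^+ 2 * d2 x xc], hence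
    at most a multiple of the truncated distance; this is where [phi] has to be both bounded and
    Lipschitz. *)
Let test_pair_test (phi : dx.-tuple R -> R) (s Lp : R) : measurable_fun setT phi -> 0 <= s -> 0 <= Lp ->
  (forall x, `|phi x| <= s) -> (forall x y, `|phi x - phi y| <= Lp * Defs.edist x y) ->
  test_pair (blocks dy l.+1) (trunc_dist l.+1) (test phi) (test phi) (4 * (s + Lp) ^+ 2).
Proof.
move=> mphi s0 L0 phis phiL.
have mt : measurable_fun setT (test phi).
  by apply: (measurableT_comp mphi); exact: measurable_snd.
have phi2 x : phi x ^+ 2 <= s ^+ 2.
  by rewrite -real_normK ?num_real//; apply: lerXn2r; rewrite ?nnegrE.
have c1 : s ^+ 2 <= 4 * (s + Lp) ^+ 2 by nra.
have nc (c : R) : 0 <= c -> nnm (fun _ : 0.-tuple ((2 ^ l.+1).-tuple (dy.-tuple R)) => c%:E).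
  by move=> c0; exact: nnm_cst.
split=> //; [by move=> y; exists s => x; exact: phis|by move=> y; exists s => x; exact: phis|..].
- move=> x; rewrite iid0; last exact: nc (sqr_ge0 (phi x)).
  by rewrite lee_fin; exact: (le_trans (phi2 x)).
- move=> x; rewrite iid0; last exact: nc (sqr_ge0 (phi x)).
  by rewrite lee_fin; exact: (le_trans (phi2 x)).
move=> x xc; rewrite iid0; last exact: nc (sqr_ge0 (phi x - phi xc)).
rewrite lee_fin /test /= /trunc_dist.
have D0 : 0 <= delta R l.+1 by rewrite ltW// delta_gt0.
have k0 : 0 <= 4 * (s + Lp) ^+ 2 by apply: le_trans c1; exact: sqr_ge0.
apply: (@le_trans _ _ (4 * (s + Lp) ^+ 2 * Num.min 1 (d2 x xc))); last first.
  by apply: ler_wpM2l => //; rewrite lerDl.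
rewrite minr_pMr// mulr1 le_min; apply/andP; split.
  have c4 : s ^+ 2 <= (s + Lp) ^+ 2 by nra.
  have -> : (phi x - phi xc) ^+ 2 = 2 * phi x ^+ 2 + 2 * phi xc ^+ 2 - (phi x + phi xc) ^+ 2 by ring.
  by have := phi2 x; have := phi2 xc; have := sqr_ge0 (phi x + phi xc); lra.
rewrite -edist_sq; apply: (@le_trans _ _ ((Lp * Defs.edist x xc) ^+ 2)).
  rewrite -real_normK ?num_real//; apply: lerXn2r; rewrite ?nnegrE//.
  by rewrite mulr_ge0// edist_ge0.
rewrite exprMn; apply: ler_wpM2r; first exact: sqr_ge0.
nra.
Qed.

Lemma cpf_second_moment (phi : dx.-tuple R -> R) (s Lp : R) p :
  measurable_fun setT phi -> 0 <= s -> 0 <= Lp ->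
  (forall x, `|phi x| <= s) -> (forall x y, `|phi x - phi y| <= Lp * Defs.edist x y) ->
  (\int[Pr]_w (Psi h Y F p.+1 phi l.+1 w ^+ 2)%:E <=
   (estimate_cst (lik_cst dy H) (path_cst dx dy K H Kh) p * (4 * (s + Lp) ^+ 2) *
    (Num.sqrt (delta R l.+1) / N%:R + delta R l.+1))%:E)%E.
Proof.
move=> mphi s0 L0 phis phiL; have tp := test_pair_test mphi s0 L0 phis phiL.
have mt := tp_measf tp.
have k0 : 0 <= 4 * (s + Lp) ^+ 2 by rewrite mulr_ge0// sqr_ge0.
under eq_integral => w _ do rewrite PsiE.
pose f (q : (1.-tuple ((2 ^ l.+1).-tuple (dy.-tuple R)) * (R * R)) * N.-tuple (Ef * Ec)) : \bar R :=
  (estimate (@endpoint R dx l.+1) (@endpoint R dx l) Gf Gc (test phi) (test phi)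
    q.1.1 (q.1.2, q.2) ^+ 2)%:E.
have nf : nnm f.
  apply: (nnm_estimate (@meas_endpoint R dx l.+1) (@meas_endpoint R dx l) mGf mGc mt mt
    (y := fun q => q.1.1) (s := fun q => (q.1.2, q.2))); meas.
rewrite (filter_law (mu := blocks dy l.+1) (1 : R, 1 : R) (upd := upd)
  (k0 := kernel0) (k := kernel) (Y := yb) (U := U) (G := past_events Y F l.+1)
  (meas_updcpf mGf mGc) _ _ _ _ _ law_first law_next p nf).
- have D0 : 0 < delta R l.+1 by exact: delta_gt0.
  have := @chain_estimate R _ _ _ _ _ _ _ _ _ _ (noise dx l.+1) (blocks dy l.+1) N Pf Pc
    (@endpoint R dx l.+1) (@start R dx l.+1) (@endpoint R dx l) (@start R dx l)
    Gf Gc (@level_dist R dx dy h l) (trunc_dist l.+1) xstar (delta R l.+1) (lik_cst dy H)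
    (path_cst dx dy K H Kh) N0 mPf mPc (@meas_endpoint _ _ l.+1) (@meas_endpoint _ _ l)
    (@meas_start_point _ _ l.+1) (@meas_start_point _ _ l) mGf mGc (meas_level_dist mh (l := l))
    (@meas_trunc_dist _ _ l.+1) Gf0 Gc0 (block_lik_bounded hH (l := l.+1))
    (block_lik2_bounded hH (l := l)) _ D0 (trunc_dist_ge l.+1) (trunc_dist_le2 l.+1)
    (trunc_distxx l.+1) _ _ _ (path_cst_ge0 dy H reg Kh0) (block_lik_sqr hH (l := l.+1))
    (block_lik2_sqr hH (l := l)) (block_lik_gap hH (l := l)) (path_gap_level reg mh hH hK Kh0 l)
    p 0 (test phi) (test phi) _ k0 tp.
  apply.
  + by move=> e ec; exact: sqdist_ge0.
  + by move=> x v; exact: start_euler_path.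
  + by move=> x v; exact: start_euler_path.
  + exact: lik_cst_ge0.
- by move=> C mC; exact: meas_kap.
- by move=> q; exact: (past_events_measurable BM runs).
- by move=> q r; exact: measurable_block_past.
- by move=> q r rq; exact: measurable_cpf_pairs_past.
- exact: block_law.
Qed.

End cpf_moment.

(** * Second moment of the particle filter at level 0 *)

Section pf_moment.
Context {R : realType} (dx dy : nat) d (Om : measurableType d) (Pr : probability Om R)
  (Y : R -> Om -> dy.-tuple R).
Context (xstar : dx.-tuple R) (h : dx.-tuple R -> dy.-tuple R)
  (b : dx.-tuple R -> dx.-tuple R) (sigma : dx.-tuple R -> 'M[R]_dx) (K H : R).
Context (N : nat) (F : filters R dx N Om).
Hypothesis BM : standard_brownian_motion Pr Y.
Hypothesis runs : runs_filters xstar h b sigma Pr Y F.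
Hypothesis reg : euler_regular b sigma K.
Hypothesis mh : forall i, measurable_fun setT (fun x => tnth (h x) i).
Hypothesis hH : forall x i, `|tnth (h x) i| <= H.
Hypothesis N0 : (0 < N)%N.

Let E := level_path R dx 0.
Let B := (2 ^ 0).-tuple (dy.-tuple R).
Let W := (2 ^ 0).-tuple (dx.-tuple R).
Let Pf x (v : W) : E := euler_path b sigma x v.
Let G (y : B) (u : E) := block_lik h y u.
Let mPf := meas_euler_path reg (l := 0).
Let mG := meas_block_lik mh (l := 0).
Let G0 y u : 0 < G y u. Proof. exact: block_lik_gt0. Qed.
Let ST := (B * N.-tuple E)%type.
Let yb := block Y 0.
Let U := pf_paths F.
Let mu := blocks dy 0 : probability B R.

Let pf_weight i (s : ST) : R := G s.1 (tnth s.2 i) / \sum_j G s.1 (tnth s.2 j).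

Let pf_draw i (s : ST) (v : W) : E := Pf (endpoint (tnth s.2 i)) v.

Let pf_weight_ge0 i s : 0 <= pf_weight i s.
Proof. by apply: normalized_ge0 => // j; exact: G0. Qed.

Let pf_weight_sum s : \sum_i pf_weight i s = 1.
Proof. by apply: normalized_sum => // j; exact: G0. Qed.

Let meas_pf_weight i : measurable_fun setT (pf_weight i).
Proof.
apply: measurable_funM; first by apply: mG; meas.
apply: measurable_inv_ge0 => [|s].
  by apply: meas_sum => j; apply: mG; meas.
by apply: sumr_ge0 => j _; exact: ltW.
Qed.

Let meas_pf_draw i : measurable_fun setT (fun p : ST * W => pf_draw i p.1 p.2).
Proof. by apply: mPf; [apply: meas_endpoint|]; meas. Qed.

Let kernel : ST -> probability E R :=
  kmix (noise dx 0) pf_weight_ge0 pf_weight_sum meas_pf_draw.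

Let meas_first : measurable_fun setT (fun v : W => Pf xstar v).
Proof. by apply: mPf; meas. Qed.

Let kernel0 : probability E R := sval (cid (int_push (noise dx 0) meas_first)).

Let kernel0_law C : measurable C -> kernel0 C = euler_law b sigma xstar C.
Proof.
move=> mC; rewrite (euler_lawE reg)// -(int_indicT kernel0 mC) /kernel0.
by case: cid => m /= ->//; exact: nnm_indic.
Qed.

Let weightE p w i :
  weight h (data Y w) p (fun j => pf_path F p j w) i = pf_weight i (yb p w, U p w).
Proof.
rewrite /weight /pf_weight /= /G /yb path_potentialE tnth_mktuple; congr (_ / _).
by apply: eq_bigr => j _; rewrite path_potentialE tnth_mktuple.
Qed.

Let kernel_law p w C : measurable C -> kernel (yb p w, U p w) C =
  (\sum_(k < N) (weight h (data Y w) p (fun j => pf_path F p j w) k)%:E *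
             euler_law b sigma (endpoint (pf_path F p k w)) C)%E.
Proof.
move=> mC; rewrite /kernel kmix_set//; apply: eq_bigr => i _.
by rewrite weightE (euler_lawE reg)// /pf_draw /= tnth_mktuple.
Qed.

Let law_first C (A : 'I_N -> set E) : <<s past_events Y F 0 0 >> C ->
  (forall i, measurable (A i)) ->
  (Pr (C `&` U 0 @^-1` rect A) = Pr C * \big[*%E/1%E]_(i < N) kernel0 (A i))%E.
Proof.
move=> pC mA; have [[_ law _] _] := runs.
rewrite setI_rect_mktuple (law _ _ pC mA); congr (_ * _)%E.
by apply: eq_bigr => i _; rewrite kernel0_law.
Qed.

Let law_next p C (A : 'I_N -> set E) : <<s past_events Y F 0 p.+1 >> C ->
  (forall i, measurable (A i)) ->
  (Pr (C `&` U p.+1 @^-1` rect A) =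
   \int[Pr]_(w in C) \big[*%E/1%E]_(i < N) kernel (yb p w, U p w) (A i))%E.
Proof.
move=> pC mA; have [[_ _ law] _] := runs.
rewrite setI_rect_mktuple (law _ _ _ pC mA); apply: eq_integral => w _.
by apply: eq_bigr => i _; rewrite kernel_law.
Qed.

Let upd (a : R) (y : B) (u : N.-tuple E) : R := a * avg (fun i => G y (tnth u i)).

Let meas_upd d' (T : measurableType d') (a : T -> R) (y : T -> B) (u : T -> N.-tuple E) :
  measurable_fun setT a -> measurable_fun setT y -> measurable_fun setT u ->
  measurable_fun setT (fun t => upd (a t) (y t) (u t)).
Proof.
move=> ma my mu'; apply: measurable_funM => //; apply: meas_avg => i.
by apply: mG => //; meas.
Qed.

Let accE p w : acc (1 : R) upd yb U p w =
  \prod_(r < p) (N%:R^-1 * \sum_(i < N) path_potential h (data Y w) r (pf_path F r i w)).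
Proof.
elim: p => [|p IH]; first by rewrite big_ord0.
rewrite /= IH /upd !big_ord_recr /= /avg; congr (_ * (_ * _)).
by apply: eq_bigr => i _; rewrite tnth_mktuple path_potentialE.
Qed.

Let upd_sqr a u : (\int[mu]_y (upd a y u ^+ 2)%:E <= (lik_cst dy H * a ^+ 2)%:E)%E.
Proof.
have ni0 : 0 <= N%:R^-1 :> R by rewrite invr_ge0.
have nG i : nnm (fun y => (G y (tnth u i) ^+ 2)%:E).
  apply: nnm_EFin => [|y]; last exact: sqr_ge0.
  by apply: meas_sqr; apply: mG; meas.
have nc c : 0 <= c -> nnm (fun _ : B => c%:E) by move=> c0; exact: nnm_cst.
have nS : nnm (fun y => (N%:R^-1)%:E * \sum_i (G y (tnth u i) ^+ 2)%:E)%E.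
  by apply: nnm_mul; [exact: nc|exact: nnm_sum].
apply: (@le_trans _ _ (\int[mu]_y ((a ^+ 2)%:E *
    ((N%:R^-1)%:E * \sum_i (G y (tnth u i) ^+ 2)%:E)))%E).
  apply: int_le.
  - apply: nnm_EFin => [|y]; last exact: sqr_ge0.
    by apply: meas_sqr; apply: meas_upd; meas.
  - by apply: nnm_mul => //; apply: nc; exact: sqr_ge0.
  move=> y; rewrite sumEFin -!EFinM lee_fin /upd exprMn.
  by apply: ler_wpM2l; [exact: sqr_ge0|exact: mean_sqr_le].
rewrite int_scale//; last exact: sqr_ge0.
rewrite int_scale//; last exact: nnm_sum.
rewrite int_sum// [lik_cst dy H * _]mulrC [X in (_ <= X)%E]EFinM; apply: lee_wpmul2l; first by rewrite lee_fin sqr_ge0.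
apply: (@le_trans _ _ ((N%:R^-1)%:E * \sum_(i < N) (lik_cst dy H)%:E)%E).
  apply: lee_wpmul2l; first by rewrite lee_fin.
  by apply: lee_sum => i _; exact: (block_lik_sqr hH).
rewrite sumEFin sumr_const card_ord -EFinM lee_fin -[lik_cst dy H *+ N]mulr_natl.
by rewrite mulKf// gt_eqF// ltr0n.
Qed.

Let meas_kernel C : measurable C -> measurable_fun setT (fun s => kernel s C).
Proof. by apply: measurable_kmix; exact: meas_pf_weight. Qed.

Let mupd : measurable_fun setT (fun p : (R * B) * N.-tuple E => upd p.1.1 p.1.2 p.2).
Proof. by apply: meas_upd; meas. Qed.

Let nnm_acc c : 0 <= c -> nnm (fun s : R * N.-tuple E => (c * s.1 ^+ 2)%:E).
Proof.
move=> c0; apply: nnm_EFin => [|s]; last by apply: mulr_ge0 => //; exact: sqr_ge0.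
by apply: measurable_funM; meas.
Qed.

Let int_upd_le c a u : 0 <= c ->
  (\int[mu]_y (c * upd a y u ^+ 2)%:E <= (c * lik_cst dy H * a ^+ 2)%:E)%E.
Proof.
move=> c0; under eq_integral => y _ do rewrite EFinM.
rewrite int_scale//; last first.
  apply: nnm_EFin => [|y]; last exact: sqr_ge0.
  by apply: meas_sqr; apply: meas_upd; meas.
by rewrite -mulrA EFinM; apply: lee_wpmul2l; [rewrite lee_fin|exact: upd_sqr].
Qed.

Let chain_sqr p (c : R) : 0 <= c ->
  (chain mu (1%R : R) upd kernel0 kernel p (fun s : R * N.-tuple E => (c * s.1 ^+ 2)%:E) <=
   (c * lik_cst dy H ^+ p)%:E)%E.
Proof.
have l0 := lik_cst_ge0 dy H.
elim: p c => [|p IH] c c0 /=; first by rewrite int_cst expr1n.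
apply: (@le_trans _ _ (chain mu (1%R : R) upd kernel0 kernel p
    (fun s : R * N.-tuple E => (c * lik_cst dy H * s.1 ^+ 2)%:E))).
  apply: (chain_le _ _ _ mupd meas_kernel).
  - exact: (nnm_transition _ mupd meas_kernel (nnm_acc c0)).
  - by apply: nnm_acc; exact: mulr_ge0.
  move=> s; rewrite /transition; under eq_integral => y _ do rewrite /= int_cst.
  exact: int_upd_le.
by rewrite exprS mulrA; apply: IH; exact: mulr_ge0.
Qed.

Let estimate_pf (phi : dx.-tuple R -> R) (q : (1.-tuple B * R) * N.-tuple E) : R :=
  q.1.2 * avg (fun i => G (tnth q.1.1 ord0) (tnth q.2 i) * phi (endpoint (tnth q.2 i))).

Let estimate_pf_le phi s q : (forall x, `|phi x| <= s) ->
  estimate_pf phi q ^+ 2 <= s ^+ 2 * upd q.1.2 (tnth q.1.1 ord0) q.2 ^+ 2.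
Proof.
move=> phis; rewrite /estimate_pf /upd.
set a := q.1.2; set A := avg _; set A' := avg _.
have -> : (a * A) ^+ 2 = a ^+ 2 * A ^+ 2 by ring.
have -> : s ^+ 2 * (a * A') ^+ 2 = a ^+ 2 * (s * A') ^+ 2 by ring.
have s0 : 0 <= s by apply: le_trans (phis xstar).
have ni0 : 0 <= N%:R^-1 :> R by rewrite invr_ge0.
apply: ler_wpM2l; first exact: sqr_ge0.
rewrite -real_normK ?num_real//; apply: lerXn2r; rewrite ?nnegrE//.
  by apply: mulr_ge0 => //; apply: mulr_ge0 => //; apply: sumr_ge0 => i _; exact: ltW.
rewrite /A /A' /avg normrM ger0_norm// [leRHS]mulrCA; apply: ler_wpM2l => //.
apply: le_trans (ler_norm_sum _ _ _) _; rewrite mulr_sumr; apply: ler_sum => i _.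
by rewrite normrM gtr0_norm// mulrC; apply: ler_wpM2r; [exact: ltW|exact: phis].
Qed.

Let PsiE phi p w : Psi h Y F p.+1 phi 0 w =
  estimate_pf phi ((window yb p 1 w, acc (1 : R) upd yb U p w), U p w).
Proof.
rewrite /estimate_pf accE /= /gamma_estimate /avg /=; congr (_ * (_ * _)).
by apply: eq_bigr => i _; rewrite !tnth_mktuple addn0 path_potentialE.
Qed.

Lemma pf_second_moment (phi : dx.-tuple R -> R) (s : R) p :
  measurable_fun setT phi -> (forall x, `|phi x| <= s) ->
  (\int[Pr]_w (Psi h Y F p.+1 phi 0 w ^+ 2)%:E <=
   (lik_cst dy H ^+ p.+1 * s ^+ 2)%:E)%E.
Proof.
move=> mphi phis; have s20 : 0 <= s ^+ 2 by exact: sqr_ge0.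
have l0 := lik_cst_ge0 dy H.
under eq_integral => w _ do rewrite PsiE.
pose f q := (estimate_pf phi q ^+ 2)%:E : \bar R.
have nf : nnm f.
  apply: nnm_EFin => [|q]; last exact: sqr_ge0.
  apply: meas_sqr; apply: measurable_funM; first by meas.
  apply: meas_avg => i; apply: measurable_funM; first by apply: mG; meas.
  by apply: (measurableT_comp mphi); apply: meas_endpoint; meas.
rewrite (filter_law (mu := mu) (1 : R) (upd := upd)
  (k0 := kernel0) (k := kernel) (Y := yb) (U := U) (G := past_events Y F 0)
  mupd meas_kernel _ _ _ _ law_first law_next p nf).
- apply: (@le_trans _ _ (chain mu (1%R : R) upd kernel0 kernel p
      (fun q : R * N.-tuple E => (s ^+ 2 * lik_cst dy H * q.1 ^+ 2)%:E))); last first.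
    have -> : lik_cst dy H ^+ p.+1 * s ^+ 2 = s ^+ 2 * lik_cst dy H * lik_cst dy H ^+ p.
      by rewrite exprS; ring.
    by apply: chain_sqr; exact: mulr_ge0.
  apply: (chain_le _ _ _ mupd meas_kernel).
  + apply: (nnm_int (iid mu 1) (f := fun q => f ((q.2, q.1.1), q.1.2))).
    by apply: (nnm_comp nf); meas.
  + by apply: nnm_acc; exact: mulr_ge0.
  move=> q; apply: le_trans (int_upd_le q.1 q.2 s20).
  have nu : nnm (fun y => (s ^+ 2 * upd q.1 y q.2 ^+ 2)%:E).
    apply: nnm_EFin => [|y]; last by apply: mulr_ge0 => //; exact: sqr_ge0.
    by apply: measurable_funM; [|apply: meas_sqr; apply: meas_upd]; meas.
  rewrite -(iid_coord mu (ord0 : 'I_1) nu); apply: int_le.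
  - by apply: (nnm_comp nf (g := fun y => ((y, q.1), q.2))); meas.
  - by apply: (nnm_comp nu (g := fun y => tnth y ord0)); meas.
  by move=> y; rewrite lee_fin; exact: estimate_pf_le.
- by move=> q; exact: (past_events_measurable BM runs).
- by move=> q r; exact: measurable_block_past.
- by move=> q r rq; exact: measurable_pf_paths_past.
- exact: block_law.
Qed.

End pf_moment.

(** * Randomization over the levels *)

Section random_level.
Context {R : realType} d (Om : measurableType d) (Pr : probability Om R).

Lemma int_restrict (D : set Om) (mD : measurable D) (f : Om -> \bar R) : nnm f ->
  (\int[mrestr Pr mD]_x f x = \int[Pr]_(x in D) f x)%E.
Proof.
move=> nf; rewrite (int_density (mu := Pr) (g := \1_D)) //.
- by rewrite [RHS]integral_mkcond; apply: eq_integral => x _; rewrite epatch_indic.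
- by move=> A mA; rewrite integral_indic// /mrestr setIC.
Qed.

(** The image under [X] of the measure restricted to [D] is [Pr D] times the law of [X]. *)
Lemma int_independent (D : set Om) (X : Om -> R) (f : R -> \bar R) :
  measurable D -> measurable_fun setT X -> nnm f ->
  (forall B, measurable B -> Pr (D `&` X @^-1` B) = Pr D * Pr (X @^-1` B))%E ->
  (\int[Pr]_(w in D) f (X w) = Pr D * \int[Pr]_w f (X w))%E.
Proof.
move=> mD mX nf ind; have [mf f0] := nf.
have pf : Pr D \is a fin_num by exact: fin_num_measure.
have p0 : 0 <= fine (Pr D) by exact: fine_ge0.
have f0' : {in [set: R], forall y, 0 <= f y}%E by move=> y _; exact: f0.
rewrite -(int_restrict mD (nnm_comp nf mX)).
have := ge0_integral_pushforward mX (mrestr Pr mD) measurableT mf f0'.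
have := ge0_integral_pushforward mX Pr measurableT mf f0'.
rewrite preimage_setT => <- <-.
rewrite -(fineK pf) -[fine (Pr D)]/((NngNum p0)%:num) -ge0_integral_mscale//.
apply: eq_measure_integral => A mA _; rewrite /= /mscale /= /pushforward /mrestr fineK//.
by rewrite setIC; exact: ind.
Qed.

Variables (L : Om -> nat) (g : nat -> Om -> R).
Hypotheses (mL : measurable_fun setT L) (mg : forall l, measurable_fun setT (g l)).

Lemma measurable_level l : measurable [set w | L w = l].
Proof. by rewrite -[X in measurable X]setTI; apply: (@mL measurableT [set l]). Qed.

Lemma bigcup_level : \bigcup_l [set w | L w = l] = setT.
Proof. by apply/seteqP; split=> // w _; exists (L w). Qed.

Lemma int_random_level : (forall l w, 0 <= g l w) ->
  (\int[Pr]_w (g (L w) w)%:E =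
   \sum_(l <oo) \int[Pr]_(w in [set w | L w = l]) (g l w)%:E)%E.
Proof.
move=> g0.
have mgL : measurable_fun setT (fun w => g (L w) w).
  move=> _ B mB; rewrite setTI.
  rewrite (_ : _ @^-1` _ = \bigcup_l ([set w | L w = l] `&` g l @^-1` B)).
    apply: bigcup_measurable => l _; apply: measurableI; first exact: measurable_level.
    by rewrite -[X in measurable X]setTI; exact: mg.
  apply/seteqP; split=> w /=; first by move=> Bw; exists (L w).
  by move=> [l _ [<-]].
rewrite -bigcup_level ge0_integral_bigcup.
- apply: eq_eseriesr => l _; apply: eq_integral => w /set_mem /= <- //.
- exact: measurable_level.
- by rewrite bigcup_level; exact/measurable_EFinP.
- by move=> w _; rewrite lee_fin.
- apply/trivIsetP => i j _ _ ij; apply/seteqP; split=> // w [/= Li Lj].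
  by move/eqP: ij; rewrite -Li -Lj.
Qed.

End random_level.

(** * Tail masses and weighted sums of squares *)

Section tail_masses.
Context {R : realType} (P : nat -> R).
Hypothesis PP : positive_pmf P.

Let P0 l : 0 < P l. Proof. by case: PP. Qed.

Lemma tail_fin l : (\sum_(l <= q <oo) (P q)%:E)%E \is a fin_num.
Proof.
have h n : (0 <= (P n)%:E)%E by rewrite lee_fin ltW.
rewrite ge0_fin_numE; last by apply: nneseries_ge0.
apply: (@le_lt_trans _ _ 1%E); last by rewrite ltry.
have [_ <-] := PP; rewrite (nneseries_split 0 l)// add0n leeDr//.
by apply: sume_ge0.
Qed.

(** Makes the undivided first term of the coupled sum fit the pattern [a l / Q l]. *)
Lemma tail_mass0 : tail_mass P 0 = 1.
Proof. by rewrite /tail_mass; have [_ ->] := PP. Qed.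

Lemma tail_massS l : tail_mass P l = P l + tail_mass P l.+1.
Proof.
rewrite /tail_mass (nneseries_split l 1); last by move=> k _; rewrite lee_fin ltW.
by rewrite addn1 big_nat1 fineD// tail_fin.
Qed.

Lemma tail_mass_gt0 l : 0 < tail_mass P l.
Proof.
rewrite tail_massS; apply: ltr_wpDr => //; apply: fine_ge0; apply: nneseries_ge0 => n _ _.
by rewrite lee_fin ltW.
Qed.

End tail_masses.

Section coupled_sum_inequalities.
Context {R : realType}.
Variables (P Q : nat -> R).
Hypotheses (Q0 : forall l, 0 < Q l) (QS : forall l, Q l = P l + Q l.+1).

Definition partial_sum (a : nat -> R) n : R := \sum_(l < n) a l / Q l.

(** A rational [r < 1] with [3 / 4 <= r ^+ 2], where [3 / 4] is the decay rate of [nu]; the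
    geometric series [r / (1 - r)] is then [7]. *)
Definition ratio : R := 7 / 8.

Lemma ratio_gt0 : 0 < ratio. Proof. by rewrite /ratio; lra. Qed.

Lemma weighted_amgm (c x y : R) : 0 < c -> 2 * (`|x| * `|y|) <= c * x ^+ 2 + c^-1 * y ^+ 2.
Proof.
move=> c0; rewrite -subr_ge0 -(real_normK (num_real x)) -(real_normK (num_real y)).
have -> : c * `|x| ^+ 2 + c^-1 * `|y| ^+ 2 - 2 * (`|x| * `|y|) = c^-1 * (c * `|x| - `|y|) ^+ 2.
  by field; rewrite gt_eqF.
by apply: mulr_ge0; [rewrite invr_ge0 ltW|exact: sqr_ge0].
Qed.

(* Summation by parts, with [P l = Q l - Q l.+1]. *)
Lemma weighted_squares_parts (a : nat -> R) m :
  \sum_(n < m) P n * partial_sum a n.+1 ^+ 2 + Q m * partial_sum a m ^+ 2 <=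
  \sum_(l < m) ((Q l)^-1 * a l ^+ 2 + 2 * (`|partial_sum a l| * `|a l|)).
Proof.
elim: m => [|m IH]; first by rewrite !big_ord0 /partial_sum big_ord0 expr0n mulr0 addr0.
rewrite !big_ord_recr /= -addrA -mulrDl -QS.
apply: (@le_trans _ _ (\sum_(n < m) P n * partial_sum a n.+1 ^+ 2 + Q m * partial_sum a m ^+ 2
  + ((Q m)^-1 * a m ^+ 2 + 2 * (`|partial_sum a m| * `|a m|)))); last by rewrite lerD2r.
rewrite -addrA lerD2l {1}/partial_sum big_ord_recr /= -/(partial_sum a m).
have -> : Q m * (partial_sum a m + a m / Q m) ^+ 2 =
  Q m * partial_sum a m ^+ 2 + ((Q m)^-1 * a m ^+ 2 + 2 * (partial_sum a m * a m)).
  by field; rewrite gt_eqF.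
by rewrite !lerD2l ler_pM2l// -normrM ler_norm.
Qed.

(** The weight [ratio ^+ (l - j)] in Young's inequality discounts the earlier square and inflates
    the later one; the decay of [nu] pays for the inflation in [discount_sum_le]. *)
Lemma weighted_squares_le (a : nat -> R) m : (forall l, 0 <= P l) ->
  \sum_(n < m) P n * partial_sum a n.+1 ^+ 2 <=
  \sum_(l < m) ((Q l)^-1 * a l ^+ 2 + \sum_(j < l)
    ((Q j)^-1 * ratio ^+ (l - j) * a j ^+ 2 + (Q j)^-1 * (ratio ^+ (l - j))^-1 * a l ^+ 2)).
Proof.
move=> P0; apply: (@le_trans _ _ (\sum_(n < m) P n * partial_sum a n.+1 ^+ 2 +
    Q m * partial_sum a m ^+ 2)).
  by rewrite lerDl mulr_ge0 ?sqr_ge0// ltW.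
apply: (le_trans (weighted_squares_parts a m)); apply: ler_sum => l _; rewrite lerD2l.
apply: (@le_trans _ _ (2 * (\sum_(j < l) `|a j / Q j| * `|a l|))).
  rewrite ler_pM2l// -mulr_suml; apply: ler_wpM2r => //.
  exact: ler_norm_sum.
rewrite mulr_sumr; apply: ler_sum => j _.
have r0 : 0 < ratio ^+ (l - j) by rewrite exprn_gt0 ?ratio_gt0.
have qi : 0 <= (Q j)^-1 by rewrite invr_ge0 ltW.
rewrite normrM (ger0_norm qi) -!mulrA -mulrDr.
have -> : 2 * (`|a j| * ((Q j)^-1 * `|a l|)) = (Q j)^-1 * (2 * (`|a j| * `|a l|)) by ring.
by apply: ler_wpM2l => //; exact: weighted_amgm.
Qed.

Lemma geometric_double_sum (c : nat -> R) m : (forall l, 0 <= c l) ->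
  \sum_(l < m) \sum_(j < l) ratio ^+ (l - j) * c j <= 7 * \sum_(l < m) c l.
Proof.
move=> c0; pose G l := \sum_(j < l) ratio ^+ (l - j) * c j.
have G0 l : 0 <= G l.
  by apply: sumr_ge0 => j _; rewrite mulr_ge0// exprn_ge0// ltW// ratio_gt0.
have GS l : G l.+1 = ratio * (G l + c l).
  rewrite /G big_ord_recr /= subSnn expr1 mulrDr mulr_sumr; congr (_ + _).
  by apply: eq_bigr => j _; rewrite subSn ?exprS ?mulrA// ltnW.
(* The extra [8 * G m] makes the induction step exact, because [8 * ratio = 7]. *)
suff : \sum_(l < m) G l + 8 * G m <= 7 * \sum_(l < m) c l by have := G0 m; lra.
elim: m => [|m IH]; first by rewrite !big_ord0 /G big_ord0 !mulr0 addr0.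
by rewrite !big_ord_recr /= GS /ratio; lra.
Qed.

(** As [3 / 4 <= ratio ^+ 2], the inflated later term is at most the discounted earlier one. The
    diagonal counts once and the two discounted double sums [7] times each, whence [15]. *)
Lemma discount_sum_le (nu : nat -> R) m : (forall l, 0 <= nu l) ->
  (forall l, nu l.+1 <= 3 / 4 * nu l) ->
  \sum_(l < m) ((Q l)^-1 * nu l + \sum_(j < l)
    ((Q j)^-1 * ratio ^+ (l - j) * nu j + (Q j)^-1 * (ratio ^+ (l - j))^-1 * nu l)) <=
  15 * \sum_(l < m) (Q l)^-1 * nu l.
Proof.
move=> nu0 nuS; have qi l : 0 <= (Q l)^-1 by rewrite invr_ge0 ltW.
have nuk k l : nu (l + k)%N <= (3 / 4) ^+ k * nu l.
  elim: k => [|k IH]; first by rewrite addn0 mul1r.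
  rewrite addnS; apply: (le_trans (nuS _)); rewrite exprS -[leRHS]mulrA.
  by apply: ler_wpM2l; [lra|exact: IH].
have step j l : (j < l)%N -> (ratio ^+ (l - j))^-1 * nu l <= ratio ^+ (l - j) * nu j.
  move=> jl; set k := (l - j)%N; have -> : l = (j + k)%N by rewrite subnKC// ltnW.
  have rk : 0 < ratio ^+ k by rewrite exprn_gt0 ?ratio_gt0.
  rewrite mulrC ler_pdivrMr//; apply: (le_trans (nuk _ _)).
  rewrite mulrAC -exprMn; apply: ler_wpM2r => //; apply: lerXn2r; rewrite ?nnegrE /ratio; lra.
have c0 l : 0 <= (Q l)^-1 * nu l by exact: mulr_ge0.
have := geometric_double_sum m c0.
set D := \sum_(l < m) \sum_(j < l) _ => hD.
apply: (@le_trans _ _ (\sum_(l < m) (Q l)^-1 * nu l + 2 * D)); last by lra.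
rewrite big_split /= lerD2l /D mulr_sumr; apply: ler_sum => l _; rewrite mulr_sumr.
apply: ler_sum => j _; have := ler_wpM2l (qi j) (step j l (ltn_ord j)).
lra.
Qed.

End coupled_sum_inequalities.

Section level_rate.
Context {R : realType} (N : nat).

Definition level_rate l : R := Num.sqrt (delta R l) / N%:R + delta R l.

Lemma level_rate_ge0 l : 0 <= level_rate l.
Proof. by rewrite addr_ge0// ?divr_ge0 ?sqrtr_ge0// ltW// delta_gt0. Qed.

Lemma level_rate0 : 1 <= level_rate 0.
Proof.
have d0 : delta R 0 = 1 by rewrite /delta expr0 invr1.
by rewrite /level_rate d0 lerDr divr_ge0// sqrtr_ge0.
Qed.

(** The slower part [sqrt (delta l)] decays by [1 / sqrt 2], which is below [3 / 4]. *)
Lemma level_rateS l : level_rate l.+1 <= 3 / 4 * level_rate l.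
Proof.
have D0 : 0 < delta R l.+1 by exact: delta_gt0.
have Dl : 0 < delta R l by exact: delta_gt0.
have e := deltaS l : delta R l = 2 * delta R l.+1.
have h : Num.sqrt (delta R l.+1) <= 3 / 4 * Num.sqrt (delta R l).
  rewrite -(ler_sqr (sqrtr_ge0 _)); last by rewrite nnegrE mulr_ge0 ?sqrtr_ge0//; lra.
  by rewrite exprMn !sqr_sqrtr ?ltW// e; lra.
rewrite /level_rate mulrDr; apply: lerD; last by lra.
by rewrite mulrA; apply: ler_wpM2r => //; rewrite invr_ge0.
Qed.

End level_rate.

Section randomized_estimators.
Context {R : realType} d (Om : measurableType d) (Pr : probability Om R).
Variables (P : nat -> R) (L : Om -> nat) (a : nat -> Om -> R) (G : set_system Om).
Variables (M : R) (nu : nat -> R).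
Hypothesis PP : positive_pmf P.
Hypotheses (mL : measurable_fun setT L) (PL : forall l, Pr [set w | L w = l] = (P l)%:E).
Hypothesis ma : forall l, measurable_fun setT (a l).
Hypothesis aG : forall l, generated_by (a l) `<=` G.
Hypothesis indep : forall l A, <<s G >> A ->
  (Pr ([set w | L w = l] `&` A) = Pr [set w | L w = l] * Pr A)%E.
Hypotheses (M0 : 0 <= M) (nu0 : forall l, 0 <= nu l).
Hypothesis a_sqr : forall l, (\int[Pr]_w (a l w ^+ 2)%:E <= (M * nu l)%:E)%E.

Let P0 l : 0 < P l. Proof. by case: PP. Qed.
Local Notation Q := (tail_mass P).
Let Q0 l : 0 < Q l. Proof. exact: tail_mass_gt0. Qed.

Let na l : nnm (fun w => (a l w ^+ 2)%:E).
Proof. by apply: nnm_EFin => [|w]; [exact: meas_sqr|exact: sqr_ge0]. Qed.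

Let int_level l (X : Om -> R) : measurable_fun [set: g_sigma_algebraType G] X ->
  measurable_fun setT X ->
  (\int[Pr]_(w in [set w | L w = l]) (X w ^+ 2)%:E = (P l)%:E * \int[Pr]_w (X w ^+ 2)%:E)%E.
Proof.
move=> mX mX'.
have ns : nnm (fun x : R => (x ^+ 2)%:E).
  by apply: nnm_EFin => [|x]; [apply: meas_sqr; exact: measurable_id|exact: sqr_ge0].
rewrite (int_independent (measurable_level mL l) mX' ns) ?PL// => B mB.
by rewrite -PL; apply: indep; have := mX measurableT B mB; rewrite setTI.
Qed.

(** On the event [L = l], of probability [P l], the square carries [(P l)^-1 ^+ 2]; independence
    leaves one factor [(P l)^-1]. *)
Lemma single_term_bound :
  (\int[Pr]_w ((a (L w) w / P (L w)) ^+ 2)%:E <=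
   M%:E * \sum_(0 <= l <oo) ((P l)^-1 * nu l)%:E)%E.
Proof.
have h l : 0 <= (P l)^-1 * nu l by rewrite mulr_ge0// invr_ge0 ltW.
rewrite (int_random_level Pr mL (g := fun l w => (a l w / P l) ^+ 2)); last 2 first.
- by move=> l; apply: meas_sqr; apply: measurable_funM => //; exact: measurable_cst.
- by move=> l w; exact: sqr_ge0.
rewrite -nneseriesZl; last by move=> l _; rewrite lee_fin.
apply: lee_nneseries => [l _ _|l _].
  by apply: integral_ge0 => w _; rewrite lee_fin sqr_ge0.
have mi : measurable_fun setT (fun w => a l w / P l).
  by apply: measurable_funM => //; exact: measurable_cst.
rewrite (@int_level l (fun w => a l w / P l)) => //; last first.
  apply: (measurable_funM (T := g_sigma_algebraType G)); last exact: measurable_cst.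
  exact: measurable_generated.
under eq_integral => w _ do rewrite exprMn mulrC EFinM.
rewrite int_scale//; last exact: sqr_ge0.
rewrite muleA -EFinM.
have -> : P l * (P l)^-1 ^+ 2 = (P l)^-1 by field; rewrite gt_eqF.
have pi : 0 <= (P l)^-1 by rewrite invr_ge0 ltW.
apply: (@le_trans _ _ (((P l)^-1)%:E * (M * nu l)%:E)%E).
  by apply: lee_wpmul2l.
by rewrite -!EFinM mulrCA.
Qed.

Hypothesis nuS : forall l, nu l.+1 <= 3 / 4 * nu l.

Let int_coef c l : 0 <= c -> (\int[Pr]_w (c * a l w ^+ 2)%:E <= (M * (c * nu l))%:E)%E.
Proof.
move=> c0; under eq_integral => w _ do rewrite EFinM.
by rewrite int_scale// mulrCA EFinM; apply: lee_wpmul2l.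
Qed.

Let nnm_coef c l : 0 <= c -> nnm (fun w => (c * a l w ^+ 2)%:E).
Proof.
move=> c0; apply: nnm_EFin => [|w]; last by apply: mulr_ge0 => //; exact: sqr_ge0.
by apply: measurable_funM; [exact: measurable_cst|exact: meas_sqr].
Qed.

Let meas_partial d' (T : measurableType d') (b : nat -> T -> R) n :
  (forall l, measurable_fun setT (b l)) ->
  measurable_fun setT (fun t => partial_sum Q (fun l => b l t) n).
Proof.
move=> mb; apply: meas_sum => l; apply: measurable_funM => //; exact: measurable_cst.
Qed.

Let partial_bound m :
  (\sum_(0 <= n < m) (P n)%:E * \int[Pr]_w (partial_sum Q (a^~ w) n.+1 ^+ 2)%:E <=
   (M * (15 * \sum_(l < m) (Q l)^-1 * nu l))%:E)%E.
Proof.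
pose f n w := partial_sum Q (a^~ w) n.+1 ^+ 2.
have nf n : nnm (fun w => (f n w)%:E).
  apply: nnm_EFin => [|w]; last exact: sqr_ge0.
  by apply: meas_sqr; exact: meas_partial.
have Pl0 l : 0 <= P l by exact: ltW.
have qi l : 0 <= (Q l)^-1 by rewrite invr_ge0 ltW.
have r0 k : 0 <= ratio ^+ k :> R by rewrite exprn_ge0// ltW// ratio_gt0.
have ri k : 0 <= (ratio ^+ k)^-1 :> R by rewrite invr_ge0.
have c1 l j : 0 <= (Q j)^-1 * ratio ^+ (l - j) by exact: mulr_ge0.
have c2 l j : 0 <= (Q j)^-1 * (ratio ^+ (l - j))^-1 by exact: mulr_ge0.
pose g1 l w := ((Q l)^-1 * a l w ^+ 2)%:E : \bar R.
pose g2 l j w := (((Q j)^-1 * ratio ^+ (l - j) * a j w ^+ 2)%:E : \bar R).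
pose g3 l j w := (((Q j)^-1 * (ratio ^+ (l - j))^-1 * a l w ^+ 2)%:E : \bar R).
have n1 l : nnm (g1 l) by exact: nnm_coef.
have n2 l j : nnm (g2 l j) by exact: nnm_coef.
have n3 l j : nnm (g3 l j) by exact: nnm_coef.
have n23 l : nnm (fun w => \sum_(j < l) (g2 l j w + g3 l j w))%E.
  by apply: nnm_sum => j; exact: nnm_add.
have n123 l : nnm (fun w => g1 l w + \sum_(j < l) (g2 l j w + g3 l j w))%E by exact: nnm_add.
rewrite big_mkord.
under eq_bigr => n _ do rewrite -(int_scale Pr (nf n) (Pl0 n)).
rewrite -(int_sum Pr _ (f := fun (n : 'I_m) w => ((P n)%:E * (f n w)%:E)%E)); last first.
  by move=> n; apply: nnm_mul => //; apply: nnm_cst; rewrite lee_fin.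
apply: (@le_trans _ _ (\int[Pr]_w \sum_(l < m)
    (g1 l w + \sum_(j < l) (g2 l j w + g3 l j w)))%E).
  apply: int_le.
  - apply: nnm_sum => n.
    by apply: nnm_mul => //; apply: nnm_cst; rewrite lee_fin.
  - by apply: nnm_sum => l.
  move=> w; rewrite [leLHS](_ : _ = (\sum_(n < m) P n * f n w)%:E); last by rewrite -sumEFin.
  rewrite [leRHS](_ : _ = (\sum_(l < m) ((Q l)^-1 * a l w ^+ 2 + \sum_(j < l)
    ((Q j)^-1 * ratio ^+ (l - j) * a j w ^+ 2 +
     (Q j)^-1 * (ratio ^+ (l - j))^-1 * a l w ^+ 2)))%:E); last first.
    by rewrite -sumEFin; apply: eq_bigr => l _; rewrite EFinD -sumEFin.
  rewrite lee_fin.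
  exact: (weighted_squares_le Q0 (tail_massS PP) (a^~ w) m Pl0).
rewrite (int_sum Pr _ (f := fun (l : 'I_m) w =>
      (g1 l w + \sum_(j < l) (g2 l j w + g3 l j w))%E))//.
apply: (@le_trans _ _ (\sum_(l < m) (M * ((Q l)^-1 * nu l + \sum_(j < l)
    ((Q j)^-1 * ratio ^+ (l - j) * nu j + (Q j)^-1 * (ratio ^+ (l - j))^-1 * nu l)))%:E)%E).
  apply: lee_sum => l _; rewrite int_add// mulrDr EFinD; apply: leeD; first exact: int_coef.
  rewrite (int_sum Pr _ (f := fun (j : 'I_l) w => (g2 l j w + g3 l j w)%E)); last first.
    by move=> j; exact: nnm_add.
  rewrite mulr_sumr -sumEFin; apply: lee_sum => j _; rewrite int_add// mulrDr EFinD.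
  by apply: leeD; exact: int_coef.
rewrite sumEFin lee_fin -mulr_sumr; apply: ler_wpM2l => //.
exact: discount_sum_le.
Qed.

(** [L] is independent of the whole family, hence of every partial sum, however the levels depend on
    each other. *)
Lemma coupled_sum_bound :
  (\int[Pr]_w (partial_sum Q (a^~ w) (L w).+1 ^+ 2)%:E <=
   (15 * M)%:E * \sum_(0 <= l <oo) ((Q l)^-1 * nu l)%:E)%E.
Proof.
have h l : 0 <= (Q l)^-1 * nu l by rewrite mulr_ge0// invr_ge0 ltW.
have mS n : measurable_fun setT (fun w => partial_sum Q (a^~ w) n) by exact: meas_partial.
rewrite (int_random_level Pr mL (g := fun n w => partial_sum Q (a^~ w) n.+1 ^+ 2)); last 2 first.
- by move=> l; exact: meas_sqr.
- by move=> l w; exact: sqr_ge0.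
(* The finite truncations are bounded one by one, so the series on the right may be infinite. *)
apply: lime_le.
  by apply: is_cvg_nneseries => n _ _; apply: integral_ge0 => w _; rewrite lee_fin sqr_ge0.
apply: nearW => m.
apply: (@le_trans _ _ (M * (15 * \sum_(l < m) (Q l)^-1 * nu l))%:E).
  apply: le_trans (partial_bound m); rewrite le_eqVlt; apply/orP; left; apply/eqP.
  apply: eq_bigr => n _; apply: int_level => //.
  apply: (meas_partial (T := g_sigma_algebraType G)) => l.
  exact: measurable_generated.
rewrite mulrA (mulrC M) EFinM; apply: lee_wpmul2l; first by rewrite lee_fin mulr_ge0.
rewrite -sumEFin -(big_mkord xpredT (fun l => ((Q l)^-1 * nu l)%:E)).
by apply: nneseries_lim_ge => l _ _; rewrite lee_fin.
Qed.

End randomized_estimators.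

(** * Uniform constants and norms of test functions *)

Section uniform_constants.
Context {R : realType}.

Lemma finite_uniform (I : finType) (T : Type) (f : I -> T -> R) (g : T -> R) :
  (forall t, 0 <= g t) ->
  (forall i, exists2 K, 0 <= K & forall t, f i t <= K * g t) ->
  exists2 K, 0 <= K & forall i t, f i t <= K * g t.
Proof.
move=> g0 fK.
have /choice[k hk] : forall i, exists K, 0 <= K /\ forall t, f i t <= K * g t.
  by move=> i; have [K K0 h] := fK i; exists K.
exists (\sum_i k i) => [|i t]; first by apply: sumr_ge0 => i _; case: (hk i).
have [_ h] := hk i; apply: (le_trans (h t)); apply: ler_wpM2r => //.
by rewrite (bigD1 i)//= lerDl; apply: sumr_ge0 => j _; case: (hk j).
Qed.

Context (n : nat).
Local Notation vec := (n.-tuple R).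

Lemma finite_lipschitz (I : finType) (f : I -> vec -> R) :
  (forall i, lipschitz2 (f i)) ->
  exists2 K, 0 <= K & forall i x y, (f i x - f i y) ^+ 2 <= K * d2 x y.
Proof.
move=> fL; have [K K0 h] := @finite_uniform I (vec * vec) (fun i p => (f i p.1 - f i p.2) ^+ 2)
  (fun p => d2 p.1 p.2) (fun p => d2_ge0 p.1 p.2)
  (fun i => let: ex_intro2 K K0 h := lipschitz_sqr (fL i) in
    ex_intro2 _ _ K K0 (fun p => h p.1 p.2)).
by exists K => // i x y; exact: (h i (x, y)).
Qed.

Lemma finite_bounded (I : finType) (f : I -> vec -> R) :
  (forall i, bounded_real (f i)) ->
  exists2 K, 0 <= K & forall i x, `|f i x| <= K.
Proof.
move=> fB; have [|i|K K0 h] := @finite_uniform I vec (fun i x => `|f i x|) (fun=> 1).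
- by [].
- have [M hM] := fB i; exists M => [|x]; last by rewrite mulr1.
  (* The value at the origin shows that the bound is nonnegative. *)
  by apply: le_trans (hM [tuple 0 | _ < n]).
by exists K => // i x; rewrite -[K]mulr1.
Qed.

End uniform_constants.

Section test_functions.
Context {R : realType} (n : nat) (phi : n.-tuple R -> R).

Lemma le_sup_norm x : bounded_real phi -> `|phi x| <= sup_norm phi.
Proof.
move=> [M hM]; apply: ub_le_sup; last by exists x.
by exists M => _ [y _ <-]; exact: hM.
Qed.

Lemma edist_eq0 (x y : n.-tuple R) : Defs.edist x y = 0 -> x = y.
Proof.
move=> e; have : d2 x y = 0 by rewrite -edist_sq e expr0n.
move=> /eqP; rewrite psumr_eq0 => [/allP h|i _]; last exact: sqr_ge0.
apply: eq_from_tnth => i; have := h i (mem_index_enum _).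
by rewrite /= sqrf_eq0 subr_eq0 => /eqP.
Qed.

Lemma lip_const_bounds : lipschitz2 phi ->
  0 <= lip_const phi /\ forall x y, `|phi x - phi y| <= lip_const phi * Defs.edist x y.
Proof.
move=> [K hK].
pose S := [set r | exists x y : n.-tuple R, x <> y /\ r = `|phi x - phi y| / Defs.edist x y].
have Sub : has_ubound S.
  exists K => _ [x [y [xy ->]]].
  have d0 : 0 < Defs.edist x y.
    by rewrite lt0r edist_ge0 andbT; apply/eqP => /edist_eq0.
  by rewrite ler_pdivrMr.
have L0 : 0 <= lip_const phi.
  (* In dimension zero there are no distinct points and the supremum of the empty set is [0]. *)
  have [S0|/set0P[r Sr]] := eqVneq S set0; first by rewrite /lip_const -/S S0 sup0.
  apply: le_trans (ub_le_sup Sub Sr); have [x [y [_ ->]]] := Sr.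
  by rewrite divr_ge0// edist_ge0.
split=> // x y; have [->|xy] := eqVneq x y.
  by rewrite subrr normr0 mulr_ge0// edist_ge0.
have d0 : 0 < Defs.edist x y.
  by rewrite lt0r edist_ge0 andbT; apply: contra xy => /eqP/edist_eq0 ->.
rewrite -ler_pdivrMr//; apply: ub_le_sup => //; exists x, y; split=> //.
by apply/eqP.
Qed.

End test_functions.

Section estimates_measurable.
Context {R : realType} (dx dy : nat) d (Om : measurableType d) (Pr : probability Om R)
  (Y : R -> Om -> dy.-tuple R) (xstar : dx.-tuple R) (h : dx.-tuple R -> dy.-tuple R)
  (b : dx.-tuple R -> dx.-tuple R) (sigma : dx.-tuple R -> 'M[R]_dx).
Context (N : nat) (F : filters R dx N Om).
Hypothesis BM : standard_brownian_motion Pr Y.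
Hypothesis runs : runs_filters xstar h b sigma Pr Y F.
Hypothesis mh : forall i, measurable_fun setT (fun x => tnth (h x) i).

Lemma measurable_gamma_estimate l t (u : nat -> 'I_N -> Om -> level_path R dx l) phi :
  (forall p i, measurable_fun setT (u p i)) -> measurable_fun setT phi ->
  measurable_fun setT (fun w => gamma_estimate h (data Y w) t (fun p i => u p i w) phi).
Proof.
move=> mu mphi.
have mY s : 0 <= s -> measurable_fun setT (Y s) by case: BM => + _ _ _; exact.
have mblock p : measurable_fun setT (block Y l p).
  apply: measurable_tuple => k; under eq_fun do rewrite tnth_mktuple.
  by apply: (measurable_increment (f := id)); apply: mY; rewrite mulr_ge0// ltW// delta_gt0.
have mpot p i : measurable_fun setT (fun w => path_potential h (data Y w) p (u p i w)).
  under eq_fun do rewrite path_potentialE; exact: meas_block_lik.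
apply: measurable_funM.
  by apply: measurable_prod => p _; apply: measurable_funM => //; apply: meas_sum.
apply: measurable_funM => //; apply: meas_sum => i; apply: measurable_funM => //.
by apply: (measurableT_comp mphi); exact: meas_endpoint.
Qed.

Lemma measurable_Psi t phi q : measurable_fun setT phi ->
  measurable_fun setT (Psi h Y F t phi q).
Proof.
have [[mpf _ _] cpf] := runs.
case: q => [|l] mphi; first exact: measurable_gamma_estimate.
have [mcpf _ _ _] := cpf l.
by apply: measurable_funB; apply: measurable_gamma_estimate => // p i; case: (mcpf p i).
Qed.

End estimates_measurable.

Theorem proposition4p2 (R : realType) (dx dy : nat)
  (hdx : (0 < dx)%N) (hdy : (0 < dy)%N)
  (xstar : dx.-tuple R)
  (h : dx.-tuple R -> dy.-tuple R)
  (b : dx.-tuple R -> dx.-tuple R)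
  (sigma : dx.-tuple R -> 'M[R]_dx)
  (sigma_nonconstant : exists x y, sigma x <> sigma y)
  (sigma_full_rank : forall x, \rank (sigma x) = dx)
  (sigma_bounded_lipschitz : forall i j,
     bounded_real (fun x => sigma x i j) /\ lipschitz2 (fun x => sigma x i j))
  (a_elliptic : uniformly_elliptic (fun x => sigma x *m (sigma x)^T))
  (h_bounded_lipschitz : forall i,
     bounded_real (fun x => tnth (h x) i) /\ lipschitz2 (fun x => tnth (h x) i))
  (b_bounded_lipschitz : forall j,
     bounded_real (fun x => tnth (b x) j) /\ lipschitz2 (fun x => tnth (b x) j))
  (d : measure_display) (Omega : measurableType d) (Pr : probability Omega R)
  (Y : R -> Omega -> dy.-tuple R)
  (Y_brownian : standard_brownian_motion Pr Y)
  (P : nat -> R) (P_pmf : positive_pmf P) :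
  forall t : nat, (0 < t)%N ->
  exists C : R, forall (N : nat) (phi : dx.-tuple R -> R),
    (0 < N)%N ->
    bounded_real phi -> measurable_fun [set: dx.-tuple R] phi ->
    lipschitz2 phi ->
    forall (F : filters R dx N Omega) (L : Omega -> nat),
      runs_filters xstar h b sigma Pr Y F ->
      is_random_level h Pr Y F P t phi L ->
      ('E_Pr[fun w => (single_term h Y F P L t phi w ^+ 2)%R]
       <= (C * (sup_norm phi + lip_const phi) ^+ 2)%:E *
          \sum_(0 <= l <oo)
            ((P l)^-1 * (Num.sqrt (delta R l) / N%:R + delta R l))%:E)%E /\
      ('E_Pr[fun w =>
               (coupled_sum h Y F (tail_mass P) L t phi w ^+ 2)%R]
       <= (C * (sup_norm phi + lip_const phi) ^+ 2)%:E *
          \sum_(0 <= l <oo)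
            ((tail_mass P l)^-1 *
             (Num.sqrt (delta R l) / N%:R + delta R l))%:E)%E.
Proof.
case=> [//|p] _.
have [Kb Kb0 hKb] := finite_lipschitz (fun j => (b_bounded_lipschitz j).2).
have [Mb Mb0 hMb] := finite_bounded (fun j => (b_bounded_lipschitz j).1).
have [Ks Ks0 hKs] := @finite_lipschitz R dx ('I_dx * 'I_dx)%type (fun ij x => sigma x ij.1 ij.2)
  (fun ij => (sigma_bounded_lipschitz ij.1 ij.2).2).
have [Ms Ms0 hMs] := @finite_bounded R dx ('I_dx * 'I_dx)%type (fun ij x => sigma x ij.1 ij.2)
  (fun ij => (sigma_bounded_lipschitz ij.1 ij.2).1).
have [Kh Kh0 hKh] := finite_lipschitz (fun i => (h_bounded_lipschitz i).2).
have [H H0 hH] := finite_bounded (fun i => (h_bounded_lipschitz i).1).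
have hH' x i : `|tnth (h x) i| <= H by exact: hH.
have hK' x y i : (tnth (h x) i - tnth (h y) i) ^+ 2 <= Kh * d2 x y by exact: hKh.
pose K := Kb + Ks + Mb ^+ 2 + Ms ^+ 2.
have sqr_le (M x : R) : `|x| <= M -> x ^+ 2 <= M ^+ 2.
  move=> xM; rewrite -real_normK ?num_real//; apply: lerXn2r; rewrite ?nnegrE//.
  by apply: le_trans xM.
have Mb2 := sqr_ge0 Mb; have Ms2 := sqr_ge0 Ms.
have reg : euler_regular b sigma K.
  split; last first.
    split=> [i|i j]; apply: lipschitz_measurable; first by case: (b_bounded_lipschitz i).
    by case: (sigma_bounded_lipschitz i j).
  split.
  - by rewrite /K; lra.
  - move=> x y i; apply: (le_trans (hKb i x y)); apply: ler_wpM2r; first exact: d2_ge0.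
    by rewrite /K; lra.
  - move=> x y i j; apply: (le_trans (hKs (i, j) x y)); apply: ler_wpM2r; first exact: d2_ge0.
    by rewrite /K; lra.
  - by move=> x i; apply: (le_trans (sqr_le _ _ (hMb i x))); rewrite /K; lra.
  - by move=> x i j; apply: (le_trans (sqr_le _ _ (hMs (i, j) x))); rewrite /K; lra.
have mh i : measurable_fun setT (fun x => tnth (h x) i).
  by apply: lipschitz_measurable; case: (h_bounded_lipschitz i).
pose c1 := lik_cst dy H; pose c2 := path_cst dx dy K H Kh.
have c10 : 0 <= c1 by exact: lik_cst_ge0.
have c20 : 0 <= c2 by exact: (path_cst_ge0 dy H reg Kh0).
(* The first summand serves level 0, the second the coupled levels, with the [4] of
   [test_pair_test]. *)
pose C0 := c1 ^+ p.+1 + 4 * estimate_cst c1 c2 p.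
have e0 : 0 <= estimate_cst c1 c2 p by exact: estimate_cst_ge0.
have c1p : 0 <= c1 ^+ p.+1 by exact: exprn_ge0.
have C00 : 0 <= C0 by rewrite /C0; lra.
(* The factor [15] is that of [coupled_sum_bound]; the single term estimator needs only [C0]. *)
exists (15 * C0) => N phi N0 bphi mphi lphi F L runs [mL PL indep].
have [L0 phiL] := lip_const_bounds lphi.
have phis x := le_sup_norm x bphi.
have s0 : 0 <= sup_norm phi by apply: le_trans (phis xstar).
set s := sup_norm phi in phis s0 *; set Lp := lip_const phi in L0 phiL *.
have mPsi q := measurable_Psi Y_brownian runs mh p.+1 q mphi.
pose M := C0 * (s + Lp) ^+ 2.
have sq0 : 0 <= (s + Lp) ^+ 2 by exact: sqr_ge0.
have M0 : 0 <= M by exact: mulr_ge0.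
have nu0 := @level_rate_ge0 R N.
have Psi_sqr q : (\int[Pr]_w (Psi h Y F p.+1 phi q w ^+ 2)%:E <= (M * level_rate N q)%:E)%E.
  case: q => [|l].
    apply: (le_trans (pf_second_moment Y_brownian runs reg mh hH' N0 p mphi phis)).
    rewrite lee_fin /M; apply: (@le_trans _ _ (C0 * (s + Lp) ^+ 2 * 1)); last first.
      by apply: ler_wpM2l => //; exact: level_rate0.
    rewrite mulr1; apply: ler_pM => //; first exact: sqr_ge0.
      by rewrite /C0; lra.
    by apply: lerXn2r; rewrite ?nnegrE; lra.
  apply: (le_trans (cpf_second_moment Y_brownian runs reg mh hH' hK' Kh0 N0 l p mphi s0 L0 phis phiL)).
  rewrite lee_fin -/c1 -/c2 -/(level_rate N l.+1); apply: ler_wpM2r; first exact: nu0.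
  by rewrite mulrA; apply: ler_wpM2r => //; rewrite /C0; lra.
have Psi_events q : generated_by (Psi h Y F p.+1 phi q) `<=`
    process_events Y [set s | 0 <= s] `|`
      [set A | exists q, generated_by (Psi h Y F p.+1 phi q) A].
  by move=> A PA; right; exists q.
rewrite unlock; split.
  have := single_term_bound P_pmf mL PL mPsi Psi_events indep nu0 Psi_sqr.
  move=> /le_trans; apply; apply: lee_wpmul2r.
    apply: nneseries_ge0 => l _ _; rewrite lee_fin; apply: mulr_ge0; last exact: nu0.
    by rewrite invr_ge0 ltW//; case: P_pmf.
  by rewrite lee_fin -mulrA -/M; lra.
have := coupled_sum_bound P_pmf mL PL mPsi Psi_events indep M0 nu0 Psi_sqr (@level_rateS R N).
rewrite /M [15 * (C0 * _)]mulrA; apply: le_trans.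
rewrite le_eqVlt; apply/orP; left; apply/eqP; apply: eq_integral => w _; congr ((_ ^+ 2)%:E).
(* The separate level 0 term of the coupled sum is the [l = 0] term of the partial sum, because the
   tail mass at [0] is one. *)
rewrite /coupled_sum /partial_sum -(big_mkord xpredT (fun l => Psi h Y F p.+1 phi l w / tail_mass P l)).
by rewrite big_ltn// (tail_mass0 P_pmf) divr1.
Qed.
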